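(* There exists an algorithm that, given an undirected weighted graph $G$ with $n$ vertices and two vertices $s,t$, for all edges $d_1,d_2,d_3\in\pi_G(s,t)$, outputs $|\pi_{G-\{d_1,d_2,d_3\}}(s,t)|$, in total time $\tilde{O}(n^3)$.
   Context: $\pi_{G'}(u,v)$ denotes the (unique) shortest $u$-$v$ path in a graph $G'$, $|P|$ the length of a path $P$, and $G-F$ the graph with the edges in $F$ removed. $\tilde{O}(\cdot)$ hides polylogarithmic factors in $n$. *)

(* Defs.v *)
From HB Require Import structures.
From mathcomp Require Import all_boot all_order all_algebra.
From mathcomp Require Import reals constructive_ereal.

Set Implicit Arguments.
Unset Strict Implicit.
Unset Printing Implicit Defensive.

Import Order.TTheory GRing.Theory Num.Theory.
Local Open Scope ring_scope.

(* Finite simple undirected graphs on 'I_n; an edge is a two-element set of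
   vertices.  [weight] is irrelevant outside [edges]. *)
Record wgraph (R : realType) (n : nat) := WGraph {
  edges : {set {set 'I_n}};
  weight : {set 'I_n} -> R;
  edges_card2 : forall d, d \in edges -> #|d| = 2%N;
  weight_ge0 : forall d, d \in edges -> 0 <= weight d }.

Section Graphs.
Variables (R : realType) (n : nat).
Implicit Types (G : wgraph R n) (u v : 'I_n) (p : seq 'I_n).

Lemma remove_card2 G (F : {set {set 'I_n}}) d :
  d \in edges G :\: F -> #|d| = 2%N.
Proof. by case/setDP => /edges_card2. Qed.

Lemma remove_weight_ge0 G (F : {set {set 'I_n}}) d :
  d \in edges G :\: F -> 0 <= weight G d.
Proof. by case/setDP => /weight_ge0. Qed.

Definition remove G (F : {set {set 'I_n}}) : wgraph R n :=
  WGraph (@remove_card2 G F) (@remove_weight_ge0 G F).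

Definition adj G : rel 'I_n := fun u v => [set u; v] \in edges G.

(* As in path.v, the path with first vertex u and remaining vertices p. *)
Definition path_edges u p : seq {set 'I_n} :=
  [seq [set e.1; e.2] | e <- zip (u :: p) p].

Definition path_length G u p : R := \sum_(d <- path_edges u p) weight G d.

Definition is_path G u v p : bool :=
  [&& path (adj G) u p, last u p == v & uniq (u :: p)].

Definition shortest_path G u v p : Prop :=
  is_path G u v p /\
  forall q, is_path G u v q -> path_length G u p <= path_length G u q.

(* d is the length of a shortest u-v path, with the usual convention that it
   is +oo when v is not reachable from u. *)
Definition is_dist G u v (d : \bar R) : Prop :=
  (exists2 p, shortest_path G u v p & d = (path_length G u p)%:E) \/
  ((forall p, ~~ is_path G u v p) /\ d = +oo%E).

End Graphs.

(* Word RAM with real-valued weights.  A program uses finitely many integer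
   arrays and finitely many weight arrays, both named by constants.  Integers
   are machine words; weights can only be copied, added, subtracted and
   compared. *)
Inductive iexp :=
  | ILit of nat
  | IGet of nat & iexp
  | IAdd of iexp & iexp
  | ISub of iexp & iexp
  | IMul of iexp & iexp
  | IDiv of iexp & iexp
  | IMod of iexp & iexp.

Inductive wexp :=
  | WZero
  | WInfty
  | WGet of nat & iexp
  | WAdd of wexp & wexp
  | WSub of wexp & wexp.

Inductive bexp :=
  | BILe of iexp & iexp
  | BWLe of wexp & wexp
  | BNot of bexp
  | BAnd of bexp & bexp.

(* IPut a i e and WPut a i e store e in cell i of array a. *)
Inductive cmd :=
  | Skip
  | IPut of nat & iexp & iexp
  | WPut of nat & iexp & wexp
  | Seq of cmd & cmd
  | If of bexp & cmd & cmd
  | While of bexp & cmd.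

Section Machine.
Variable R : realType.

Record state := State {
  imem : nat -> nat -> nat;
  wmem : nat -> nat -> \bar R }.

Definition upd (T : Type) (m : nat -> nat -> T) (a i : nat) (x : T) :=
  fun b j => if (b == a) && (j == i) then x else m b j.

(* Integers, hence also addresses, must remain below W; evaluation is
   undefined (None) when an integer operand or result overflows. *)
Variable W : nat.

Definition word (x : nat) : option nat := if (x < W)%N then Some x else None.

Definition lift2 (A B C : Type) (f : A -> B -> option C)
    (x : option A) (y : option B) : option C :=
  obind (fun a => obind (f a) y) x.

Fixpoint ieval (st : state) (e : iexp) : option nat :=
  match e with
  | ILit k => word k
  | IGet a i => obind (fun j => word (imem st a j)) (ieval st i)
  | IAdd e1 e2 => lift2 (fun x y => word (x + y)%N) (ieval st e1) (ieval st e2)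
  | ISub e1 e2 => lift2 (fun x y => word (x - y)%N) (ieval st e1) (ieval st e2)
  | IMul e1 e2 => lift2 (fun x y => word (x * y)%N) (ieval st e1) (ieval st e2)
  | IDiv e1 e2 => lift2 (fun x y => word (x %/ y)%N) (ieval st e1) (ieval st e2)
  | IMod e1 e2 => lift2 (fun x y => word (x %% y)%N) (ieval st e1) (ieval st e2)
  end.

Fixpoint weval (st : state) (e : wexp) : option (\bar R) :=
  match e with
  | WZero => Some 0%E
  | WInfty => Some +oo%E
  | WGet a i => omap (wmem st a) (ieval st i)
  | WAdd e1 e2 => lift2 (fun x y => Some (x + y)%E) (weval st e1) (weval st e2)
  | WSub e1 e2 => lift2 (fun x y => Some (x - y)%E) (weval st e1) (weval st e2)
  end.

Fixpoint beval (st : state) (b : bexp) : option bool :=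
  match b with
  | BILe e1 e2 => lift2 (fun x y => Some (x <= y)%N) (ieval st e1) (ieval st e2)
  | BWLe e1 e2 => lift2 (fun x y => Some (x <= y)%E) (weval st e1) (weval st e2)
  | BNot b1 => omap negb (beval st b1)
  | BAnd b1 b2 => lift2 (fun x y => Some (x && y)) (beval st b1) (beval st b2)
  end.

(* exec c st k st': started in st, c halts in st' after k steps.  A step is a
   store or a test; the expressions it evaluates have constant size, being
   part of the program. *)
Inductive exec : cmd -> state -> nat -> state -> Prop :=
  | ExecSkip st : exec Skip st 0 st
  | ExecIPut st a i e j x :
      ieval st i = Some j -> ieval st e = Some x ->
      exec (IPut a i e) st 1 (State (upd (imem st) a j x) (wmem st))
  | ExecWPut st a i e j x :
      ieval st i = Some j -> weval st e = Some x ->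
      exec (WPut a i e) st 1 (State (imem st) (upd (wmem st) a j x))
  | ExecSeq st c1 k1 st1 c2 k2 st2 :
      exec c1 st k1 st1 -> exec c2 st1 k2 st2 ->
      exec (Seq c1 c2) st (k1 + k2) st2
  | ExecIfTrue st b c1 c2 k st1 :
      beval st b = Some true -> exec c1 st k st1 ->
      exec (If b c1 c2) st k.+1 st1
  | ExecIfFalse st b c1 c2 k st1 :
      beval st b = Some false -> exec c2 st k st1 ->
      exec (If b c1 c2) st k.+1 st1
  | ExecWhileTrue st b c k1 st1 k2 st2 :
      beval st b = Some true -> exec c st k1 st1 ->
      exec (While b c) st1 k2 st2 ->
      exec (While b c) st (k1 + k2).+1 st2
  | ExecWhileFalse st b c :
      beval st b = Some false -> exec (While b c) st 1 st.

(* Integer array 0 holds n, s, t; weight array 0 holds the weighted adjacency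
   matrix in row-major order, with +oo for a non-edge.  All else is 0. *)
Definition input (n : nat) (G : wgraph R n) (s t : 'I_n) : state :=
  State
    (fun a i => if a == 0%N then nth 0%N [:: n; nat_of_ord s; nat_of_ord t] i
                else 0%N)
    (fun a i =>
       if [pick e : 'I_n * 'I_n | (a == 0%N) && (i == e.1 * n + e.2)%N]
         is Some (u, v)
       then if adj G u v then (weight G [set u; v])%:E else +oo%E
       else 0%E).

(* Cell 0 of integer array 1 holds the number of edges of the path, integer
   array 2 its successive vertices. *)
Definition outputs_path (n : nat) (st : state) (s : 'I_n) (p : seq 'I_n) :
    Prop :=
  imem st 1 0 = size p /\
  forall i, (i <= size p)%N -> imem st 2 i = nth s (s :: p) i.

(* The value for a triple of edges of the path is stored in weight array 1,
   viewed as an n * n * n table indexed by the positions of the edges. *)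
Definition output_at (n : nat) (st : state) (s : 'I_n) (p : seq 'I_n)
    (d1 d2 d3 : {set 'I_n}) : \bar R :=
  let pos d := index d (path_edges s p) in
  wmem st 1 ((pos d1 * n + pos d2) * n + pos d3).

End Machine.

(* T = O~(g): T(n) = O(g(n) log^k n) for some k. *)
Definition soft_O (T g : nat -> nat) : Prop :=
  exists C k n0 : nat,
    forall n, (n0 <= n)%N -> (T n <= C * (g n * trunc_log 2 n ^ k))%N.

(* Main.v *)
Require Import Defs.
From mathcomp Require Import all_boot all_order all_algebra.
From mathcomp Require Import reals constructive_ereal.
From mathcomp Require Import zify lra.

Set Implicit Arguments.
Unset Strict Implicit.
Unset Printing Implicit Defensive.

Import Order.TTheory GRing.Theory Num.Theory.
Local Open Scope ring_scope.

(* Let P be the shortest s-t path found by the algorithm, and let M be the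
   all-pairs distances in G minus the edges of P.  A path that avoids edges
   i < j < k of P alternates between jumps, measured by M, and travels inside the
   four segments A, B, C, D of P left by i, j, k; every segment is itself a
   shortest path and can be walked in both directions, so each is visited once.

   First fix i and k only, and let y be the entry and z the exit of a shortest
   path avoiding them in the segment ]i, k].  It is a path of G - {i, j, k}
   unless j separates y from z.  If it does, then positions on y's side of j keep
   their distance from s and positions on z's side keep their distance to t, so
   an optimal path leaves y's side (or A) at some p and enters z's side (or D) at
   some q by one jump.  If p lies between y and j, its distance from s is that of
   y plus a travel; otherwise p lies beyond y, in a range that does not depend on
   j; likewise for q.  In each of the four cases the minimum over p and q is read
   off tables with three indices, the ranges being handled by sparse tables,
   whence the time O(n^3 log n).

   A value is specified by its upper bounds: x represents P : R -> Prop when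
   x <= r is equivalent to P r for all real r.  Since P says that some walk has
   length at most r, arguments about minima become arguments about walks, and
   infinite distances need no separate treatment. *)

(** * Table programs *)

(** Three indices suffice because a jump with neither end next to [j] is governed by [i] and [k]
    alone, a jump with one end between [j] and [y] or [z] by [i], [k] and [j], and a jump with both
    ends there by [j], [y] and [z], which index a table of their own. The obstacle is the distance
    from s to a position beyond [y]: in G - {i, j, k} it depends on too much. It is replaced by
    [sgp], the distance avoiding [i] alone, whose walks may use edges [j] and [k]. This never makes
    the total too small: a walk that enters []i, k]] on the wrong side of [j] costs no less than one
    entering at [y], because the route through [y] and [z] is optimal, and a walk that has got
    beyond [k] may go straight to t instead. The same holds for [tgp] on the other side. Weights may
    be 0 and the path is padded to n positions. Hence two positions can have the same [pos], or even
    name the same vertex, and only edges called genuine are cut. *)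

Definition nn := IGet 0 (ILit 0).
Definition cnt := IGet 3 (ILit 0).

(** The computation of one cell is a loop-free decision tree, so a cell costs at most [depth] steps
    and the only loops of the program are those of [fill]. *)
Inductive tree :=
  | LW of wexp
  | LI of iexp
  | Br of bexp & tree & tree.

(* A table is filled cell by cell in increasing order. *)
Record table := Table { tid : nat; tbound : iexp; tbody : tree }.

Fixpoint store (a : nat) (t : tree) : cmd :=
  match t with
  | LW e => WPut a cnt e
  | LI e => IPut a cnt e
  | Br b t1 t2 => If b (store a t1) (store a t2)
  end.

Definition fill (T : table) : cmd :=
  Seq (IPut 3 (ILit 0) (ILit 0))
    (While (BNot (BILe (tbound T) cnt))
       (Seq (store (tid T) (tbody T)) (IPut 3 (ILit 0) (IAdd cnt (ILit 1))))).

Definition fill_all (l : seq table) : cmd := foldr (fun T => Seq (fill T)) Skip l.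

Fixpoint depth (t : tree) : nat :=
  if t is Br _ t1 t2 then (maxn (depth t1) (depth t2)).+1 else 1.

Fixpoint is_wtree (t : tree) : bool :=
  match t with LW _ => true | LI _ => false
  | Br _ t1 t2 => is_wtree t1 && is_wtree t2 end.

Fixpoint is_itree (t : tree) : bool :=
  match t with LW _ => false | LI _ => true
  | Br _ t1 t2 => is_itree t1 && is_itree t2 end.

Fixpoint iarrays (e : iexp) : seq nat :=
  match e with
  | ILit _ => [::]
  | IGet a x => a :: iarrays x
  | IAdd x y | ISub x y | IMul x y | IDiv x y | IMod x y => iarrays x ++ iarrays y
  end.

(* An expression of degree d has value below (n + 2)^d, provided that the cells
   of array 0 are below n + 2 and all other cells are below (n + 2)^5. *)
Fixpoint deg (e : iexp) : nat :=
  match e with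
  | ILit k => k
  | IGet a _ => if a == 0%N then 1 else 5
  | IAdd x y => (maxn (deg x) (deg y)).+1
  | ISub x _ => deg x
  | IMul x y => deg x + deg y
  | IDiv x _ => deg x
  | IMod _ (IGet 0 (ILit 0)) => 1
  | IMod x _ => deg x
  end.

(** * Evaluation of expressions without overflow *)

Section Exec.
Variables (R : realType) (c : nat).
Implicit Types (st : state R).

Fixpoint ifits (e : iexp) : bool :=
  (deg e <= c)%N &&
  match e with
  | ILit _ => true
  | IGet _ x => (5 <= c)%N && ifits x
  | IAdd x y | ISub x y | IMul x y | IDiv x y | IMod x y => ifits x && ifits y
  end.

Fixpoint wfits (e : wexp) : bool :=
  match e with
  | WZero | WInfty => true
  | WGet _ x => ifits x
  | WAdd x y | WSub x y => wfits x && wfits y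
  end.

Fixpoint bfits (b : bexp) : bool :=
  match b with
  | BILe x y => ifits x && ifits y
  | BWLe x y => wfits x && wfits y
  | BNot b => bfits b
  | BAnd b1 b2 => bfits b1 && bfits b2
  end.

Fixpoint tfits (t : tree) : bool :=
  match t with
  | LW e => wfits e
  | LI e => ifits e && (deg e <= 5)%N
  | Br b t1 t2 => [&& bfits b, tfits t1 & tfits t2]
  end.

(** Total evaluation, without overflow checks: the tables are specified with it, and the degree
    bounds transfer the result to the machine. *)
Fixpoint iden st (e : iexp) : nat :=
  match e with
  | ILit k => k
  | IGet a i => imem st a (iden st i)
  | IAdd e1 e2 => (iden st e1 + iden st e2)%N
  | ISub e1 e2 => (iden st e1 - iden st e2)%N
  | IMul e1 e2 => (iden st e1 * iden st e2)%N
  | IDiv e1 e2 => (iden st e1 %/ iden st e2)%N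
  | IMod e1 e2 => (iden st e1 %% iden st e2)%N
  end.

Fixpoint wden st (e : wexp) : \bar R :=
  match e with
  | WZero => 0%E
  | WInfty => +oo%E
  | WGet a i => wmem st a (iden st i)
  | WAdd e1 e2 => (wden st e1 + wden st e2)%E
  | WSub e1 e2 => (wden st e1 - wden st e2)%E
  end.

Fixpoint bden st (b : bexp) : bool :=
  match b with
  | BILe e1 e2 => (iden st e1 <= iden st e2)%N
  | BWLe e1 e2 => (wden st e1 <= wden st e2)%E
  | BNot b1 => ~~ bden st b1
  | BAnd b1 b2 => bden st b1 && bden st b2
  end.

Fixpoint wval st (t : tree) : \bar R :=
  match t with
  | LW e => wden st e
  | LI _ => 0%E
  | Br b t1 t2 => if bden st b then wval st t1 else wval st t2
  end.

Fixpoint ival st (t : tree) : nat :=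
  match t with
  | LW _ => 0
  | LI e => iden st e
  | Br b t1 t2 => if bden st b then ival st t1 else ival st t2
  end.

Variable n : nat.
Hypothesis n_gt0 : (0 < n)%N.
Hypothesis c_ge6 : (6 <= c)%N.
Local Notation q := n.+2.
Local Notation W := (q ^ c)%N.

Definition good st := [/\ imem st 0 0 = n, forall i, (imem st 0 i < q)%N &
  forall a i, (imem st a i < q ^ 5)%N].

Lemma ieval_ok st e : good st -> ifits e ->
  ieval W st e = Some (iden st e) /\ (iden st e < q ^ deg e)%N.
Proof.
move=> [n0 m0 m5].
have W5 k : (k <= c)%N -> forall x, (x < q ^ k)%N -> word W x = Some x.
  move=> kc x xk; rewrite /word (leq_trans xk) // leq_pexp2l //.
elim: e => [k|a i IHi|x IHx y IHy|x IHx y IHy|x IHx y IHy|x IHx y IHy|x IHx y IHy] /=.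
- rewrite andbT => kc.
  have kq : (k < q ^ k)%N.
    case: (k) => [|k'] //.
    by apply: (leq_trans (ltn_expl k'.+1 (isT : 1 < 2)%N)); rewrite leq_exp2r.
  by split=> //; apply: W5 kq.
- move=> /andP[ac /andP[c5 fi]]; have [-> _] := IHi fi; rewrite /=.
  have := m5 a (iden st i) => h5; split; first by apply: W5 h5.
  by case: eqP => [->|_] //; rewrite expn1.
- move=> /andP[dc /andP[/IHx[-> hx] /IHy[-> hy]]] /=.
  have hxy : (iden st x + iden st y < q ^ (maxn (deg x) (deg y)).+1)%N.
    rewrite expnS.
    have h1 : (iden st x < q ^ maxn (deg x) (deg y))%N by rewrite (leq_trans hx) // leq_pexp2l // leq_maxl.
    have h2 : (iden st y < q ^ maxn (deg x) (deg y))%N by rewrite (leq_trans hy) // leq_pexp2l // leq_maxr.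
    by move: h1 h2; set z := (q ^ _)%N; nia.
  by split=> //; apply: W5 hxy.
- move=> /andP[dc /andP[/IHx[-> hx] /IHy[-> hy]]] /=.
  have hxy : (iden st x - iden st y < q ^ deg x)%N by apply: leq_ltn_trans hx; apply: leq_subr.
  by split=> //; apply: W5 hxy.
- move=> /andP[dc /andP[/IHx[-> hx] /IHy[-> hy]]] /=.
  have hxy : (iden st x * iden st y < q ^ (deg x + deg y))%N by rewrite expnD ltn_mul.
  by split=> //; apply: W5 hxy.
- move=> /andP[dc /andP[/IHx[-> hx] /IHy[-> hy]]] /=.
  have hxy : (iden st x %/ iden st y < q ^ deg x)%N by apply: leq_ltn_trans hx; apply: leq_div.
  by split=> //; apply: W5 hxy.
- move=> /andP[dc /andP[fx fy]]; have [-> hx] := IHx fx; have [-> hy] := IHy fy.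
  have hm : (iden st x %% iden st y < q ^ deg x)%N by apply: leq_ltn_trans hx; apply: leq_mod.
  have hc : (deg x <= c)%N by move: fx; case: (x) => [?|? ?|? ?|? ?|? ?|? ?|? ?] /andP[].
  rewrite /=; split; first by apply: W5 hm.
  case: y hm {IHy fy hy dc} => [k|[|a] [[|k]|a' i|x1 x2|x1 x2|x1 x2|x1 x2|x1 x2]|x1 x2|x1 x2|x1 x2|x1 x2|x1 x2] //= _.
  by rewrite n0 expn1; apply: (leq_trans (ltn_pmod _ n_gt0)); rewrite leqW.
Qed.

Lemma weval_ok st e : good st -> wfits e -> weval W st e = Some (wden st e).
Proof.
move=> gs; elim: e => //= [a i fi|x IHx y IHy|x IHx y IHy].
- by have [-> _] := ieval_ok gs fi.
- by move=> /andP[/IHx-> /IHy->].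
- by move=> /andP[/IHx-> /IHy->].
Qed.

Lemma beval_ok st b : good st -> bfits b -> beval W st b = Some (bden st b).
Proof.
move=> gs; elim: b => /= [x y|x y|b IH /IH->|b1 IH1 b2 IH2] //.
- by move=> /andP[fx fy]; rewrite (proj1 (ieval_ok gs fx)) (proj1 (ieval_ok gs fy)).
- by move=> /andP[fx fy]; rewrite (weval_ok gs fx) (weval_ok gs fy).
- by move=> /andP[/IH1-> /IH2->].
Qed.

Definition iset st a i x := State (upd (imem st) a i x) (wmem st).
Definition wset st a i x := State (imem st) (upd (wmem st) a i x).

Lemma good_iset st a i x : good st -> a != 0%N -> (x < q ^ 5)%N -> good (iset st a i x).
Proof.
move=> [h1 h2 h3] a0 x5; split=> /= [|j|b j]; rewrite /upd.
- by rewrite eq_sym (negPf a0).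
- by rewrite eq_sym (negPf a0) /= h2.
- by case: ifP.
Qed.

Lemma store_exec a t st : good st -> a != 0%N -> tfits t -> is_wtree t || is_itree t ->
  exists2 k, (k <= depth t)%N &
    exec W (store a t) st k
      (if is_wtree t then wset st a (imem st 3 0) (wval st t)
       else iset st a (imem st 3 0) (ival st t)) /\
    (is_itree t -> (ival st t < q ^ 5)%N).
Proof.
move=> gs a0; have cf : ifits cnt by rewrite /= (ltnW c_ge6).
have [ec _] := ieval_ok gs cf.
have main u : (tfits u -> is_wtree u || is_itree u -> exists2 k, (k <= depth u)%N &
    exec W (store a u) st k
      (if is_wtree u then wset st a (imem st 3 0) (wval st u)
       else iset st a (imem st 3 0) (ival st u)) /\
    (is_itree u -> (ival st u < q ^ 5)%N)).
  elim: u => [e|e|b t1 IH1 t2 IH2] /=.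
  - by move=> fe _; exists 1%N => //; split=> //; apply: ExecWPut ec (weval_ok gs fe).
  - move=> /andP[fe d5] _; exists 1%N => //.
    have [ee le] := ieval_ok gs fe; split; first exact: ExecIPut ec ee.
    by move=> _; apply: leq_trans le _; rewrite leq_pexp2l.
  move=> /and3P[fb f1 f2] wi.
  have [w1 w2] : is_wtree t1 || is_itree t1 /\ is_wtree t2 || is_itree t2.
    by case/orP: wi => /andP[-> ->]; rewrite ?orbT.
  have we : (is_wtree t1 = is_wtree t2) /\ (is_itree t1 && is_itree t2 -> is_itree t1 /\ is_itree t2).
    have ex u : is_itree u -> is_wtree u = false by elim: u => //= ? ? H ? ? /andP[/H-> _].
    split; last by case/andP.
    by case/orP: wi => /andP[h1 h2]; rewrite ?h1 ?h2 ?(ex _ h1) ?(ex _ h2).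
  have [k1 l1 [e1 i1]] := IH1 f1 w1; have [k2 l2 [e2 i2]] := IH2 f2 w2.
  have eb := beval_ok gs fb.
  rewrite -we.1 andbb; case: (bden st b) eb => eb.
  - exists k1.+1; first by rewrite ltnS (leq_trans l1) // leq_maxl.
    by split; [apply: ExecIfTrue eb e1 | case/we.2=> /i1].
  - exists k2.+1; first by rewrite ltnS (leq_trans l2) // leq_maxr.
    by split; [rewrite we.1; apply: ExecIfFalse eb e2 | case/we.2=> _ /i2].
exact: main.
Qed.

End Exec.

Definition tablefits (c : nat) (T : table) : bool :=
  [&& tid T != 0%N, tid T != 3%N, tfits c (tbody T),
      is_wtree (tbody T) || is_itree (tbody T), ifits c (tbound T),
      (deg (tbound T) <= 5)%N, 3%N \notin iarrays (tbound T)
    & tid T \notin iarrays (tbound T)].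

(** * Running time and final memory of table programs *)

Section Run.
Variables (R : realType) (c n : nat).
Hypothesis n_gt0 : (0 < n)%N.
Hypothesis c_ge6 : (6 <= c)%N.
Implicit Types (st s F : state R).
Local Notation q := n.+2.
Local Notation W := (q ^ c)%N.

Definition same st s b := forall i, imem st b i = imem s b i /\ wmem st b i = wmem s b i.

Lemma same_trans s2 s1 s3 b : same s1 s2 b -> same s2 s3 b -> same s1 s3 b.
Proof. by move=> h1 h2 i; have [-> ->] := h1 i; apply: h2. Qed.

Lemma same_sym s1 s2 b : same s1 s2 b -> same s2 s1 b.
Proof. by move=> h1 i; have [-> ->] := h1 i. Qed.

Lemma iden_same s1 s2 e :
  (forall b, b \in iarrays e -> same s1 s2 b) -> iden s1 e = iden s2 e.
Proof.
elim: e => //= [a i IH|x IHx y IHy|x IHx y IHy|x IHx y IHy|x IHx y IHy|x IHx y IHy] h.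
- rewrite IH => [|b hb]; last by apply: h; rewrite inE hb orbT.
  by have [] := h a (mem_head _ _) (iden s2 i).
all: by rewrite IHx ?IHy // => b hb; apply: h; rewrite mem_cat hb ?orbT.
Qed.

(* The state in which cell e of table T received its value, compared with a later state F. *)
Record written (F : state R) (T : table) (e : nat) (s : state R) : Prop := Written {
  written_cnt : imem s 3 0 = e;
  written_own : forall i, (i < e)%N ->
    imem s (tid T) i = imem F (tid T) i /\ wmem s (tid T) i = wmem F (tid T) i;
  written_wval : is_wtree (tbody T) -> wmem F (tid T) e = wval s (tbody T);
  written_ival : is_itree (tbody T) -> imem F (tid T) e = ival s (tbody T) }.

Lemma is_itreeN u : is_itree u -> is_wtree u = false.
Proof. by elim: u => //= ? ? H ? ? /andP[/H-> _]. Qed.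

(** The bound is evaluated again at each test; it keeps its value because [tablefits] forbids it to
    read the counter or the array being filled. A cell once written is never rewritten, so it can be
    compared with the final state. *)
Lemma loop_exec T st m e :
  tablefits c T -> good n st -> imem st 3 0 = e -> (e + m)%N = iden st (tbound T) ->
  exists k F, [/\ exec W (While (BNot (BILe (tbound T) cnt))
       (Seq (store (tid T) (tbody T)) (IPut 3 (ILit 0) (IAdd cnt (ILit 1))))) st k F,
    good n F, (k <= m * (depth (tbody T) + 2) + 1)%N,
    (forall b : nat, b != 3%N -> b != tid T -> same F st b)
  & (forall i, (i < e)%N ->
      imem F (tid T) i = imem st (tid T) i /\ wmem F (tid T) i = wmem st (tid T) i) /\
    forall e', (e <= e' < e + m)%N ->
      exists2 s, written F T e' s & forall b : nat, b != 3%N -> b != tid T -> same s F b].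
Proof.
move=> Tf; have /and5P[a0 a3 ft fw /and4P[fb d5 b3 ba]] := Tf.
have c5 : (5 <= c)%N by apply: ltnW.
have c1 : (1 <= c)%N by apply: leq_trans c5.
have fcnt : ifits c cnt by rewrite /= c5.
elim: m st e => [|m IH] st e gs he hm.
  have bt : beval W st (BNot (BILe (tbound T) cnt)) = Some false.
    rewrite (beval_ok n_gt0 c_ge6 gs) /=; last by rewrite fb /= c5.
    by rewrite he -hm addn0 leqnn.
  exists 1%N, st; split=> //; first exact: ExecWhileFalse bt.
  by split=> // e'; rewrite addn0; case: leqP => //=; case: ltnP => //; lia.
have bt : beval W st (BNot (BILe (tbound T) cnt)) = Some true.
  rewrite (beval_ok n_gt0 c_ge6 gs) /=; last by rewrite fb /= c5.
  by rewrite he -hm; congr Some; lia.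
have N5 : (iden st (tbound T) < q ^ 5)%N.
  have [_ h] := ieval_ok n_gt0 c_ge6 gs fb.
  by apply: leq_trans h _; rewrite leq_pexp2l.
have [k1 hk1 [ex1 v1]] := store_exec n_gt0 c_ge6 gs a0 ft fw.
set s1 := (if _ then _ else _) in ex1.
have gs1 : good n s1.
  rewrite /s1; case hw: (is_wtree _) fw => /=; first by [].
  by move=> /v1 v5; apply: good_iset.
have s1b b : b != tid T -> same s1 st b.
  by move=> ba' i; rewrite /s1; case: ifP => _ /=; rewrite /upd (negPf ba').
have s13 : imem s1 3 0 = e by have [-> _] := s1b 3%N (ltac:(by rewrite eq_sym)) 0%N.
have s1o i : i != e ->
    imem s1 (tid T) i = imem st (tid T) i /\ wmem s1 (tid T) i = wmem st (tid T) i.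
  by move=> ie; rewrite /s1; case: ifP => _ /=; rewrite /upd he (negPf ie) andbF.
pose s2 := iset s1 3 0 e.+1.
have ex2 : exec W (IPut 3 (ILit 0) (IAdd cnt (ILit 1))) s1 1 s2.
  apply: ExecIPut.
    by rewrite (proj1 (ieval_ok n_gt0 c_ge6 gs1 _)) //= c1.
  rewrite (proj1 (ieval_ok n_gt0 c_ge6 gs1 _)) /= ?s13 ?addn1 //.
  by rewrite c5 c_ge6 c1.
have gs2 : good n s2 by apply: good_iset => //; lia.
have s2b b : b != 3%N -> same s2 s1 b by move=> b3' i; rewrite /s2 /= /upd (negPf b3').
have s2st b : b != 3%N -> b != tid T -> same s2 st b.
  by move=> h3 ha; apply: same_trans (s2b _ h3) (s1b _ ha).
have hb2 : iden s2 (tbound T) = iden st (tbound T).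
  by apply: iden_same => b hb; apply: s2st; apply: contraTneq hb => ->.
have s2e : imem s2 3 0 = e.+1 by rewrite /s2 /= /upd.
have [|k2 [F [exF gF hk2 fr [own cells]]]] := IH s2 e.+1 gs2 s2e.
  by rewrite hb2 -hm addSnnS.
have Fb b : b != 3%N -> b != tid T -> same F st b.
  by move=> h3 ha; apply: same_trans (fr _ h3 ha) (s2st _ h3 ha).
have a3' : tid T != 3%N by [].
exists (k1 + 1 + k2).+1, F; split=> //.
- by apply: ExecWhileTrue bt _ exF; apply: ExecSeq ex1 ex2.
- by nia.
split=> [i ie|e' /andP[ee' e'm]].
  have [-> ->] := own i (ltnW ie); have [-> ->] := s2b _ a3' i.
  by apply: s1o; rewrite neq_ltn ie.
case: (ltngtP e e') ee' => // [lt _|eq _].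
  by apply: cells; rewrite lt -addSnnS in e'm *.
exists st; last by move=> b h3 ha; apply: same_sym; apply: Fb.
rewrite -eq; have [Fi Fw] := own e (ltnSn e); have [Fi' Fw'] := s2b _ a3' e.
split=> // [i ie|hw|hi].
- have [-> ->] := own i (ltnW ie); have [-> ->] := s2b _ a3' i.
  by have [-> ->] := s1o i (ltac:(by rewrite neq_ltn ie)).
- by rewrite Fw Fw' /s1 hw /= /upd he !eqxx.
- by rewrite Fi Fi' /s1 (is_itreeN hi) /= /upd he !eqxx.
Qed.

Lemma fill_exec T st : tablefits c T -> good n st ->
  exists k F, [/\ exec W (fill T) st k F, good n F,
    (k <= iden F (tbound T) * (depth (tbody T) + 2) + 2)%N,
    (forall b : nat, b != 3%N -> b != tid T -> same F st b)
  & forall e, (e < iden F (tbound T))%N ->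
      exists2 s, written F T e s & forall b : nat, b != 3%N -> b != tid T -> same s F b].
Proof.
move=> Tf gs; have /and5P[a0 a3 ft fw /and4P[fb d5 b3 ba]] := Tf.
pose s1 := iset st 3 0 0.
have ex1 : exec W (IPut 3 (ILit 0) (ILit 0)) st 1 s1.
  by apply: ExecIPut; rewrite (proj1 (ieval_ok n_gt0 c_ge6 gs _)).
have gs1 : good n s1 by apply: good_iset; rewrite ?expn_gt0.
have s1b b : b != 3%N -> same s1 st b by move=> b3' i; rewrite /s1 /= /upd (negPf b3').
have s10 : imem s1 3 0 = 0%N by [].
have [k [F [exF gF hk fr [_ cells]]]] := loop_exec Tf gs1 s10 (add0n _).
have hbF : iden F (tbound T) = iden s1 (tbound T).
  by apply: iden_same => b hb; apply: fr; apply: contraTneq hb => ->.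
exists (1 + k)%N, F; rewrite hbF; split=> //.
- exact: ExecSeq ex1 exF.
- by lia.
- by move=> b h3 ha; apply: same_trans (fr _ h3 ha) (s1b _ h3).
Qed.

(** Each array is filled once and each bound reads completed arrays only, so cells and bounds can
    all be evaluated in the final memory. What the bodies read is checked later, cell by cell,
    through [earlier] and [precedes]. *)
Fixpoint wf_tables (ids : seq nat) (l : seq table) : bool :=
  if l is T :: l' then
    [&& tablefits c T, tid T \notin ids, all (mem ids) (iarrays (tbound T))
      & wf_tables (rcons ids (tid T)) l']
  else true.

Lemma wf_tables_fresh ids l : wf_tables ids l -> forall b : nat, b \in ids -> b \notin map tid l.
Proof.
elim: l ids => //= T l IH ids /and4P[_ Tids _ /IH h] b hb.
rewrite inE negb_or h ?mem_rcons ?inE ?hb ?orbT // andbT.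
by apply: contraNneq Tids => <-.
Qed.

Lemma fill_all_exec ids l st : wf_tables ids l -> 3%N \notin ids -> good n st ->
  exists k F, [/\ exec W (fill_all l) st k F, good n F,
    (k <= \sum_(T <- l) (iden F (tbound T) * (depth (tbody T) + 2) + 2))%N,
    (forall b : nat, b != 3%N -> b \notin map tid l -> same F st b)
  & forall m e, (m < size l)%N -> (e < iden F (tbound (nth (Table 0 (ILit 0) (LI (ILit 0))) l m)))%N ->
    exists2 s, written F (nth (Table 0 (ILit 0) (LI (ILit 0))) l m) e s
      & forall b : nat, b \in ids ++ take m (map tid l) -> same s F b].
Proof.
elim: l ids st => [|T l IH] ids st.
  move=> _ _ gs; exists 0%N, st; split=> //; first exact: ExecSkip.
move=> /= /and4P[Tf Tids Tb wl] ids3 gs.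
have [k1 [s1 [ex1 gs1 hk1 fr1 cells1]]] := fill_exec Tf gs.
have T3 : tid T != 3%N by case/and5P: Tf.
have ids3' : 3%N \notin rcons ids (tid T) by rewrite mem_rcons inE negb_or eq_sym T3.
have [k2 [F [ex2 gF hk2 fr2 cells2]]] := IH _ _ wl ids3' gs1.
have fresh := wf_tables_fresh wl.
have Fs1 b : b \in rcons ids (tid T) -> same F s1 b.
  move=> hb; apply: fr2; last exact: fresh.
  by apply: contraNneq ids3' => <-.
have hb1 : iden F (tbound T) = iden s1 (tbound T).
  apply: iden_same => b /(allP Tb) hb; apply: Fs1.
  by rewrite mem_rcons inE; apply/orP; right.
exists (k1 + k2)%N, F; split=> //.
- exact: ExecSeq ex1 ex2.
- by rewrite big_cons hb1; lia.
- move=> b b3; rewrite inE negb_or => /andP[bT bl].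
  exact: same_trans (fr2 _ b3 bl) (fr1 _ b3 bT).
case=> [|m] e /= hm; last first.
  by move=> /(cells2 _ _ hm)[s h1 h2]; exists s => // b; rewrite -cat_rcons => /h2.
rewrite hb1 => /cells1 [s [w1 w2 w3 w4] hs]; exists s; last first.
  move=> b; rewrite cats0 => hb; apply: same_trans (hs b _ _) _.
  - by apply/eqP => bE; move: ids3; rewrite -bE hb.
  - by apply/eqP => bE; move: Tids; rewrite -bE hb.
  - by apply: same_sym; apply: Fs1; rewrite mem_rcons inE hb orbT.
have FT := Fs1 (tid T) (ltac:(by rewrite mem_rcons mem_head)).
split=> // [i ie|hw|hi].
- by have [-> ->] := w2 i ie; have [-> ->] := FT i.
- by have [_ ->] := FT e; apply: w3.
- by have [-> _] := FT e; apply: w4.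
Qed.
End Run.

(** * Walks of bounded length *)

Section Reach.
Variables (R : realType) (n : nat) (G : wgraph R n).
Implicit Types (F : {set {set 'I_n}}) (X : {set 'I_n}) (u v w : 'I_n) (r a b : R).

(* reach F X u v r: some u-v walk of length at most r avoids the edges in F and
   the vertices in X. *)
Inductive reach F X : 'I_n -> 'I_n -> R -> Prop :=
  | Reach0 u r : u \notin X -> 0 <= r -> reach F X u u r
  | ReachS u w v r a : u \notin X -> [set u; w] \in edges G -> [set u; w] \notin F ->
      reach F X w v a -> weight G [set u; w] + a <= r -> reach F X u v r.

Lemma reach_le F X u v a r : reach F X u v a -> a <= r -> reach F X u v r.
Proof.
case=> [x b hx h0|x w y b c hx hE hF hr hb] ar; first by apply: Reach0 => //; lra.
by apply: ReachS hr _ => //; lra.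
Qed.

Lemma reach_sub F F' X X' u v r : F' \subset F -> X' \subset X ->
  reach F X u v r -> reach F' X' u v r.
Proof.
move=> /subsetP FF /subsetP XX; elim=> [x a hx h0|x w y a b hx hE hF _ hr hb].
  by apply: Reach0 => //; apply: contra hx; apply: XX.
by apply: ReachS hr hb => //; [apply: contra hx; apply: XX | apply: contra hF; apply: FF].
Qed.

Lemma reach_src F X u v r : reach F X u v r -> u \notin X.
Proof. by case. Qed.

Lemma reach_trans F X u v w a b : reach F X u v a -> reach F X v w b ->
  reach F X u w (a + b).
Proof.
move=> h; elim: h b => [x c hx h0|x y z c d hx hE hF _ IH hc] b hb.
  by apply: reach_le hb _; lra.
by apply: ReachS (IH _ hb) _ => //; lra.
Qed.

Lemma reach1 F X u v : u \notin X -> v \notin X -> [set u; v] \in edges G -> [set u; v] \notin F ->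
  reach F X u v (weight G [set u; v]).
Proof. by move=> hu hv hE hF; apply: ReachS (Reach0 F hv (lexx 0)) _ => //; lra. Qed.

Lemma reach_sym F X u v r : reach F X u v r -> reach F X v u r.
Proof.
elim=> [x a hx h0|x w y a b hx hE hF hr IH hb]; first exact: Reach0.
have hw := reach_src hr; apply: reach_le (reach_trans IH (reach1 _ _ _ _)) _ => //.
1,2: by rewrite setUC.
by rewrite setUC; lra.
Qed.

Lemma path_edges_cons u w p : path_edges u (w :: p) = [set u; w] :: path_edges w p.
Proof. by []. Qed.

Lemma path_length_cons u w p : path_length G u (w :: p) = weight G [set u; w] + path_length G w p.
Proof. by rewrite /path_length path_edges_cons big_cons. Qed.

Lemma path_length_ge0 u p : path (adj G) u p -> 0 <= path_length G u p.
Proof.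
elim: p u => [|w p IH] u; first by rewrite /path_length /path_edges big_nil.
by case/andP=> /weight_ge0 h /IH h'; rewrite path_length_cons; lra.
Qed.

Lemma path_length_suffix u p1 w p2 : path (adj G) u (p1 ++ w :: p2) ->
  path_length G w p2 <= path_length G u (p1 ++ w :: p2).
Proof.
elim: p1 u => [|y p1 IH] u /=; rewrite path_length_cons.
  by case/andP=> /weight_ge0; lra.
by case/andP=> /weight_ge0 h /IH; lra.
Qed.

(** An edge put in front of a simple path may start at a vertex of that path; then only the suffix
    from this vertex is kept, which is no longer since weights are non-negative. *)
Lemma reach_path F u v r : reach F set0 u v r ->
  exists2 p, is_path (remove G F) u v p & path_length G u p <= r.
Proof.
elim=> [x a hx h0|x w y a b hx hE hF _ [p pp hp] hb].
  by exists [::]; rewrite /is_path /= ?eqxx // /path_length /path_edges big_nil.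
have adj_sub : subrel (adj (remove G F)) (adj G) by move=> c d; rewrite /adj inE => /andP[].
have /and3P[pth lst unq] := pp.
have hW := weight_ge0 hE.
have [xin|xnin] := boolP (x \in w :: p); last first.
  exists (w :: p); last by rewrite path_length_cons; lra.
  by rewrite /is_path /= /adj inE hE hF /= pth lst xnin.
have h0 := path_length_ge0 (sub_path adj_sub pth).
move: xin; rewrite inE => /orP[/eqP->|xin]; first by exists p => //; lra.
have pG := sub_path adj_sub pth.
case/splitPr: xin pth lst unq hp pG {pp h0} => p1 p2; rewrite cat_path last_cat /=.
move=> /and3P[_ _ h1] h2 h3 hp pG; exists p2.
  rewrite /is_path h1 h2 /=; move: h3; rewrite cat_uniq /=.
  by case/and4P=> _ _ _ /andP[-> ->].
by have := path_length_suffix pG; lra.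
Qed.

Lemma path_reach F u v p : path (adj (remove G F)) u p -> last u p = v ->
  reach F set0 u v (path_length G u p).
Proof.
elim: p u => [|w p IH] u /=.
  by move=> _ ->; rewrite /path_length /path_edges big_nil; apply: Reach0; rewrite ?inE.
rewrite {1}/adj /= inE => /andP[/andP[hF hE] hp] hl; rewrite path_length_cons.
by apply: ReachS (IH _ hp hl) _; rewrite ?inE.
Qed.

End Reach.

(** * Values given by the bounds they satisfy *)

(** Excluding [-oo] makes every value with a real bound real, so that it bounds itself, and sums
    never mix the two infinities. *)
Definition dval (R : realType) (x : \bar R) (P : R -> Prop) : Prop :=
  x <> -oo%E /\ forall r : R, (x <= r%:E)%E <-> P r.

Section Dval.
Variable R : realType.
Implicit Types (x y : \bar R) (P Q : R -> Prop) (r a b : R).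

Lemma dval_ext x P Q : dval x P -> (forall r, P r <-> Q r) -> dval x Q.
Proof. by move=> [h1 h2] h; split=> // r; rewrite h2. Qed.

Lemma dval_le x P a b : dval x P -> P a -> a <= b -> P b.
Proof. by move=> [_ h] /h ha ab; apply/h; apply: le_trans ha _; rewrite lee_fin. Qed.

Lemma dval_fin a : dval a%:E (fun r => a <= r).
Proof. by split=> // r; rewrite lee_fin. Qed.

Lemma dval_pinfty : dval (+oo%E : \bar R) (fun=> False).
Proof. by split=> // r; rewrite leye_eq; split. Qed.

Lemma dval_add x y P Q : dval x P -> dval y Q ->
  dval (x + y)%E (fun r => exists a b, [/\ P a, Q b & a + b <= r]).
Proof.
move=> hx hy; case: (hx) (hy) => [nx ex] [ny ey].
case: x nx ex hx => [x| |] // nx ex hx; case: y ny ey hy => [y| |] // ny ey hy.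
- split=> // r; rewrite -EFinD lee_fin; split=> [h|[a [b [/ex + /ey + h]]]].
    by exists x, y; split=> //; [apply/ex | apply/ey].
  by rewrite !lee_fin; lra.
all: rewrite ?addey ?addye //; split=> // r; rewrite leye_eq; split=> //.
all: by case=> a [b [/ex + /ey + h]]; rewrite ?leye_eq.
Qed.

Lemma dval_shift x P c : dval x P -> dval (x + c%:E)%E (fun r => exists2 a, P a & a + c <= r).
Proof.
move=> hx; apply: dval_ext (dval_add hx (dval_fin c)) _ => r; split.
  by case=> a [b [h1 h2 h3]]; exists a => //; lra.
by case=> a h1 h2; exists a, c; split.
Qed.

Lemma dval_shiftl x P c : dval x P -> dval (c%:E + x)%E (fun r => exists2 a, P a & c + a <= r).
Proof.
move=> hx; rewrite addeC; apply: dval_ext (dval_shift c hx) _ => r.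
by split=> -[a h1 h2]; exists a => //; lra.
Qed.

Lemma dval_min x y P Q : dval x P -> dval y Q ->
  dval (if (x <= y)%E then x else y) (fun r => P r \/ Q r).
Proof.
move=> [nx ex] [ny ey]; case: leP => h; split=> // r.
  by rewrite ex; split=> [|[//|/ey hr]]; [left | apply/ex; apply: le_trans h hr].
by rewrite ey; split=> [|[/ex hr|//]]; [right | apply/ey; apply: le_trans (ltW h) hr].
Qed.

Lemma dval_le_cmp x y P Q : dval x P -> dval y Q -> (x <= y)%E <-> (forall r, Q r -> P r).
Proof.
move=> [nx ex] [ny ey]; split=> [h r /ey hr|h]; first by apply/ex; apply: le_trans h hr.
case: y ny ey => [y| |] // ny ey; last by rewrite leey.
by apply/ex/h/ey.
Qed.

Lemma dval_real x P r : dval x P -> P r -> exists2 a, x = a%:E & P a /\ a <= r.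
Proof.
move=> [nx ex]; case: x nx ex => [x| |] // nx ex /ex; rewrite ?leye_eq //.
by rewrite lee_fin => h; exists x => //; split=> //; apply/ex.
Qed.

Lemma dval_pinfty_none P : dval +oo%E P -> forall r, ~ P r.
Proof. by move=> [_ h] r /h; rewrite leye_eq. Qed.

End Dval.

(** A real [x] is one of its own bounds, so some walk has length at most [x]; the simple path
    extracted from it attains the minimum. *)
Lemma dval_reach_dist (R : realType) n (G : wgraph R n) F u v x :
  dval x (reach G F set0 u v) -> is_dist (remove G F) u v x.
Proof.
move=> hx; have [nx ex] := hx.
have pr p : is_path (remove G F) u v p -> (x <= (path_length G u p)%:E)%E.
  by move=> /and3P[h1 /eqP h2 _]; apply/ex; apply: path_reach.
case: x hx nx ex pr => [x| |] // hx nx ex pr.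
  have /reach_path[p pp hp] : reach G F set0 u v x by apply/ex.
  have := pr _ pp; rewrite lee_fin => hp'.
  have e : x = path_length G u p by apply/eqP; rewrite eq_le hp' hp.
  left; exists p; last by rewrite e.
  by split=> // q /pr; rewrite lee_fin e.
by right; split=> // p; apply/negP => /pr; rewrite leye_eq.
Qed.

(** * The geometry of a shortest path *)

Section Line.
Variables (R : realType) (n : nat) (G : wgraph R n).
Variables (V : nat -> 'I_n) (pos : nat -> R).
Local Notation N := n.-1.
Local Notation reach := (reach G).

Definition pedge a : {set 'I_n} := [set V a; V a.+1].
Definition pedges : {set {set 'I_n}} := [set d | [exists a : 'I_n, (a.+1 < n)%N && (d == pedge a)]].
Definition cut (fs : seq nat) : {set {set 'I_n}} := [set d | d \in map pedge fs].

(* V lists the vertices of a shortest path, its last vertex being repeated up to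
   index n - 1, and pos v is the distance from V 0 to V v. *)
Record line : Prop := Line {
  line_gt0 : (0 < n)%N;
  line_pos0 : pos 0 = 0;
  line_mono : forall a b, (a <= b)%N -> (b < n)%N -> pos a <= pos b;
  line_short : forall a b r, (a < n)%N -> (b < n)%N -> reach set0 set0 (V a) (V b) r ->
    pos a - pos b <= r /\ pos b - pos a <= r;
  line_step : forall a, (a.+1 < n)%N ->
    (V a = V a.+1 /\ pos a = pos a.+1) \/
    (pedge a \in edges G /\ weight G (pedge a) = pos a.+1 - pos a) }.

(* The edge number f is a genuine edge of the path, not part of its padding. *)
Definition genuine f := (f.+1 < n)%N /\
  forall a b, (a <= f)%N -> (f < b)%N -> (b < n)%N -> V a <> V b.

Hypothesis L : line.
Let mono := line_mono L.
Let short := line_short L.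

Lemma N_lt : (N < n)%N. Proof. by have := line_gt0 L; lia. Qed.

Definition genuines (fs : seq nat) := forall f, f \in fs -> genuine f.

Lemma cut_sub fs : genuines fs -> cut fs \subset pedges.
Proof.
move=> gs; apply/subsetP => d; rewrite !inE => /mapP[f /gs[fn _] ->].
apply/existsP; exists (Ordinal (ltnW fn)); by rewrite /= fn eqxx.
Qed.

(** Padding makes [V] non-injective. This lemma is what allows a union of segments, a set of
    positions, to be treated as a set of vertices. *)
Lemma same_vertex fs a b : genuines fs -> (a < n)%N -> (b < n)%N -> V a = V b ->
  {in fs, forall f, (a <= f)%N = (b <= f)%N}.
Proof.
move=> gs an bn e f /gs[fn h]; case: (leqP a f); case: (leqP b f) => // h1 h2.
  by case: (h a b).
by case: (h b a).
Qed.

Lemma pedge_inj fs f a : genuines fs -> f \in fs -> (a.+1 < n)%N -> pedge a = pedge f -> a = f.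
Proof.
move=> gs /gs[fn h] an e; case: (ltngtP a f) => // lt; exfalso.
  have : V f.+1 \in pedge a by rewrite e !inE eqxx orbT.
  by rewrite !inE => /orP[] /eqP /esym; apply: h; lia.
have : V f \in pedge a by rewrite e !inE eqxx.
by rewrite !inE => /orP[] /eqP; apply: h; lia.
Qed.

Lemma travel_up fs a b : genuines fs -> (a <= b)%N -> (b < n)%N ->
  {in fs, forall f, (a <= f)%N = (b <= f)%N} -> reach (cut fs) set0 (V a) (V b) (pos b - pos a).
Proof.
move=> gs; elim: b => [|b IH] ab bn side.
  by rewrite (_ : a = 0%N) ?subrr; [apply: Reach0; rewrite ?inE | lia].
case: (ltngtP a b.+1) ab => // [ab|->] _; last by rewrite subrr; apply: Reach0; rewrite ?inE.
have side' : {in fs, forall f, (a <= f)%N = (b <= f)%N} by move=> f /side; lia.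
have h := IH ab (ltnW bn) side'.
case: (line_step L bn) => [[<- <-] //|[hE hw]].
apply: reach_le (reach_trans h (reach1 _ _ hE _)) _; rewrite ?inE //; last first.
  by rewrite -/(pedge b) hw; lra.
apply/mapP => -[f hf e]; have := pedge_inj gs hf bn e => bf.
by have := side f hf; rewrite -bf; lia.
Qed.

Lemma travel fs a b c : genuines fs -> (a < n)%N -> (b < n)%N ->
  {in fs, forall f, (a <= f)%N = (b <= f)%N} -> pos a - pos b <= c -> pos b - pos a <= c ->
  reach (cut fs) set0 (V a) (V b) c.
Proof.
move=> gs an bn side h1 h2; case: (leqP a b) => ab.
  by apply: reach_le (travel_up gs ab bn side) _.
by apply/reach_sym; apply: reach_le (travel_up gs (ltnW ab) an _) _ => // f /side.
Qed.

Lemma jump fs u v r : genuines fs -> reach pedges set0 u v r -> reach (cut fs) set0 u v r.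
Proof. by move=> gs; apply: reach_sub => //; apply: cut_sub. Qed.

Lemma reach_short fs X u v r : (u < n)%N -> (v < n)%N -> reach fs X (V u) (V v) r ->
  pos u - pos v <= r /\ pos v - pos u <= r.
Proof. by move=> un vn /(reach_sub (sub0set _) (sub0set _)); apply: short. Qed.

Definition off (Z : pred nat) : {set 'I_n} := [set x | [exists a : 'I_n, ~~ Z a && (x == V a)]].

Lemma offP (Z : pred nat) x : reflect (exists a, [/\ (a < n)%N, ~~ Z a & x = V a]) (x \in off Z).
Proof.
rewrite inE; apply: (iffP existsP) => [[a /andP[h1 /eqP h2]]|[a [h1 h2 h3]]].
  by exists a.
by exists (Ordinal h1); rewrite /= h2 h3 eqxx.
Qed.

(** [Z] is a union of segments left by the cuts. The walk is followed up to its first vertex off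
    [Z], with the last position entered by a path edge as start of the current jump. Recording
    [off Z] in the forbidden vertices of the prefix allows the lemma to be applied again to that
    prefix. *)
Lemma first_exit fs X (Z : pred nat) u v r : genuines fs ->
  (forall a b, {in fs, forall f, (a <= f)%N = (b <= f)%N} -> Z a = Z b) ->
  (u < n)%N -> (v < n)%N -> Z u -> ~~ Z v -> reach (cut fs) X (V u) (V v) r ->
  exists z w a m b, [/\ (z < n)%N, (w < n)%N, Z z, ~~ Z w &
    [/\ reach (cut fs) (X :|: off Z) (V u) (V z) a, reach pedges set0 (V z) (V w) m,
        reach (cut fs) X (V w) (V v) b & a + m + b <= r]].
Proof.
move=> gs ZP un vn Zu Zv.
have Zeq a b : (a < n)%N -> (b < n)%N -> V a = V b -> Z a = Z b.
  by move=> an bn e; apply: ZP; apply: same_vertex e.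
set X' := X :|: off Z.
have main x t s : reach (cut fs) X x t s -> t = V v -> x \notin X' -> forall z a m,
    (z < n)%N -> Z z -> reach (cut fs) X' (V u) (V z) a -> reach pedges X' (V z) x m ->
    exists z w a' m' b, [/\ (z < n)%N, (w < n)%N, Z z, ~~ Z w &
    [/\ reach (cut fs) X' (V u) (V z) a', reach pedges set0 (V z) (V w) m',
        reach (cut fs) X (V w) (V v) b & a' + m' + b <= a + m + s]].
  elim=> [y c _ _ -> /negP[]|y w {}t c d hy hE hF hr IH hc tE yX' z a m zn Zz hz hm].
    by rewrite inE; apply/orP; right; apply/offP; exists v.
  have wX := reach_src hr.
  case: (boolP (w \in off Z)) => [/offP[q [qn Zq wE]]|wZ].
    exists z, q, a, (m + weight G [set y; w]), d; split=> //; split=> //; last by lra.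
      rewrite -wE; apply: reach_trans (reach_sub _ (sub0set _) hm) _ => //.
      (* The step out of [Z] is not a path edge: an uncut path edge joins two positions on the same
         side of every cut, and [Z] does not distinguish these. *)
      apply: reach1; rewrite ?inE // ; apply/negP => /existsP[p /andP[pn /eqP pE]].
      have pfs : {in fs, forall f, (p <= f)%N = (p.+1 <= f)%N}.
        move=> f hf; case: (ltngtP p f) => // pf; case/negP: hF.
        by rewrite inE pE pf map_f.
      have Zp : Z p = Z p.+1 by apply: ZP.
      have wp : w \in pedge p by rewrite -pE !inE eqxx orbT.
      have Zp0 : ~~ Z p.
        move: wp; rewrite wE !inE => /orP[] /eqP e; first by rewrite -(Zeq _ _ qn (ltnW pn) e).
        by rewrite Zp -(Zeq _ _ qn pn e).
      have yp : y \in pedge p by rewrite -pE !inE eqxx.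
      case/negP: yX'; rewrite inE; apply/orP; right; apply/offP.
      by move: yp; rewrite !inE => /orP[] /eqP ->; [exists p | exists p.+1; rewrite -Zp].
    by rewrite -wE -tE.
  have wX' : w \notin X' by rewrite inE negb_or wX wZ.
  (* A path edge inside [Z] ends the current jump: everything so far becomes the prefix, and a jump
     of length 0 starts at the position reached. *)
  case: (boolP ([set y; w] \in pedges)) => hP.
    have [q [qn qE]] : exists q, (q < n)%N /\ w = V q.
      move: hP; rewrite inE => /existsP[p /andP[pn /eqP pE]].
      have : w \in pedge p by rewrite -pE !inE eqxx orbT.
      by rewrite !inE => /orP[] /eqP ->; [exists p; split=> //; lia | exists p.+1].
    have Zq : Z q by apply: contraNT wZ => h; apply/offP; exists q.
    have hq : reach (cut fs) X' (V u) (V q) (a + m + weight G [set y; w]).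
      rewrite -qE; apply: reach_trans (reach1 yX' wX' hE hF).
      by apply: reach_trans hz (reach_sub (cut_sub gs) _ hm).
    have h0 : reach pedges X' (V q) w 0 by rewrite -qE; apply: Reach0.
    have [z' [w' [a' [m' [b [h1 h2 h3 h4 [h5 h6 h7 h8]]]]]]] := IH tE wX' _ _ _ qn Zq hq h0.
    by exists z', w', a', m', b; split=> //; split=> //; lra.
  have h1 : reach pedges X' (V z) w (m + weight G [set y; w]) by apply: reach_trans hm (reach1 _ _ _ _).
  have [z' [w' [a' [m' [b [h2 h3 h4 h5 [h6 h7 h8 h9]]]]]]] := IH tE wX' _ _ _ zn Zz hz h1.
  by exists z', w', a', m', b; split=> //; split=> //; lra.
move=> hr; have uX' : V u \notin X'.
  rewrite inE negb_or (reach_src hr); apply/offP => -[a [an Za e]].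
  by rewrite -(Zeq _ _ un an e) Zu in Za.
have r0 : reach (cut fs) X' (V u) (V u) 0 by apply: Reach0.
have m0 : reach pedges X' (V u) (V u) 0 by apply: Reach0.
have [z [w [a [m [b [h1 h2 h3 h4 [h5 h6 h7 h8]]]]]]] := main _ _ _ hr erefl uX' _ _ _ un Zu r0 m0.
by exists z, w, a, m, b; split=> //; split=> //; lra.
Qed.

End Line.

(** * Paths avoiding two and three edges *)

Section Detours.
Variables (R : realType) (n : nat) (G : wgraph R n).
Variables (V : nat -> 'I_n) (pos : nat -> R).
Local Notation N := n.-1.
Local Notation reach := (reach G).
Local Notation pedges := (pedges V).
Local Notation cut := (cut V).

(* Bounds on distances: Mp between u and v off the path; Sp (resp. Tp) for a
   travel from s to some x <= i (resp. from some q > k to t) and one jump between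
   it and v; Up when Sp is followed by a travel to v inside ]i, k]; sgp (resp. tgp)
   from s (resp. to t) avoiding edge i (resp. k); Dp from s to t avoiding i and k. *)
Definition Mp u v (r : R) := reach pedges set0 (V u) (V v) r.
Definition Sp i v (r : R) := exists x a, [/\ (x <= i)%N, Mp x v a & pos x + a <= r].
Definition Tp k v (r : R) := exists q a, [/\ (k < q)%N, (q < n)%N, Mp v q a & a + (pos N - pos q) <= r].
Definition Up i k v (r : R) := exists y a, [/\ (i < y)%N, (y <= k)%N, Sp i y a,
  a + (pos y - pos v) <= r & a + (pos v - pos y) <= r].
Definition Dp i k (r : R) :=
  (exists q a, [/\ (k < q)%N, (q < n)%N, Sp i q a & a + (pos N - pos q) <= r]) \/
  (exists q a b, [/\ (i < q)%N, (q <= k)%N, Up i k q a, Tp k q b & a + b <= r]).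
Definition sgp i v (r : R) : Prop := if (v <= i)%N then is_true (pos v <= r) else Up i N v r.
Definition tgp k v (r : R) : Prop := if (k < v)%N then is_true (pos N - pos v <= r) else
  exists z a, [/\ (z <= k)%N, Tp k z a, a + (pos z - pos v) <= r & a + (pos v - pos z) <= r].

Hypothesis L : line G V pos.
Let mono := line_mono L.
Let short := @reach_short _ _ _ _ _ L.

Lemma Mp_short u v r : (u < n)%N -> (v < n)%N -> Mp u v r ->
  pos u - pos v <= r /\ pos v - pos u <= r.
Proof. exact: short. Qed.

Lemma s_travel fs v r : genuines V fs -> (v < n)%N -> {in fs, forall f, v <= f}%N ->
  pos v <= r -> reach (cut fs) set0 (V 0) (V v) r.
Proof.
move=> gs vn h vr; have p0 := line_pos0 L; have := mono (leq0n v) vn; rewrite p0 => v0.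
apply: (travel L gs); rewrite ?p0; [exact: leq_ltn_trans vn|exact: vn|by move=> f /h ->|lra|lra].
Qed.

Lemma t_travel fs v r : genuines V fs -> (v < n)%N -> {in fs, forall f, f < v}%N ->
  pos N - pos v <= r -> reach (cut fs) set0 (V v) (V N) r.
Proof.
move=> gs vn h vr; have Nn := N_lt L; have vN : (v <= N)%N by lia.
have := mono vN Nn => h1.
apply: (travel L gs) => //; [by move=> f hf; have := h f hf; have [] := gs f hf; lia|lra].
Qed.

Lemma Sp_reach fs i v r : genuines V fs -> (i < n)%N -> {in fs, forall f, i <= f}%N ->
  Sp i v r -> reach (cut fs) set0 (V 0) (V v) r.
Proof.
move=> gs hi hf [x [a [xi h1 h2]]]; have xn := leq_ltn_trans xi hi.
have h4 := jump gs h1; apply: reach_le h2. apply: reach_trans _ h4.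
by apply: s_travel => // f /hf; lia.
Qed.

Lemma Tp_reach fs k v r : genuines V fs -> {in fs, forall f, f <= k}%N ->
  Tp k v r -> reach (cut fs) set0 (V v) (V N) r.
Proof.
move=> gs hf [q [a [kq qn h1 h2]]].
apply: reach_le h2; apply: reach_trans (jump gs h1) _.
by apply: t_travel => // f /hf; lia.
Qed.

(** Once the walk has landed beyond [i], what remains of it is at least as long as the travel from
    the landing position to [v], because the path is a shortest one. *)
Lemma reach_sgp fs i v r : genuines V fs -> i \in fs -> (v < n)%N ->
  reach (cut fs) set0 (V 0) (V v) r -> sgp i v r.
Proof.
move=> gs hi vn hr; have [hin _] := gs i hi; rewrite /sgp; case: leqP => vi.
  by have := short (line_gt0 L) vn hr; rewrite (line_pos0 L); lra.
have gi : genuines V [:: i] by move=> f; rewrite inE => /eqP->; apply: gs.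
have hr' : reach (cut [:: i]) set0 (V 0) (V v) r.
  apply: reach_sub hr => //; apply/subsetP => d; rewrite !inE /= => /eqP->.
  by apply: map_f.
have [||z [w [a [m [b [h1 h2 h3 h4 [h5 h6 h7 h8]]]]]]] :=
  first_exit (Z := fun x => (x <= i)%N) gi _ (line_gt0 L) vn (leq0n _) _ hr'.
- by move=> x y /(_ i (mem_head _ _)).
- by rewrite -ltnNge.
have p1 := short (line_gt0 L) h1 h5; have p2 := short h2 vn h7.
have p0 := line_pos0 L.
exists w, (pos z + m); rewrite -ltnNge in h4; split=> //; first by lia.
- by exists z, m; split.
- by lra.
- by lra.
Qed.

Lemma reach_tgp fs k v r : genuines V fs -> k \in fs -> (v < n)%N ->
  reach (cut fs) set0 (V v) (V N) r -> tgp k v r.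
Proof.
move=> gs hk vn hr; have [hkn _] := gs k hk; have Nn := N_lt L; rewrite /tgp; case: (ltnP k v) => vk.
  by have := short vn Nn hr; lra.
have gk : genuines V [:: k] by move=> f; rewrite inE => /eqP->; apply: gs.
have hr' : reach (cut [:: k]) set0 (V v) (V N) r.
  apply: reach_sub hr => //; apply/subsetP => d; rewrite !inE /= => /eqP->.
  by apply: map_f.
have [||z [w [a [m [b [h1 h2 h3 h4 [h5 h6 h7 h8]]]]]]] :=
  first_exit (Z := fun x => (x <= k)%N) gk _ vn Nn vk _ hr'.
- by move=> x y /(_ k (mem_head _ _)).
- by lia.
have p1 := short vn h1 h5; have p2 := short h2 Nn h7.
exists z, (m + (pos N - pos w)); rewrite -ltnNge in h4; split=> //.
- by exists w, m; split=> //; lra.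
- by lra.
- by lra.
Qed.

Lemma Up_reach fs i k v r : genuines V fs -> (i < n)%N -> (v < n)%N -> (k < n)%N ->
  {in fs, forall f, i <= f}%N ->
  {in fs, forall f y, i < y <= k -> (y <= f) = (v <= f)}%N ->
  Up i k v r -> reach (cut fs) set0 (V 0) (V v) r.
Proof.
move=> gs hi vn kn h1 h2 [y [a [iy yk ha hr1 hr2]]]; have yn := leq_ltn_trans yk kn.
rewrite (_ : r = a + (r - a)); last by lra.
apply: reach_trans (Sp_reach gs hi h1 ha) _.
apply: (travel L gs) => //; [by move=> f hf; apply: h2 => //; rewrite iy|lra|lra].
Qed.

(** The first exit from the positions up to [k] gives [z]; the first exit from the positions up to
    [i], taken in the prefix, gives the entry. All parts but the two jumps are replaced by
    travels. *)
Lemma Dp_reach i k r : genuine V i -> genuine V k -> (i <= k)%N ->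
  Dp i k r <-> reach (cut [:: i; k]) set0 (V 0) (V N) r.
Proof.
move=> gi gk ik; have Nn := N_lt L; have n0 := line_gt0 L.
have gs : genuines V [:: i; k] by move=> f; rewrite !inE => /orP[] /eqP->.
have [hin _] := gi; have [hkn _] := gk.
have fi : {in [:: i; k], forall f, i <= f}%N by move=> f; rewrite !inE => /orP[] /eqP->.
have fk : {in [:: i; k], forall f, f <= k}%N by move=> f; rewrite !inE => /orP[] /eqP->.
split.
  case=> [[q [a [kq qn h1 h2]]]|[q [a [b [iq qk h1 h2 h3]]]]].
    apply: reach_le h2; apply: reach_trans (Sp_reach gs (ltnW hin) fi h1) _.
    by apply: t_travel => // f /fk; lia.
  have qn : (q < n)%N by lia.
  apply: reach_le h3; apply: reach_trans _ (Tp_reach gs fk h2).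
  apply: (Up_reach gs (ltnW hin) qn (ltnW hkn) fi _ h1).
  by move=> f; rewrite !inE => /orP[] /eqP-> y /andP[h4 h5]; lia.
have side (g : nat) : g \in [:: i; k] -> forall x y, {in [:: i; k], forall f, (x <= f)%N = (y <= f)%N} ->
    (x <= g)%N = (y <= g)%N by move=> hg x y; apply.
have hi0 := side i (mem_head _ _); have hk0 := side k (ltac:(by rewrite !inE eqxx orbT)).
move=> hr; have [||z [w [a [m [b [zn wn zk wk [h5 h6 h7 h8]]]]]]] :=
  first_exit (Z := fun x => (x <= k)%N) gs _ n0 Nn (leq0n _) _ hr.
- by move=> x y /hk0.
- by lia.
rewrite -ltnNge in wk; have pw := short wn Nn h7.
case: (leqP z i) => zi.
  have := short n0 zn h5; rewrite (line_pos0 L) => pz.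
  left; exists w, (pos z + m); split=> //; last by lra.
  by exists z, m; split.
have [||x [u [a' [m' [b' [xn un xi ui [g5 g6 g7 g8]]]]]]] :=
  first_exit (Z := fun x => (x <= i)%N) gs _ n0 zn (leq0n _) _ h5.
- by move=> x y /hi0.
- by rewrite -ltnNge.
rewrite -ltnNge in ui.
(* The prefix avoids every vertex beyond [k], so its landing position lies in the middle segment. *)
have uk : (u <= k)%N.
  rewrite leqNgt; apply/negP => uk; have /negP := reach_src g7; apply.
  by rewrite set0U; apply/offP; exists u; rewrite -ltnNge.
have := short n0 xn g5; rewrite (line_pos0 L) => px; have pu := short un zn g7.
right; exists z, a, (b + m); split=> //; last by lra.
  exists u, (pos x + m'); split=> //; [|lra|lra].
  by exists x, m'; split.
by exists w, m; split=> //; lra.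
Qed.

End Detours.

(** * The four ways around the middle edge *)

Section Three.
Variables (R : realType) (n : nat) (G : wgraph R n).
Variables (V : nat -> 'I_n) (pos : nat -> R).
Local Notation N := n.-1.
Local Notation reach := (reach G).
Local Notation cut := (cut V).
Local Notation Mp := (Mp G V).
Local Notation Sp := (Sp G V pos).
Local Notation Tp := (Tp G V pos).
Local Notation Up := (Up G V pos).
Local Notation Dp := (Dp G V pos).
Local Notation sgp := (sgp G V pos).
Local Notation tgp := (tgp G V pos).

Definition gap (u v : nat) : R := if (u <= v)%N then pos v - pos u else pos u - pos v.

Variables i j k y z : nat.

(* A shortest s-t path avoiding edges i and k enters the segment ]i, k] of the
   path at y and leaves it at z.  On the side of edge j that contains y (resp. z),
   positions are between j and y (resp. z), or beyond.  The letters of OOp, OBp,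
   BOp and BBp say whether the jump from one side to the other starts between j
   and y (B) or beyond y (O), and where it lands relative to z. *)
Definition outY p := if (y <= z)%N then (i < p <= y)%N else (y <= p <= k)%N.
Definition outZ p := if (y <= z)%N then (z <= p <= k)%N else (i < p <= z)%N.
Definition betY p := if (y <= z)%N then (y <= p <= j)%N else (j < p <= y)%N.
Definition betZ p := if (y <= z)%N then (j < p <= z)%N else (z <= p <= j)%N.

(** The last jump lands at [u] and comes from segment A or from a position beyond [y]. Nothing
    depends on [j], so a table indexed by [i], [k] and [u] is enough; the price is that [sgp] may
    stand for walks that use [j] or [k]. *)
Definition GAp u (r : R) :=
  Sp i u r \/ exists p a m, [/\ outY p, sgp i p a, Mp p u m & a + m <= r].
Definition GBp u (r : R) :=
  Tp k u r \/ exists p a m, [/\ outZ p, tgp k p a, Mp p u m & a + m <= r].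

Variables ay bz r0 : R.

Definition OOp (r : R) := exists u a b, [/\ (k < u)%N || outZ u, (u < n)%N, GAp u a, tgp k u b & a + b <= r].
Definition OBp (r : R) := exists u a, [/\ betZ u, GAp u a & a + gap u z + bz <= r].
Definition BOp (r : R) := exists p b, [/\ betY p, GBp p b & ay + gap p y + b <= r].
Definition BBp (r : R) := exists p q m, [/\ betY p, betZ q, Mp p q m &
  ay + gap p y + m + gap q z + bz <= r].

Hypothesis L : line G V pos.
Hypothesis (gi : genuine V i) (gj : genuine V j) (gk : genuine V k).
Hypothesis (ij : (i <= j)%N) (jk : (j <= k)%N).
Hypothesis (iy : (i < y)%N) (yk : (y <= k)%N) (iz : (i < z)%N) (zk : (z <= k)%N).
Hypothesis sep : (y <= j < z)%N || (z <= j < y)%N.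
Hypothesis (hay : Sp i y ay) (hbz : Tp k z bz).
Hypothesis hr0 : forall r, reach (cut [:: i; k]) set0 (V 0) (V N) r -> r0 <= r.
Hypothesis hyz : ay + gap y z + bz <= r0.

Let mono := line_mono L.
Let short := @reach_short _ _ _ _ _ L.

Lemma gapP u v : (u < n)%N -> (v < n)%N ->
  [/\ pos u - pos v <= gap u v, pos v - pos u <= gap u v &
      gap u v = pos v - pos u \/ gap u v = pos u - pos v].
Proof.
move=> un vn; rewrite /gap; case: leqP => uv.
  by have := mono uv vn => h; split; [lra|lra|left].
by have := mono (ltnW uv) un => h; split; [lra|lra|right].
Qed.

Let kn : (k < n)%N. Proof. by case: gk => /ltnW. Qed.
Let jn : (j < n)%N. Proof. by case: gj => /ltnW. Qed.
Let i_n : (i < n)%N. Proof. by case: gi => /ltnW. Qed.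
Let yn : (y < n)%N. Proof. exact: leq_ltn_trans yk kn. Qed.
Let zn : (z < n)%N. Proof. exact: leq_ltn_trans zk kn. Qed.
Let n0 := line_gt0 L.
Let Nn := N_lt L.
Let g2 : genuines V [:: i; k].
Proof. by move=> f; rewrite !inE => /orP[] /eqP->. Qed.
Let g3 : genuines V [:: i; j; k].
Proof. by move=> f; rewrite !inE => /or3P[] /eqP->. Qed.
Let i2 : {in [:: i; k], forall f, i <= f}%N.
Proof. by move=> f; rewrite !inE => /orP[] /eqP->; lia. Qed.
Let k2 : {in [:: i; k], forall f, f <= k}%N.
Proof. by move=> f; rewrite !inE => /orP[] /eqP->; lia. Qed.
Let i3 : {in [:: i; j; k], forall f, i <= f}%N.
Proof. by move=> f; rewrite !inE => /or3P[] /eqP->; lia. Qed.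
Let k3 : {in [:: i; j; k], forall f, f <= k}%N.
Proof. by move=> f; rewrite !inE => /or3P[] /eqP->; lia. Qed.

Lemma sub23 u v r : reach (cut [:: i; j; k]) set0 u v r -> reach (cut [:: i; k]) set0 u v r.
Proof.
apply: reach_sub => //; apply/subsetP => d; rewrite !inE /=.
by case/orP => /eqP->; rewrite ?eqxx ?orbT.
Qed.

(** Diverting any walk to [z] gives a competitor of the optimal route through [y] and [z]. All
    exchange arguments below use this comparison or its mirror [via_y]. *)
Lemma via_z p a : (i < p <= k)%N -> reach (cut [:: i; k]) set0 (V 0) (V p) a ->
  r0 <= a + gap p z + bz.
Proof.
move=> /andP[ip pk] ha; have pn := leq_ltn_trans pk kn; have [h1 h2 _] := gapP pn zn.
apply: hr0; apply: reach_trans (Tp_reach L g2 k2 hbz); apply: reach_trans ha _.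
apply: (travel L g2) => // f; rewrite !inE => /orP[] /eqP->; lia.
Qed.

Lemma via_y p b : (i < p <= k)%N -> reach (cut [:: i; k]) set0 (V p) (V N) b ->
  r0 <= ay + gap p y + b.
Proof.
move=> /andP[ip pk] hb; have pn := leq_ltn_trans pk kn; have [h1 h2 _] := gapP pn yn.
apply: hr0; apply: reach_trans hb; apply: reach_trans (Sp_reach L g2 i_n i2 hay) _.
apply: (travel L g2) => // f; rewrite !inE => /orP[] /eqP->; lia.
Qed.

Lemma within p q c : (i < p <= k)%N -> (i < q <= k)%N -> (p <= j)%N = (q <= j)%N ->
  pos p - pos q <= c -> pos q - pos p <= c ->
  reach (cut [:: i; j; k]) set0 (V p) (V q) c.
Proof.
move=> /andP[ip pk] /andP[iq qk] h; apply: (travel L g3); try lia.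
by move=> f; rewrite !inE => /or3P[] /eqP->; lia.
Qed.

(** Let [y'] be where the walk behind [sgp] lands beyond [i]. If [y'] is beyond [k], the walk up to
    [y'] gives the second alternative. If it is on y's side of [j], a travel reaches [p]. Otherwise
    entering at [y] instead of [y'] costs no more. *)
Lemma sg_sound p a : outY p -> sgp i p a ->
  reach (cut [:: i; j; k]) set0 (V 0) (V p) a \/
  exists d b, [/\ (k < d)%N, (d < n)%N, reach (cut [:: i; j; k]) set0 (V 0) (V d) b,
    b + (pos d - pos p) <= a & b + (pos p - pos d) <= a].
Proof.
move=> op; have [ip pk pj] : [/\ (i < p)%N, (p <= k)%N & (p <= j)%N = (y <= j)%N].
  by move: op sep; rewrite /outY; case: (leqP y z); split; lia.
rewrite /sgp leqNgt ip /= => -[y' [a0 [iy' yN' ha h1 h2]]].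
have y'n : (y' < n)%N by lia.
case: (ltnP k y') => ky'.
  by right; exists y', a0; split=> //; apply: Sp_reach ha.
left; case: (boolP ((y' <= j)%N == (y <= j)%N)) => [/eqP|] side.
  rewrite (_ : a = a0 + (a - a0)); last by lra.
  apply: reach_trans (Sp_reach L g3 i_n i3 ha) _.
  by apply: within; rewrite ?iy' ?ip ?pj //; lra.
have := via_z (p := y') (a := a0); rewrite iy' ky' => /(_ isT (Sp_reach L g2 i_n i2 ha)) h3.
have pn : (p < n)%N by lia.
have h4 : ay + (pos y - pos p) <= a /\ ay + (pos p - pos y) <= a.
  (* Both routes finish through [z], so [ay + gap y z <= a0 + gap y' z]. As [y] lies between [p] and
     [y'], going from [y] on to [p] then costs at most [a0] plus the travel from [y'] to [p]. *)
  have h3' := le_trans hyz h3; clear h3.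
  have le p q : (p <= q)%N -> (q < n)%N -> pos p <= pos q := @mono p q.
  move: op sep side; rewrite /outY; case: (leqP y z) => yz op sp side.
    have m1 : pos p <= pos y by apply: le; lia.
    have m2 : pos y <= pos y' by apply: le; lia.
    have m3 : pos y <= pos z by apply: le; lia.
    move: h3'; rewrite /gap yz; case: (leqP y' z) => yz' h3'; lra.
  have m1 : pos y <= pos p by apply: le; lia.
  have m2 : pos y' <= pos y by apply: le; lia.
  have m3 : pos z <= pos y by apply: le; lia.
  by move: h3'; rewrite /gap (leqNgt y) yz /=; case: (leqP y' z) => yz' h3'; lra.
rewrite (_ : a = ay + (a - ay)); last by lra.
apply: reach_trans (Sp_reach L g3 i_n i3 hay) _.
by apply: within; rewrite ?iy ?ip ?pj //; lra.
Qed.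

Lemma tg_sound p a : outZ p -> tgp k p a ->
  reach (cut [:: i; j; k]) set0 (V p) (V N) a \/
  exists x b, [/\ (x <= i)%N, reach (cut [:: i; j; k]) set0 (V x) (V N) b,
    b + (pos x - pos p) <= a & b + (pos p - pos x) <= a].
Proof.
move=> op; have [ip pk pj] : [/\ (i < p)%N, (p <= k)%N & (p <= j)%N = (z <= j)%N].
  by move: op sep; rewrite /outZ; case: (leqP y z); split; lia.
rewrite /tgp ltnNge pk /= => -[z' [a0 [zk' ha h1 h2]]].
have z'n : (z' < n)%N by lia.
case: (leqP z' i) => iz'.
  by right; exists z', a0; split=> //; apply: Tp_reach ha.
left; case: (boolP ((z' <= j)%N == (z <= j)%N)) => [/eqP|] side.
  rewrite (_ : a = (a - a0) + a0); last by lra.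
  apply: reach_trans (Tp_reach L g3 k3 ha).
  by apply: within; rewrite ?iz' ?ip ?pj //; lra.
have := via_y (p := z') (b := a0); rewrite iz' zk' => /(_ isT (Tp_reach L g2 k2 ha)) h3.
have pn : (p < n)%N by lia.
have h4 : bz + (pos z - pos p) <= a /\ bz + (pos p - pos z) <= a.
  have h3' := le_trans hyz h3; clear h3.
  have le p q : (p <= q)%N -> (q < n)%N -> pos p <= pos q := @mono p q.
  move: op sep side; rewrite /outZ; case: (leqP y z) => yz op sp side.
    have m1 : pos z <= pos p by apply: le; lia.
    have m2 : pos z' <= pos z by apply: le; lia.
    have m3 : pos y <= pos z by apply: le; lia.
    by move: h3'; rewrite /gap yz; case: (leqP z' y) => yz' h3'; lra.
  have m1 : pos p <= pos z by apply: le; lia.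
  have m2 : pos z <= pos z' by apply: le; lia.
  have m3 : pos z <= pos y by apply: le; lia.
  by move: h3'; rewrite /gap (leqNgt y) yz /=; case: (leqP z' y) => yz' h3'; lra.
rewrite (_ : a = (a - bz) + bz); last by lra.
apply: reach_trans (Tp_reach L g3 k3 hbz).
by apply: within; rewrite ?iz ?ip ?pj //; lra.
Qed.

Lemma GA_sound u a : (u < n)%N -> GAp u a ->
  reach (cut [:: i; j; k]) set0 (V 0) (V u) a \/
  exists d b, [/\ (k < d)%N, (d < n)%N, reach (cut [:: i; j; k]) set0 (V 0) (V d) b,
    b + (pos d - pos u) <= a & b + (pos u - pos d) <= a].
Proof.
move=> un [hs|[p [b [m [op hp hm bm]]]]]; first by left; apply: Sp_reach hs.
have pn : (p < n)%N by move: op; rewrite /outY; case: ifP; lia.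
case: (sg_sound op hp) => [h|[d [c [h1 h2 h3 h4 h5]]]].
  by left; apply: reach_le bm; apply: reach_trans h (jump g3 hm).
have := short pn un hm; right; exists d, c; split=> //; lra.
Qed.

Lemma GB_sound u a : (u < n)%N -> GBp u a ->
  reach (cut [:: i; j; k]) set0 (V u) (V N) a \/
  exists x b, [/\ (x <= i)%N, reach (cut [:: i; j; k]) set0 (V x) (V N) b,
    b + (pos x - pos u) <= a & b + (pos u - pos x) <= a].
Proof.
move=> un [hs|[p [b [m [op hp hm bm]]]]]; first by left; apply: Tp_reach hs.
have pn : (p < n)%N by move: op; rewrite /outZ; case: ifP; lia.
case: (tg_sound op hp) => [h|[d [c [h1 h2 h3 h4]]]].
  by left; apply: reach_le bm; rewrite addrC; apply: reach_trans (reach_sym (jump g3 hm)) h.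
have := short pn un hm; right; exists d, c; split=> //; lra.
Qed.

(** In the second alternatives the halves need not meet at [u]. From [d] beyond [k] the walk goes
    straight to t, which is cheaper than returning to [u], since [b] is at least the distance from
    [u] to t; symmetrically, [x] is reached straight from s. *)
Lemma join u a b :(u < n)%N ->
  (reach (cut [:: i; j; k]) set0 (V 0) (V u) a \/
  exists d b, [/\ (k < d)%N, (d < n)%N, reach (cut [:: i; j; k]) set0 (V 0) (V d) b,
    b + (pos d - pos u) <= a & b + (pos u - pos d) <= a]) ->
  (reach (cut [:: i; j; k]) set0 (V u) (V N) b \/
  exists x c, [/\ (x <= i)%N, reach (cut [:: i; j; k]) set0 (V x) (V N) c,
    c + (pos x - pos u) <= b & c + (pos u - pos x) <= b]) ->
  reach (cut [:: i; j; k]) set0 (V 0) (V N) (a + b).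
Proof.
have p0 := line_pos0 L.
move=> un h1 h2; have ha : pos u <= a.
  case: h1 => [/(short n0 un)|[d [c [_ dn /(short n0 dn)]]]]; lra.
have hb : pos N - pos u <= b.
  case: h2 => [/(short un Nn)|[x [c [xi /(short (leq_ltn_trans xi i_n) Nn)]]]]; lra.
case: h1 => [h1|[d [c [kd dn h3 h4 h5]]]]; last first.
  apply: reach_le (reach_trans h3 (t_travel L g3 dn _ (lexx _))) _; last by lra.
  by move=> f /k3; lia.
case: h2 => [h2|[x [c [xi h3 h4 h5]]]]; first exact: reach_trans h1 h2.
have xn := leq_ltn_trans xi i_n.
apply: reach_le (reach_trans (s_travel L g3 xn _ (lexx _)) h3) _; last by lra.
by move=> f /i3; lia.
Qed.

Lemma three_sound r : [\/ OOp r, OBp r, BOp r | BBp r] ->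
  reach (cut [:: i; j; k]) set0 (V 0) (V N) r.
Proof.
case.
- move=> [u [a [b [hu un hA hB ab]]]]; apply: reach_le ab.
  apply: (join un (GA_sound un hA)); case/orP: hu => [ku|ou]; last exact: tg_sound hB.
  left; move: hB; rewrite /tgp ku => hB.
  by apply: (t_travel L g3 un _ hB) => f /k3; lia.
- move=> [u [a [hu hA ab]]].
  have [iu uk uj] : [/\ (i < u)%N, (u <= k)%N & (u <= j)%N = (z <= j)%N].
    by move: hu sep; rewrite /betZ; case: (leqP y z); split; lia.
  have un := leq_ltn_trans uk kn; have [h1 h2 _] := gapP un zn.
  apply: reach_le (_ : a + (gap u z + bz) <= r); last by lra.
  apply: (join un (GA_sound un hA)); left.
  by apply: reach_trans (Tp_reach L g3 k3 hbz); apply: within => //; lia.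
- move=> [p [b [hp hB ab]]].
  have [ip pk pj] : [/\ (i < p)%N, (p <= k)%N & (p <= j)%N = (y <= j)%N].
    by move: hp sep; rewrite /betY; case: (leqP y z); split; lia.
  have pn := leq_ltn_trans pk kn; have [h1 h2 _] := gapP pn yn.
  apply: reach_le ab; apply: (join pn _ (GB_sound pn hB)); left.
  by apply: reach_trans (Sp_reach L g3 i_n i3 hay) _; apply: within => //; lia.
move=> [p [q [m [hp hq hm ab]]]].
have [ip pk pj] : [/\ (i < p)%N, (p <= k)%N & (p <= j)%N = (y <= j)%N].
  by move: hp sep; rewrite /betY; case: (leqP y z); split; lia.
have [iq qk qj] : [/\ (i < q)%N, (q <= k)%N & (q <= j)%N = (z <= j)%N].
  by move: hq sep; rewrite /betZ; case: (leqP y z); split; lia.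
have pn := leq_ltn_trans pk kn; have [h1 h2 _] := gapP pn yn.
have qn := leq_ltn_trans qk kn; have [h3 h4 _] := gapP qn zn.
apply: reach_le ab; apply: reach_trans (Tp_reach L g3 k3 hbz).
apply: reach_trans (_ : reach _ _ (V q) _ _); last by apply: within => //; lia.
apply: reach_trans (jump g3 hm).
by apply: reach_trans (Sp_reach L g3 i_n i3 hay) _; apply: within => //; lia.
Qed.

Lemma three_complete r : reach (cut [:: i; j; k]) set0 (V 0) (V N) r ->
  [\/ OOp r, OBp r, BOp r | BBp r].
Proof.
have p0 := line_pos0 L.
(* Segment A together with y's side of [j]; the first exit from it is the jump that the four cases
   classify. *)
pose Z p := (p <= i)%N || (p <= k)%N && ((p <= j)%N == (y <= j)%N).
have le p q : (p <= q)%N -> (q < n)%N -> pos p <= pos q := @mono p q.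
move=> hr; have [||z' [u [a [m [b [z'n un Zz Zu [h5 h6 h7 h8]]]]]]] :=
  first_exit (Z := Z) g3 _ n0 Nn isT _ hr.
- move=> p q h; rewrite /Z (h i) ?(h j) ?(h k) // !inE eqxx ?orbT //.
- by have [kN _] := gk; rewrite /Z; lia.
have h5' := reach_sub (subxx _) (sub0set _) h5.
have hA : betY z' /\ ay + gap z' y <= a \/ GAp u (a + m).
  case: (leqP z' i) => zi.
    right; left; exists z', m; split=> //.
    by have := short n0 z'n h5; lra.
  have /orP[hb|ho] : betY z' || outY z'.
    by move: Zz sep; rewrite /Z /betY /outY; case: (leqP y z); lia.
    left; split=> //.
    (* Here [z'] lies between [y] and [z]. If [a] were less than [ay + gap z' y], then going on from
       [z'] to [z] would beat the optimal route. *)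
    have [h1 h2] : (i < z' <= k)%N /\ gap y z = gap z' y + gap z' z.
      move: hb sep; rewrite /betY /gap; case: (leqP y z) => yz hb sp.
        split; first by lia.
        rewrite (_ : (z' <= z)%N = true); last by lia.
        by case: (leqP z' y) => h; [rewrite (_ : z' = y); [lra|lia]|lra].
      split; first by lia.
      rewrite (_ : (z' <= y)%N = true); last by lia.
      by case: (leqP z' z) => h; [rewrite (_ : z' = z); [lra|lia]|lra].
    by have := via_z h1 (sub23 h5'); move: hyz; lra.
  right; right; exists z', a, m; split=> //.
  by apply: reach_sgp h5' => //; rewrite inE eqxx.
have hB : betZ u /\ gap u z + bz <= b \/ (((k < u)%N || outZ u) /\ tgp k u b).
  have /orP[hb|ho] : betZ u || ((k < u)%N || outZ u).
    by move: Zu sep; rewrite /Z /betZ /outZ; case: (leqP y z); lia.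
    left; split=> //.
    have [h1 h2] : (i < u <= k)%N /\ gap y z = gap u z + gap u y.
      move: hb sep; rewrite /betZ /gap; case: (leqP y z) => yz hb sp.
        split; first by lia.
        rewrite (_ : (u <= z)%N = true); last by lia.
        by case: (leqP u y) => h; [rewrite (_ : u = y); [lra|lia]|lra].
      split; first by lia.
      rewrite (_ : (u <= y)%N = true); last by lia.
      by case: (leqP u z) => h; [rewrite (_ : u = z); [lra|lia]|lra].
    by have := via_y h1 (sub23 h7); move: hyz; lra.
  by right; split=> //; apply: reach_tgp h7 => //; rewrite !inE eqxx ?orbT.
case: hA => [[hbz' ha]|hA]; case: hB => [[hbu hb]|[hu hb]].
- by constructor 4; exists z', u, m; split=> //; lra.
- constructor 3; exists z', (m + b); split=> //; last by lra.
  case/orP: hu => [ku|ou]; last by right; exists u, b, m; split; rewrite // 1?addrC //; apply: reach_sym.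
  left; exists u, m; split=> //; by move: hb; rewrite /tgp ku; lra.
- by constructor 2; exists u, (a + m); split=> //; lra.
- by constructor 1; exists u, (a + m), b; split.
Qed.

Lemma threeP (r : R) : [\/ OOp r, OBp r, BOp r | BBp r] <->
  reach (cut [:: i; j; k]) set0 (V 0) (V N) r.
Proof. by split; [apply: three_sound | apply: three_complete]. Qed.
End Three.

(** * The program *)

Definition lit0 := ILit 0.
Definition lit1 := ILit 1.
(** The counter is read in base [n]: cell [(i, j, v)] has number [(i n + j) n + v], and [LL] is the
    further leading index of the sparse tables. Reducing modulo [n] also brings the syntactic degree
    down to 1. *)
Definition II := IMod (IDiv cnt (IMul nn nn)) nn.
Definition JJ := IMod (IDiv cnt nn) nn.
Definition VV := IMod cnt nn.
Definition LL := IDiv cnt (IMul (IMul nn nn) nn).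
Definition N1 := ISub nn lit1.
Definition addr x y z := IAdd (IMul (IAdd (IMul x nn) y) nn) z.
Definition addr4 l x y z := addr (IAdd (IMul l nn) x) y z.
Definition W3 a x y z := WGet a (addr x y z).
Definition I3 a x y z := IGet a (addr x y z).
Definition W4 a l x y z := WGet a (addr4 l x y z).

Definition beq x y := BAnd (BILe x y) (BILe y x).
Definition blt x y := BNot (BILe y x).
Definition wlt x y := BNot (BWLe y x).
Definition bor b1 b2 := BNot (BAnd (BNot b1) (BNot b2)).
Definition btrue := BILe lit0 lit0.

Fixpoint tmin (t : tree) (e : wexp) : tree :=
  match t with
  | LW e1 => Br (BWLe e1 e) (LW e1) (LW e)
  | LI e1 => LI e1
  | Br b t_out t_path => Br b (tmin t_out e) (tmin t_path e)
  end.

(* Cell (i, j, v) is the minimum of t over the values of VV at most v satisfying b. *)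
Definition tacc a b t :=
  Br (BILe VV lit0) (Br b t (LW WInfty))
    (Br b (tmin t (W3 a II JJ (ISub VV lit1))) (LW (W3 a II JJ (ISub VV lit1)))).

(* Cell (i, j, v) is e at the last value of VV at most v satisfying b, d if there is none. *)
Definition tsearch a b e d :=
  Br b (LI e) (Br (BILe VV lit0) (LI d) (LI (I3 a II JJ (ISub VV lit1)))).

(* Tables 4 to 7: Bellman-Ford distances by number of edges; predecessors,
   a vertex being its own predecessor when the last edge does not help; the path
   traced back from t; its number of edges. *)
Definition xB h v := W3 4 h v N1.
Definition xw u v := WGet 0 (IAdd (IMul u nn) v).
Definition hp := ISub II lit1.
Definition t_hops := tacc 4 btrue
  (Br (BILe II lit0) (Br (beq JJ (IGet 0 (ILit 1))) (LW WZero) (LW WInfty))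
    (Br (beq VV JJ) (LW (xB hp JJ)) (LW (WAdd (xB hp VV) (xw VV JJ))))).
Definition t_pred := tsearch 5
  (BAnd (BILe lit1 II) (BAnd (wlt (xB II JJ) (xB hp JJ))
     (BWLe (WAdd (xB hp VV) (xw VV JJ)) (xB II JJ)))) VV JJ.
Definition t_trace := Br (BILe VV lit0) (LI (IGet 0 (ILit 2)))
  (LI (I3 5 (ISub nn VV) (I3 6 lit0 lit0 (ISub VV lit1)) N1)).
(** The trace is stored from t backwards, since a cell can only depend on preceding ones; the
    reversed index restores the order. Past the last position, truncated subtraction gives t
    again. *)
Definition xV h := I3 6 lit0 lit0 (ISub N1 h).
Definition t_size := tsearch 7
  (BAnd (BILe lit1 VV) (BAnd (beq (xV VV) (IGet 0 (ILit 2)))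
     (BNot (beq (xV (ISub VV lit1)) (IGet 0 (ILit 2)))))) VV lit0.

(* Tables 8 to 12: edges of the path; Floyd-Warshall without these edges; the
   distances between vertices of the path; their positions. *)
Definition t_edge := tsearch 8
  (bor (BAnd (beq II (xV VV)) (beq JJ (xV (IAdd VV lit1))))
       (BAnd (beq JJ (xV VV)) (beq II (xV (IAdd VV lit1))))) lit1 lit0.
Definition t_weight := Br (beq JJ VV) (LW WZero)
  (Br (BILe (I3 8 JJ VV N1) lit0) (LW (xw JJ VV)) (LW WInfty)).
Definition tfw a x := tmin (LW (W3 a x JJ VV)) (WAdd (W3 a x JJ II) (W3 a x II VV)).
Definition t_floyd := Br (BILe II lit0) (tfw 9 lit0) (tfw 10 hp).
Definition t_M := LW (W3 10 N1 (xV JJ) (xV VV)).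
Definition t_pos := LW (xB VV (xV VV)).
Definition xM a b := W3 11 lit0 a b.
Definition xP a := W3 12 lit0 lit0 a.
Definition xrest a := WSub (xP N1) (xP a).
Definition tgap x a b := Br (BILe a b) (LW (WAdd x (WSub (xP b) (xP a))))
                                       (LW (WAdd x (WSub (xP a) (xP b)))).

(* Tables 13 to 18 hold the distances specified by Sp, Tp, Up, sgp, tgp and Dp.
   Tables 19 and 20 hold the exit and the entry of a path attaining Dp, the exit
   being 0 when no such path enters the segment. *)
Definition t_S := tacc 13 (BILe VV II) (LW (WAdd (xP VV) (xM VV JJ))).
Definition xS i v := W3 13 i v N1.
Definition t_T := tacc 14 (blt II VV) (LW (WAdd (xM JJ VV) (xrest VV))).
Definition xT k v := W3 14 k v N1.
Definition t_U := tacc 15 (blt II VV) (tgap (xS II VV) VV JJ).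
Definition xU i k v := W3 15 i v k.
Definition t_sg := Br (BILe VV JJ) (LW (xP VV)) (LW (xU JJ N1 VV)).
Definition xsg i v := W3 16 lit0 i v.
Definition t_tg := tacc 17 (bor (blt II JJ) (BILe VV II))
  (Br (blt II JJ) (LW (xrest JJ)) (tgap (xT II VV) VV JJ)).
Definition xtg k v := W3 17 k v N1.
Definition t_D := tacc 18 (blt II VV)
  (Br (BILe VV JJ) (LW (WAdd (xU II JJ VV) (xT JJ VV))) (LW (WAdd (xS II VV) (xrest VV)))).
Definition xD i k := W3 18 i k N1.
Definition t_Z := tsearch 19
  (BAnd (BAnd (blt II VV) (BILe VV JJ)) (BWLe (WAdd (xU II JJ VV) (xT JJ VV)) (xD II JJ))) VV lit0.
Definition xZ i k := I3 19 i k N1.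
Definition t_Y := tsearch 20
  (BAnd (BAnd (blt II VV) (BILe VV JJ))
    (BAnd (BWLe (WAdd (xS II VV) (WSub (xP VV) (xP (xZ II JJ)))) (xU II JJ (xZ II JJ)))
          (BWLe (WAdd (xS II VV) (WSub (xP (xZ II JJ)) (xP VV))) (xU II JJ (xZ II JJ))))) VV lit0.
Definition xY i k := I3 20 i k N1.

(* Tables 21 to 24: binary logarithms, powers of 2 and the two sparse tables.
   The sums are written as differences so that they are visibly bounded. *)
Definition xLG x := I3 21 lit0 lit0 x.
Definition t_log := Br (BILe VV lit1) (LI lit0)
  (LI (ISub VV (ISub (ISub VV (xLG (IDiv VV (ILit 2)))) lit1))).
Definition xPW x := I3 22 lit0 lit0 x.
Definition t_pow := Br (BILe VV lit0) (LI lit1)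
  (LI (ISub nn (ISub nn (IMul (ILit 2) (xPW (ISub VV lit1)))))).
Definition lp := ISub LL lit1.
(** Level [l] takes minima over windows of [2 ^ l] positions ending at [JJ], truncated at 0. Windows
    reach backwards; both halves belong to the previous level, which precedes the current cell. *)
Definition tsparse a f := Br (BILe LL lit0) (LW (WAdd f (xM JJ VV)))
  (Br (blt JJ (xPW lp)) (LW (W4 a lp II JJ VV))
    (tmin (LW (W4 a lp II JJ VV)) (W4 a lp II (ISub JJ (xPW lp)) VV))).
Definition t_spA := tsparse 23 (xsg II JJ).
Definition t_spB := tsparse 24 (xtg II JJ).

(* Tables 25 to 33 hold GAp, GBp, OOp and the ingredients of OBp, BOp and BBp. *)
Definition trange a e i l r u :=
  let g := xLG (ISub (IAdd r lit1) l) in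
  tmin (tmin (LW e) (W4 a g i r u)) (W4 a g i (ISub (IAdd l (xPW g)) lit1) u).
Definition t_GA := Br (BILe (xY II JJ) (xZ II JJ))
  (trange 23 (xS II VV) II (IAdd II lit1) (xY II JJ) VV)
  (trange 23 (xS II VV) II (xY II JJ) JJ VV).
Definition t_GB := Br (BILe (xY II JJ) (xZ II JJ))
  (trange 24 (xT JJ VV) JJ (xZ II JJ) JJ VV)
  (trange 24 (xT JJ VV) JJ (IAdd II lit1) (xZ II JJ) VV).
Definition xGA i k u := W3 25 i k u.
Definition xGB i k u := W3 26 i k u.
Definition boutZ i k u :=
  bor (BAnd (BILe (xY i k) (xZ i k)) (BAnd (BILe (xZ i k) u) (BILe u k)))
      (BAnd (blt (xZ i k) (xY i k)) (BAnd (blt i u) (BILe u (xZ i k)))).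
Definition t_OO := tacc 27 (bor (blt JJ VV) (boutZ II JJ VV))
  (LW (WAdd (xGA II JJ VV) (xtg JJ VV))).
Definition tup a g x := tacc a (BILe x VV) (LW (WAdd (g II JJ VV) (WSub (xP VV) (xP x)))).
(** [tacc] produces prefix minima; with the reversed index the same scan produces suffix minima. *)
Definition RR := ISub N1 VV.
Definition tdown a g x := tacc a (BILe RR x) (LW (WAdd (g II JJ RR) (WSub (xP x) (xP RR)))).
Definition t_upA := tup 28 xGA (xZ II JJ).
Definition t_downA := tdown 29 xGA (xZ II JJ).
Definition t_upB := tup 30 xGB (xY II JJ).
Definition t_downB := tdown 31 xGB (xY II JJ).
Definition t_W0 := tacc 32 (BILe JJ VV) (LW (WAdd (xM VV II) (WSub (xP VV) (xP JJ)))).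
Definition t_W := tacc 33 (blt II VV) (LW (WSub (W3 32 VV JJ II) (xP VV))).
(** The term [pos hi] is common to all candidates. Adding it only on reading leaves, in table 33, a
    quantity independent of [hi], whose prefix minima serve every [hi]. *)
Definition xWW j lo hi := WAdd (W3 33 j lo hi) (xP hi).

(* Table 34 is meaningful for II <= JJ <= VV only. *)
Definition tmin4 a b c d := tmin (tmin (tmin (LW a) b) c) d.
Definition down := ISub N1 (IAdd JJ lit1).
Definition xz := xZ II VV.
Definition xy := xY II VV.
Definition t_forward := tmin4 (W3 27 II VV N1) (WAdd (W3 29 II VV down) (xT VV xz))
  (WAdd (xS II xy) (W3 30 II VV JJ)) (WAdd (WAdd (xS II xy) (xWW JJ xy xz)) (xT VV xz)).
Definition t_backward := tmin4 (W3 27 II VV N1) (WAdd (W3 28 II VV JJ) (xT VV xz))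
  (WAdd (xS II xy) (W3 31 II VV down)) (WAdd (WAdd (xS II xy) (xWW JJ xz xy)) (xT VV xz)).
Definition t_ans :=
  Br (bor (BWLe WInfty (xD II VV)) (BILe xz lit0)) (LW (xD II VV))
  (Br (BAnd (BILe xy JJ) (blt JJ xz)) t_forward
  (Br (BAnd (BILe xz JJ) (blt JJ xy)) t_backward (LW (xD II VV)))).
Definition t_out :=
  let an a b c := LW (W3 34 a b c) in
  Br (BILe II JJ)
    (Br (BILe JJ VV) (an II JJ VV) (Br (BILe II VV) (an II VV JJ) (an VV II JJ)))
    (Br (BILe II VV) (an JJ II VV) (Br (BILe JJ VV) (an JJ VV II) (an VV JJ II))).
Definition t_path := LI (xV VV).

Definition n3 := IMul (IMul nn nn) nn.
(** The logarithm is already below [n], so [IMod] leaves its value unchanged; it lowers the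
    syntactic degree of the bound to 5. *)
Definition n3log := IMul n3 (IAdd (IMod (xLG N1) nn) lit1).

Definition tables : seq table :=
  [:: Table 4 n3 t_hops; Table 5 n3 t_pred; Table 6 n3 t_trace; Table 7 n3 t_size; Table 8 n3 t_edge;
      Table 9 n3 t_weight; Table 10 n3 t_floyd; Table 11 n3 t_M; Table 12 n3 t_pos; Table 13 n3 t_S;
      Table 14 n3 t_T; Table 15 n3 t_U; Table 16 n3 t_sg; Table 17 n3 t_tg; Table 18 n3 t_D;
      Table 19 n3 t_Z; Table 20 n3 t_Y; Table 21 n3 t_log; Table 22 n3 t_pow;
      Table 23 n3log t_spA; Table 24 n3log t_spB; Table 25 n3 t_GA; Table 26 n3 t_GB;
      Table 27 n3 t_OO; Table 28 n3 t_upA; Table 29 n3 t_downA; Table 30 n3 t_upB; Table 31 n3 t_downB;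
      Table 32 n3 t_W0; Table 33 n3 t_W; Table 34 n3 t_ans; Table 1 n3 t_out; Table 2 n3 t_path].

Definition program : cmd := Seq (fill_all tables) (IPut 1 lit0 (I3 7 lit0 lit0 N1)).

(** The exponent 30 of the word size bounds the degrees of all expressions in the tables, nested
    addresses included. *)
Lemma wf_program : wf_tables 30 [:: 0%N] tables.
Proof. by vm_compute. Qed.

(** * Reading the tables *)

Lemma idenE (R : realType) (x : state R) :
  ((forall k, iden x (ILit k) = k) * (forall a e, iden x (IGet a e) = imem x a (iden x e)) *
  (forall e f, iden x (IAdd e f) = (iden x e + iden x f)%N) *
  (forall e f, iden x (ISub e f) = (iden x e - iden x f)%N) *
  (forall e f, iden x (IMul e f) = (iden x e * iden x f)%N) *
  (forall e f, iden x (IDiv e f) = (iden x e %/ iden x f)%N) *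
  (forall e f, iden x (IMod e f) = (iden x e %% iden x f)%N))%type.
Proof. by []. Qed.

Lemma wdenE (R : realType) (x : state R) :
  ((wden x WZero = 0%E) * (wden x WInfty = +oo%E) *
  (forall a e, wden x (WGet a e) = wmem x a (iden x e)) *
  (forall e f, wden x (WAdd e f) = (wden x e + wden x f)%E) *
  (forall e f, wden x (WSub e f) = (wden x e - wden x f)%E))%type.
Proof. by []. Qed.

Lemma bdenE (R : realType) (x : state R) :
  ((forall e f, bden x (BILe e f) = (iden x e <= iden x f)%N) *
  (forall e f, bden x (BWLe e f) = (wden x e <= wden x f)%E) *
  (forall b, bden x (BNot b) = ~~ bden x b) *
  (forall b c, bden x (BAnd b c) = bden x b && bden x c) *
  (forall b c, bden x (bor b c) = bden x b || bden x c) *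
  (forall e f, bden x (beq e f) = (iden x e == iden x f)) *
  (forall e f, bden x (blt e f) = (iden x e < iden x f)%N) *
  (forall e f, bden x (wlt e f) = (wden x e < wden x f)%E) *
  (bden x btrue = true))%type.
Proof.
do !split=> //=.
- by move=> b c; rewrite negb_and !negbK.
- by move=> e f; rewrite eqn_leq.
- by move=> e f; rewrite ltnNge.
- by move=> e f; rewrite ltNge.
Qed.

Lemma wvalE (R : realType) (x : state R) :
  ((forall e, wval x (LW e) = wden x e) *
  (forall b t u, wval x (Br b t u) = if bden x b then wval x t else wval x u) *
  (forall e, ival x (LI e) = iden x e) *
  (forall b t u, ival x (Br b t u) = if bden x b then ival x t else ival x u))%type.
Proof. by []. Qed.

Lemma cell_ltn n i j v i' j' v' : (j < n)%N -> (v < n)%N ->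
  (i < i')%N || (i == i') && ((j < j')%N || (j == j') && (v < v')%N) ->
  ((i * n + j) * n + v < (i' * n + j') * n + v')%N.
Proof.
move=> jn vn /orP[ii|/andP[/eqP-> /orP[jj|/andP[/eqP-> vv]]]]; last by rewrite ltn_add2l.
  have h : (i.+1 * n <= i' * n)%N by rewrite leq_mul2r ii orbT.
  have h2 : ((i * n + j).+1 * n <= (i' * n + j') * n)%N by rewrite leq_mul2r; lia.
  lia.
have h2 : ((i' * n + j).+1 * n <= (i' * n + j') * n)%N by rewrite leq_mul2r; lia.
lia.
Qed.

Definition table0 := Table 0 (ILit 0) (LI (ILit 0)).

Section Read.
Variables (R : realType) (n : nat).
Variable F : state R.

Definition wcell a i j v := wmem F a ((i * n + j) * n + v).
Definition icell a i j v := imem F a ((i * n + j) * n + v).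
Definition wcell4 a l i j v := wcell a (l * n + i) j v.

Definition filled := forall m e, (m < size tables)%N ->
  (e < iden F (tbound (nth table0 tables m)))%N ->
  exists2 x, written F (nth table0 tables m) e x
    & forall b : nat, b \in [:: 0%N] ++ take m (map tid tables) -> same x F b.

Hypothesis n0 : (0 < n)%N.
Hypothesis Fn : imem F 0 0 = n.
Hypothesis FF : filled.

Definition earlier m (b : nat) := b \in 0%N :: take m (map tid tables).

(* The state in which cell (l, i, j, v) of the m-th table received its value. *)
Record view m (x : state R) l i j v : Prop := View {
  view_n : imem x 0 0 = n;
  view_l : iden x LL = l;
  view_i : iden x II = i;
  view_j : iden x JJ = j;
  view_v : iden x VV = v;
  view_same : forall b, earlier m b -> same x F b;
  view_own : forall i' j' v', (j' < n)%N -> (v' < n)%N ->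
    (i' < l * n + i)%N || (i' == l * n + i)%N && ((j' < j)%N || (j' == j) && (v' < v)%N) ->
    imem x (tid (nth table0 tables m)) ((i' * n + j') * n + v') =
      icell (tid (nth table0 tables m)) i' j' v' /\
    wmem x (tid (nth table0 tables m)) ((i' * n + j') * n + v') =
      wcell (tid (nth table0 tables m)) i' j' v' }.

Lemma viewP4 m l i j v : (m < size tables)%N -> (i < n)%N -> (j < n)%N -> (v < n)%N ->
  (((l * n + i) * n + j) * n + v < iden F (tbound (nth table0 tables m)))%N ->
  exists x, [/\ view m x l i j v,
    is_wtree (tbody (nth table0 tables m)) ->
      wcell4 (tid (nth table0 tables m)) l i j v = wval x (tbody (nth table0 tables m))
  & is_itree (tbody (nth table0 tables m)) ->
      icell (tid (nth table0 tables m)) (l * n + i) j v = ival x (tbody (nth table0 tables m))].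
Proof.
move=> hm iN jN vN he; have [x [w1 w2 w3 w4] hs] := FF hm he; exists x; split=> //.
have xn : imem x 0 0 = n by have [-> _] := hs 0%N (mem_head _ _) 0%N.
have d1 : ((((l * n + i) * n + j) * n + v) %/ n = (l * n + i) * n + j)%N.
  by rewrite divnMDl // divn_small // addn0.
have d2 : (((l * n + i) * n + j) %/ n = l * n + i)%N by rewrite divnMDl // divn_small // addn0.
split=> //.
- by rewrite /LL /cnt /nn !idenE xn w1 !divnMA d1 d2 divnMDl // divn_small // addn0.
- by rewrite /II /cnt /nn !idenE xn w1 divnMA d1 d2 modnMDl modn_small.
- by rewrite /JJ /cnt /nn !idenE xn w1 d1 modnMDl modn_small.
- by rewrite /VV /cnt /nn !idenE xn w1 modnMDl modn_small.
- by move=> i' j' v' h1 h2 h3; apply: w2; apply: cell_ltn.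
Qed.

Section View.
Variables (m : nat) (x : state R) (l i j v : nat).
Hypothesis X : view m x l i j v.

Lemma view_N1 : iden x N1 = n.-1.
Proof. by rewrite /N1 /nn !idenE (view_n X) subn1. Qed.

Lemma view_addr a b c : iden x (addr a b c) = ((iden x a * n + iden x b) * n + iden x c)%N.
Proof. by rewrite /addr /nn !idenE (view_n X). Qed.

Lemma view_W3 a b c d : earlier m a ->
  wden x (W3 a b c d) = wcell a (iden x b) (iden x c) (iden x d).
Proof. by move=> /(view_same X) h; rewrite /W3 wdenE view_addr; have [_ ->] := h (((iden x b * n + iden x c) * n + iden x d)%N). Qed.

Lemma view_I3 a b c d : earlier m a ->
  iden x (I3 a b c d) = icell a (iden x b) (iden x c) (iden x d).
Proof. by move=> /(view_same X) h; rewrite /I3 idenE view_addr; have [-> _] := h (((iden x b * n + iden x c) * n + iden x d)%N). Qed.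

Lemma view_W4 a b c d e : earlier m a ->
  wden x (W4 a b c d e) = wcell4 a (iden x b) (iden x c) (iden x d) (iden x e).
Proof.
move=> /(view_same X) h; rewrite /W4 /addr4 wdenE view_addr /nn !idenE (view_n X).
by rewrite /wcell4 /wcell; have [_ ->] := h ((((iden x b * n + iden x c) * n + iden x d) * n + iden x e)%N).
Qed.

Definition precedes i' j' v' := [&& (j' < n)%N, (v' < n)%N &
  (i' < l * n + i)%N || (i' == l * n + i)%N && ((j' < j)%N || (j' == j) && (v' < v)%N)].

Lemma view_W3own a b c d : tid (nth table0 tables m) = a ->
  precedes (iden x b) (iden x c) (iden x d) ->
  wden x (W3 a b c d) = wcell a (iden x b) (iden x c) (iden x d).
Proof.
move=> <- /and3P[h1 h2 h3]; rewrite /W3 wdenE view_addr.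
by have [_ ->] := view_own X h1 h2 h3.
Qed.

Lemma view_I3own a b c d : tid (nth table0 tables m) = a ->
  precedes (iden x b) (iden x c) (iden x d) ->
  iden x (I3 a b c d) = icell a (iden x b) (iden x c) (iden x d).
Proof.
move=> <- /and3P[h1 h2 h3]; rewrite /I3 idenE view_addr.
by have [-> _] := view_own X h1 h2 h3.
Qed.

Lemma view_W4own a b c d e : tid (nth table0 tables m) = a ->
  precedes (iden x b * n + iden x c) (iden x d) (iden x e) ->
  wden x (W4 a b c d e) = wcell4 a (iden x b) (iden x c) (iden x d) (iden x e).
Proof.
move=> <- /and3P[h1 h2 h3]; rewrite /W4 /addr4 wdenE view_addr /nn !idenE (view_n X).
by rewrite /wcell4; have [_ ->] := view_own X h1 h2 h3.
Qed.
End View.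

Lemma iden_n3log : iden F n3log = (n * n * n * (icell 21 0 0 n.-1 %% n + 1))%N.
Proof.
by rewrite /n3log /n3 /xLG /I3 /addr /lit0 /lit1 /N1 /nn /icell !idenE Fn subn1 !mul0n !add0n.
Qed.

Lemma iden_size a : iden F (I3 a lit0 lit0 N1) = icell a 0 0 n.-1.
Proof. by rewrite /I3 /addr /lit0 /N1 /nn /lit1 /icell !idenE Fn subn1 mul0n. Qed.

#[local] Opaque II JJ VV LL N1 W3 I3 W4.

Lemma viewP m i j v : (m < size tables)%N -> tbound (nth table0 tables m) = n3 ->
  (i < n)%N -> (j < n)%N -> (v < n)%N ->
  exists x, [/\ view m x 0 i j v,
    is_wtree (tbody (nth table0 tables m)) ->
      wcell (tid (nth table0 tables m)) i j v = wval x (tbody (nth table0 tables m))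
  & is_itree (tbody (nth table0 tables m)) ->
      icell (tid (nth table0 tables m)) i j v = ival x (tbody (nth table0 tables m))].
Proof.
move=> hm hb iN jN vN; have [|x [h1 h2 h3]] := @viewP4 m 0 i j v hm iN jN vN.
  rewrite hb /n3 /nn /= Fn.
  have h1 : ((i.+1) * n <= n * n)%N by rewrite leq_mul2r iN orbT.
  have h2 : ((i * n + j).+1 * n <= n * n * n)%N by rewrite leq_mul2r; lia.
  lia.
by exists x.
Qed.

Lemma wval_tmin (x : state R) t e P Q : is_wtree t -> dval (wval x t) P -> dval (wden x e) Q ->
  dval (wval x (tmin t e)) (fun r => P r \/ Q r).
Proof.
elim: t => [e' _|e' //|b t1 IH1 t2 IH2]; first exact: dval_min.
by rewrite /= => /andP[h1 h2]; case: (bden x b) => hP hQ; [exact: IH1|exact: IH2].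
Qed.

(** Read in the last column, such a row gives the minimum over all candidates; in an intermediate
    column, a minimum over an initial range. Both uses occur below. *)
Lemma wacc m a b t cc (phi : nat -> R -> Prop) i j :
  nth table0 tables m = Table a n3 (tacc a b t) -> (m < size tables)%N -> is_wtree t ->
  is_wtree (tacc a b t) ->
  (i < n)%N -> (j < n)%N ->
  (forall v x, (v < n)%N -> view m x 0 i j v -> bden x b = cc v /\ (cc v -> dval (wval x t) (phi v))) ->
  forall v, (v < n)%N ->
    dval (wcell a i j v) (fun r => exists z, [/\ (z <= v)%N, cc z & phi z r]).
Proof.
move=> E hm wt wt' iN jN H; elim=> [|v IH] vn.
  have [|x [X hw _]] := @viewP m i j 0 hm _ iN jN vn; first by rewrite E.
  move: hw; rewrite E [tbody _]/= [tid _]/= => /(_ wt')->; rewrite /tacc !wvalE !bdenE /= (view_v X) leqnn; have [-> hphi] := H _ _ vn X.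
  case: ifP => hc.
    apply: dval_ext (hphi hc) _ => r; split; first by move=> h; exists 0%N.
    by case=> z [h _ +]; rewrite (_ : z = 0%N) //; lia.
  apply: dval_ext (dval_pinfty R) _ => r; split=> //.
  by case=> z [h +]; rewrite (_ : z = 0%N) ?hc //; lia.
have [|x [X hw _]] := @viewP m i j v.+1 hm _ iN jN vn; first by rewrite E.
move: hw; rewrite E [tbody _]/= [tid _]/= => /(_ wt')->; rewrite /tacc !wvalE !bdenE /= (view_v X) leqn0 /=; have [-> hphi] := H _ _ vn X.
have own : wden x (W3 a II JJ (ISub VV lit1)) = wcell a i j v.
  have pr : precedes 0 i j v.+1 (iden x II) (iden x JJ) (iden x (ISub VV lit1)).
    rewrite (view_i X) (view_j X) /= (view_v X) subn1 /precedes jN (ltnW vn).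
    by rewrite !eqxx ltnSn !orbT.
  rewrite (view_W3own X _ pr) ?E // (view_i X) (view_j X) /= (view_v X).
  by rewrite subn1.
have IHv := IH (ltnW vn).
case: ifP => hc.
  apply: dval_ext (wval_tmin wt (hphi hc) (_ : dval _ _)) _; first by rewrite own; apply: IHv.
  move=> r; split=> [[h|[z [h1 h2 h3]]]|[z [h1 h2 h3]]]; first by exists v.+1.
    by exists z; split=> //; apply: leqW.
  move: h1; rewrite leq_eqVlt => /orP[/eqP e|h1]; first by left; rewrite -e.
  by right; exists z.
rewrite own; apply: dval_ext IHv _ => r; split=> [[z [h1 h2 h3]]|[z [h1 h2 h3]]].
  by exists z; split=> //; apply: leqW.
move: h1; rewrite leq_eqVlt => /orP[/eqP e|h1]; first by move: h2; rewrite e hc.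
by exists z.
Qed.

Lemma isearch m a b e d cc (val : nat -> nat) d' i j :
  nth table0 tables m = Table a n3 (tsearch a b e d) -> (m < size tables)%N ->
  (i < n)%N -> (j < n)%N ->
  (forall v x, (v < n)%N -> view m x 0 i j v -> [/\ bden x b = cc v, iden x e = val v & iden x d = d']) ->
  forall v, (v < n)%N ->
    (exists z, [/\ (z <= v)%N, cc z & icell a i j v = val z]) \/
    ((forall z, (z <= v)%N -> ~~ cc z) /\ icell a i j v = d').
Proof.
move=> E hm iN jN H; elim=> [|v IH] vn.
  have [|x [X _ hw]] := @viewP m i j 0 hm _ iN jN vn; first by rewrite E.
  move: hw; rewrite E [tbody _]/= [tid _]/= => /(_ isT)->; rewrite /tsearch !wvalE !bdenE /= (view_v X) leqnn; have [-> -> ->] := H _ _ vn X; case: ifP => hc; first by left; exists 0%N.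
  by right; split=> // z; rewrite leqn0 => /eqP->; rewrite hc.
have [|x [X _ hw]] := @viewP m i j v.+1 hm _ iN jN vn; first by rewrite E.
move: hw; rewrite E [tbody _]/= [tid _]/= => /(_ isT)->; rewrite /tsearch !wvalE !bdenE /= (view_v X) leqn0 /=; have [-> -> _] := H _ _ vn X.
have -> : iden x (I3 a II JJ (ISub VV lit1)) = icell a i j v.
  have pr : precedes 0 i j v.+1 (iden x II) (iden x JJ) (iden x (ISub VV lit1)).
    rewrite (view_i X) (view_j X) /= (view_v X) subn1 /precedes jN (ltnW vn).
    by rewrite !eqxx ltnSn !orbT.
  rewrite (view_I3own X _ pr) ?E // (view_i X) (view_j X) /= (view_v X).
  by rewrite subn1.
case: ifP => hc; first by left; exists v.+1.
case: (IH (ltnW vn)) => [[z [h1 h2 h3]]|[h1 h2]].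
  by left; exists z; split=> //; apply: leqW.
by right; split=> // z; rewrite leq_eqVlt => /orP[/eqP->|/h1//]; rewrite hc.
Qed.

End Read.

#[local] Opaque II JJ VV LL N1 W3 I3 W4.

(** * The shortest path *)

Ltac ev X := rewrite /= ?(view_v X) ?(view_i X) ?(view_j X) ?(view_N1 X) /=.

Section Path.
Variables (R : realType) (n : nat) (G : wgraph R n) (s t : 'I_n) (F : state R).
Local Notation N := n.-1.
Hypothesis F0 : forall a, imem F 0 a = imem (input G s t) 0 a /\
                          wmem F 0 a = wmem (input G s t) 0 a.
Hypothesis FF : filled F.
Local Notation T := (wcell n F).
Local Notation TI := (icell n F).

Lemma n_gt0 : (0 < n)%N. Proof. exact: leq_ltn_trans (leq0n s) (ltn_ord s). Qed.
Let n0 := n_gt0.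
Let Nn : (N < n)%N. Proof. by have := n0; lia. Qed.

Lemma Fn : imem F 0 0 = n. Proof. by have [-> _] := F0 0. Qed.

Lemma input_weight (u v : 'I_n) :
  dval (wmem F 0 (u * n + v)) (fun r => [set u; v] \in edges G /\ weight G [set u; v] <= r).
Proof.
have [_ ->] := F0 (u * n + v); rewrite /=.
case: pickP => [[u' v'] /= /eqP e|/(_ (u, v))]; last by rewrite /= eqxx.
have [<- <-] : u' = u /\ v' = v.
  have e1 := congr1 (divn^~ n) e; have e2 := congr1 (modn^~ n) e.
  rewrite /= !divnMDl // !divn_small // !addn0 in e1.
  by rewrite /= !modnMDl !modn_small // in e2; split; apply: val_inj.
rewrite /adj; case: ifP => h; first by apply: dval_ext (dval_fin _) _ => r; split=> [|[]].
by apply: dval_ext (dval_pinfty R) _ => r; split=> // -[].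
Qed.

Lemma view_s m x l i j v : view n F m x l i j v -> imem x 0 1 = s :> nat /\ imem x 0 2 = t :> nat.
Proof.
move=> X; have h := view_same X (mem_head _ _).
by have [-> _] := h 1%N; have [-> _] := h 2; have [-> _] := F0 1%N; have [-> _] := F0 2.
Qed.

Lemma view_w m x l i j v a b (u w : 'I_n) : view n F m x l i j v ->
  iden x a = u :> nat -> iden x b = w :> nat ->
  wden x (xw a b) = wmem F 0 (u * n + w).
Proof.
move=> X ha hb; rewrite /xw /= (view_n X) ha hb.
by have [_ ->] := view_same X (mem_head _ _) (u * n + w)%N.
Qed.

#[local] Opaque xw.

(** The Bellman-Ford invariant: walks from [s] with at most [h] edges. *)
Fixpoint hops h (v : 'I_n) (r : R) : Prop :=
  if h is h'.+1 then
    hops h' v r \/ exists u a, [/\ [set u; v] \in edges G, hops h' u a & a + weight G [set u; v] <= r]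
  else v = s /\ 0 <= r.

Lemma hopsS h v r : hops h v r -> hops h.+1 v r. Proof. by left. Qed.

Lemma hops_leq h h' v r : (h <= h')%N -> hops h v r -> hops h' v r.
Proof. by elim: h' => [|h' IH]; [case: h|rewrite leq_eqVlt => /orP[/eqP->|/IH h1 /h1/hopsS]]. Qed.

Lemma table_hopsP h (v : 'I_n) : (h < n)%N -> dval (T 4 h v N) (hops h v).
Proof.
elim: h v => [|h IH] v hn.
  apply: dval_ext (wacc (cc := xpredT) (phi := fun _ r => v = s /\ 0 <= r) n0 Fn FF
    (m := 0) (t := _) (i := 0) (j := v) erefl _ _ _ _ _ _ Nn) _ => //.
    move=> z x zn X; split=> // _; ev X; have [-> _] := view_s X; rewrite -eqn_leq.
    case: eqP => e; first by apply: dval_ext (dval_fin 0) _ => r; split=> [|[]] //; split=> //; apply: val_inj.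
    by apply: dval_ext (dval_pinfty R) _ => r; split=> // -[e'] _; case: e; rewrite e'.
  by move=> r; split=> [[z []]|h] //; exists 0%N.
have hn' := ltnW hn.
apply: dval_ext (wacc (cc := xpredT) (phi := fun z r => (z = v :> nat /\ hops h v r) \/
    exists u : 'I_n, z = u :> nat /\ exists a, [/\ [set u; v] \in edges G, hops h u a & a + weight G [set u; v] <= r])
    n0 Fn FF (m := 0) (t := _) (i := h.+1) (j := v) erefl _ _ _ _ _ _ Nn) _ => //.
  move=> z x zn X; split=> // _; ev X.
  have own a (u : 'I_n) : iden x a = u :> nat -> wden x (xB hp a) = T 4 h u N.
    move=> ha; rewrite /xB /hp (view_W3own X) ?(view_N1 X) //; ev X; rewrite ha ?subn1 //.
    by rewrite /precedes ltn_ord Nn ltnSn.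
  rewrite -eqn_leq; case: eqP => e.
    rewrite (own JJ v) ?(view_j X) //; apply: dval_ext (IH v hn') _ => r; split; first by left.
    case=> [[]//|[u [zu [a [hE ha hr]]]]].
    by have := edges_card2 hE; rewrite (_ : u = v) ?setUid ?cards1 //; apply: val_inj; rewrite /= -zu.
  rewrite (own VV (Ordinal zn)) ?(view_v X) // (view_w (u := Ordinal zn) (w := v) X) ?(view_v X) ?(view_j X) //.
  apply: dval_ext (dval_add (IH (Ordinal zn) hn') (input_weight _ v)) _ => r; split.
    case=> a [b [h1 [h2 h3] h4]]; right; exists (Ordinal zn); split=> //; exists a; split=> //; lra.
  case=> [[]//|[u [zu [a [hE ha hr]]]]].
  have <- : u = Ordinal zn by apply: val_inj.
  by exists a, (weight G [set u; v]); split.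
move=> r; split.
  case=> z [_ _ [[_ h1]|[u [_ [a [h1 h2 h3]]]]]]; first by left.
  by right; exists u, a.
case=> [h1|[u [a [h1 h2 h3]]]].
  by exists v; split=> //; [have := ltn_ord v; lia | left].
exists u; split=> //; first by have := ltn_ord u; lia.
by right; exists u; split=> //; exists a.
Qed.

(** The bound [r] that separates stage [h.+1] from stage [h] records a strict improvement, the
    reason why the traced path is simple even with edges of weight 0. *)
Lemma table_predP h (v : 'I_n) : (h.+1 < n)%N ->
  (TI 5 h.+1 v N = v /\ forall r, hops h.+1 v r -> hops h v r) \/
  exists u : 'I_n, [/\ TI 5 h.+1 v N = u, [set u; v] \in edges G,
    exists r, hops h.+1 v r /\ ~ hops h v r &
    forall r, hops h.+1 v r -> exists2 a, hops h u a & a + weight G [set u; v] <= r].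
Proof.
move=> hn; have hn' := ltnW hn.
have B1 := table_hopsP v hn; have B0 := table_hopsP v hn'.
case: (isearch (cc := fun z => (T 4 h.+1 v N < T 4 h v N)%E &&
      (T 4 h z N + wmem F 0 (z * n + v) <= T 4 h.+1 v N)%E) (val := id) (d' := v) n0 Fn FF
   (m := 1) (i := h.+1) (j := v) erefl _ _ _ _ Nn) => //.
- move=> z x zn X; rewrite (view_v X) (view_j X); split=> //.
  rewrite /= /xB /hp !(view_W3 X) //; ev X; rewrite subn1 /= -ltNge.
  by rewrite (view_w (u := Ordinal zn) (w := v) X) ?(view_v X) ?(view_j X).
- move=> [z [zN /andP[c1 c2] ->]]; right.
  have zn : (z < n)%N by apply: leq_ltn_trans zN Nn.
  have C := dval_add (table_hopsP (Ordinal zn) hn') (input_weight (Ordinal zn) v).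
  have c2' := (dval_le_cmp C B1).1 c2.
  have [r [h1 h2]] : exists r, hops h.+1 v r /\ ~ hops h v r.
    case: (B1) (B0) c1 => n1 e1 [n2 e2]; case: (T 4 h.+1 v N) n1 e1 => [b| |] // n1 e1 c1.
      exists b; split; first by apply/e1.
      by move=> /e2 hb; move: c1; rewrite ltNge hb.
    by move: c1; rewrite ltNge leey.
  exists (Ordinal zn); split=> //.
  - by have [a [b [_ [hE _] _]]] := c2' r h1.
  - by exists r.
  - by move=> r' /c2'[a [b [h3 [_ h4] h5]]]; exists a => //; lra.
move=> [none ->]; left; split=> // r hr.
have [a Ea [ha ar]] := dval_real B1 hr.
case: ha => [ha|[u [c [hE hc hr']]]]; first by apply: dval_le B0 ha ar.
apply: (dval_le B0 _ ar).
have := none u; rewrite -ltnS prednK // ltn_ord => /(_ isT).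
have C := dval_add (table_hopsP u hn') (input_weight u v).
have -> /= : (T 4 h u N + wmem F 0 (u * n + v) <= T 4 h.+1 v N)%E.
  by rewrite Ea; apply/C.2; exists c, (weight G [set u; v]).
by rewrite andbT -leNgt Ea => /B0.2.
Qed.

Definition vt h := TI 6 0 0 (N - h).
Definition Vt h : 'I_n := insubd s (vt h).

Lemma vt_last h : (N <= h)%N -> vt h = t.
Proof.
move=> hN; rewrite /vt (_ : (N - h = 0)%N); last by lia.
have [x [X _ hi]] := viewP n0 Fn FF (m := 2) (i := 0) (j := 0) (v := 0) isT erefl n0 n0 n0.
by have := hi isT; rewrite [tid _]/= => ->; ev X; have [_ ->] := view_s X.
Qed.

Lemma vt_step h : (h.+1 < n)%N -> vt h = TI 5 h.+1 (vt h.+1) N.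
Proof.
move=> hn; rewrite /vt; have c : (N - h = (N - h.+1).+1)%N by lia.
have cn : (N - h < n)%N by lia.
have [x [X _ hi]] := viewP n0 Fn FF (m := 2) (i := 0) (j := 0) (v := N - h) isT erefl n0 n0 cn.
have := hi isT; rewrite [tid _]/= => ->; ev X; rewrite {1}c /=.
rewrite (view_I3 X) //; ev X; rewrite ?(view_n X).
rewrite (_ : (n - (N - h) = h.+1)%N); last by lia.
rewrite (view_I3own X) //=; ev X; rewrite c subn1 //=.
by rewrite /precedes n0 !eqxx /= !ltnSn -?c; lia.
Qed.

Lemma vtV h : vt h = Vt h :> nat.
Proof.
rewrite /Vt val_insubd; suff -> : (vt h < n)%N by [].
case: (leqP N h) => hN; first by rewrite vt_last.
have [c hc] : exists c, (h + c = N)%N by exists (N - h)%N; lia.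
elim: c h hc {hN} => [|c IH] h hc; first by rewrite vt_last //; lia.
have hn : (h.+1 < n)%N by lia.
have h1 := IH h.+1 ltac:(lia); rewrite vt_step //.
by case: (table_predP (Ordinal h1) hn) => [[/= -> _]|[u [/= -> _ _ _]]].
Qed.

End Path.

#[local] Opaque xw.

(** * The traced path is a simple shortest path *)

Section PathLine.
Variables (R : realType) (n : nat) (G : wgraph R n) (s t : 'I_n) (F : state R).
Local Notation N := n.-1.
Hypothesis F0 : forall a, imem F 0 a = imem (input G s t) 0 a /\
                          wmem F 0 a = wmem (input G s t) 0 a.
Hypothesis FF : filled F.
Local Notation T := (wcell n F).
Local Notation TI := (icell n F).
Local Notation hops := (hops G s).
Local Notation V := (Vt s F).
Hypothesis conn : exists p, is_path G s t p.

Let n0 := n_gt0 s.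
Let Nn : (N < n)%N. Proof. by have := n0; lia. Qed.

Definition post h : R := fine (T 4 h (V h) N).

Lemma V_last h : (N <= h)%N -> V h = t.
Proof. by move=> hN; apply: val_inj; rewrite /= -(vtV F0 FF) (vt_last F0 FF). Qed.

Lemma hops_path h (v : 'I_n) p : path (adj G) s p -> last s p = v -> (size p <= h)%N ->
  hops h v (path_length G s p).
Proof.
elim/last_ind: p h v => [|p w IH] h v.
  by move=> _ /= <- _; apply: hops_leq (leq0n h) _; rewrite /= /path_length /path_edges big_nil.
rewrite rcons_path last_rcons size_rcons => /andP[h1 h2] <-; case: h => // h hs.
right; exists (last s p), (path_length G s p); split=> //; first exact: IH.
rewrite {IH h1 h2 hs}; elim: p (s) => [|y p IH] x /=.
  by rewrite !path_length_cons /path_length /path_edges big_nil; lra.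
by rewrite !path_length_cons; have := IH y; lra.
Qed.

Lemma hops_reach h v r : hops h v r -> reach G set0 set0 s v r.
Proof.
elim: h v r => [|h IH] v r /=; first by case=> -> h; apply: Reach0; rewrite ?inE.
case=> [/IH//|[u [a [hE /IH h1 h2]]]].
by apply: reach_le (reach_trans h1 (reach1 _ _ hE _)) h2; rewrite inE.
Qed.

Lemma uniq_path_size (u : 'I_n) p : uniq (u :: p) -> (size p <= N)%N.
Proof.
move=> /card_uniqP /= e; have : (size p < n)%N; last by lia.
by rewrite -[X in (_ <= X)%N](card_ord n) -e; apply: max_card.
Qed.

Lemma reach_hops r : reach G set0 set0 s t r -> hops N t r.
Proof.
move=> /reach_path[p /and3P[h1 /eqP h2 h3] h4].
apply: dval_le (table_hopsP F0 FF t Nn) _ h4; apply: hops_path h2 (uniq_path_size h3).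
by apply: sub_path h1 => x y; rewrite /adj inE => /andP[].
Qed.

Lemma V_hops h : (h < n)%N -> exists r, hops h (V h) r.
Proof.
move=> hn; have [c hc] : exists c, (h + c = N)%N by exists (N - h)%N; lia.
elim: c h hc {hn} => [|c IH] h hc.
  rewrite V_last; last by lia.
  have [p /and3P[h1 /eqP h2 h3]] := conn; exists (path_length G s p).
  by rewrite (_ : h = N); [apply: hops_path h2 (uniq_path_size h3)|lia].
have hn : (h.+1 < n)%N by lia.
have [r hr] := IH h.+1 ltac:(lia).
have := vt_step F0 FF hn; rewrite !(vtV F0 FF).
case: (table_predP F0 FF (V h.+1) hn) => [[-> h1] e|[u [-> _ _ h1] e]].
  by exists r; rewrite (_ : V h = V h.+1); [apply: h1|apply: val_inj].
by have [a ha _] := h1 _ hr; exists a; rewrite (_ : V h = u) //; apply: val_inj.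
Qed.

Lemma postP h : (h < n)%N -> T 4 h (V h) N = (post h)%:E.
Proof.
move=> hn; have [r hr] := V_hops hn.
by have [a e _] := dval_real (table_hopsP F0 FF (V h) hn) hr; rewrite /post e.
Qed.

Lemma hopsP h r : (h < n)%N -> hops h (V h) r <-> post h <= r.
Proof.
move=> hn; have [_ h2] := table_hopsP F0 FF (V h) hn.
by rewrite -h2 postP // lee_fin.
Qed.

Definition moves h := [/\ [set V h; V h.+1] \in edges G,
  weight G [set V h; V h.+1] = post h.+1 - post h &
  exists r, hops h.+1 (V h.+1) r /\ ~ hops h (V h.+1) r].
Definition stays h := [/\ V h = V h.+1, post h = post h.+1 &
  forall r, hops h.+1 (V h.+1) r -> hops h (V h.+1) r].

Lemma moves_or_stays h : (h.+1 < n)%N -> moves h \/ stays h.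
Proof.
move=> hn; have hn' := ltnW hn; have := vt_step F0 FF hn; rewrite !(vtV F0 FF).
case: (table_predP F0 FF (V h.+1) hn) => [[-> h1] e|[u [-> hE h2 h1] e]].
  have eV : V h = V h.+1 by apply: val_inj.
  right; split=> //; apply/eqP; rewrite eq_le; apply/andP; split.
    by apply/(hopsP _ hn'); rewrite eV; apply: h1; apply/(hopsP _ hn).
  by apply/(hopsP _ hn); rewrite -eV; left; apply/(hopsP _ hn').
have eV : V h = u by apply: val_inj.
rewrite -eV in hE h1; left; split=> //.
have [a /(hopsP _ hn') ha hr] := h1 (post h.+1) ((hopsP _ hn).2 (lexx _)).
have : post h.+1 <= post h + weight G [set V h; V h.+1].
  by apply/(hopsP _ hn); right; exists (V h), (post h); split=> //; apply/(hopsP _ hn').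
lra.
Qed.

(** If the last edge brought nothing to [V h.+1], the next edge could be appended one stage earlier,
    against its strict improvement. Hence the moves come first and all repetitions of t stand at the
    end. *)
Lemma moves_down h : (h.+2 < n)%N -> moves h.+1 -> moves h.
Proof.
move=> hn [hE hw [r [h1 h2]]]; have [//|[_ _ h3]] := moves_or_stays (ltnW hn).
case: h2; right; exists (V h.+1), (post h.+1); split=> //.
  by apply: h3; apply/hopsP => //; apply: ltnW.
by have := (hopsP r hn).1 h1; lra.
Qed.

Lemma nedges_exists : exists L, [/\ (L <= N)%N, forall h, (h < L)%N -> moves h
  & forall h, (L <= h)%N -> (h < N)%N -> stays h].
Proof.
suff : forall m, (m <= N)%N -> exists L, [/\ (L <= m)%N, forall h, (h < L)%N -> moves h
  & forall h, (L <= h)%N -> (h < m)%N -> stays h] by move=> /(_ N (leqnn _)).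
elim=> [|m IH] hm; first by exists 0%N.
have [L [h1 h2 h3]] := IH (ltnW hm).
have [mv|st] := @moves_or_stays m ltac:(lia); last first.
  exists L; split=> //; first by lia.
  by move=> h hL; rewrite ltnS leq_eqVlt => /orP[/eqP->|/h3]//; apply.
exists m.+1; split=> //; last by move=> h; lia.
move=> h hh; have [c hc] : exists c, (h + c = m)%N by exists (m - h)%N; lia.
elim: c h hc {hh} => [|c IHc] h hc; first by rewrite (_ : h = m) //; lia.
by apply: moves_down; [lia | apply: IHc; lia].
Qed.

Lemma post_step h : (h.+1 < n)%N -> (V h = V h.+1 /\ post h = post h.+1) \/
  ([set V h; V h.+1] \in edges G /\ weight G [set V h; V h.+1] = post h.+1 - post h).
Proof. by move=> /moves_or_stays[[h1 h2 _]|[h1 h2 _]]; [right | left]. Qed.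

Lemma post_mono a b : (a <= b)%N -> (b < n)%N -> post a <= post b.
Proof.
elim: b => [|b IH] ab bn; first by rewrite (_ : a = 0%N) //; lia.
move: ab; rewrite leq_eqVlt => /orP[/eqP->//|ab].
have h1 := IH ab (ltnW bn); case: (post_step bn) => [[_ <-] //|[/weight_ge0 h2 h3]].
by move: h2; rewrite h3; lra.
Qed.

Lemma V0 : V 0 = s. Proof. by have [r []] := V_hops n0. Qed.

Lemma post0 : post 0 = 0.
Proof.
have h := hopsP _ n0; have h1 : post 0 <= 0 by apply/h; split=> //; exact: V0.
by have [_ h2] := (h (post 0)).2 (lexx _); lra.
Qed.

Lemma reach_post a : (a < n)%N -> reach G set0 set0 s (V a) (post a).
Proof. by move=> an; apply: hops_reach; apply/hopsP. Qed.

Lemma reach_rest a b : (a <= b)%N -> (b < n)%N -> reach G set0 set0 (V a) (V b) (post b - post a).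
Proof.
elim: b => [|b IH] ab bn.
  by rewrite (_ : a = 0%N) ?subrr; [apply: Reach0; rewrite ?inE|lia].
move: ab; rewrite leq_eqVlt => /orP[/eqP->|ab]; first by rewrite subrr; apply: Reach0; rewrite ?inE.
have h := IH ab (ltnW bn); case: (post_step bn) => [[<- <-] //|[h1 h2]].
by apply: reach_le (reach_trans h (reach1 _ _ h1 _)) _; rewrite ?inE // h2; lra.
Qed.

(** A shortcut from one position to another, completed by the path before and after it, would be an
    s-t walk shorter than [post N]. So the distances with a limited number of edges are true
    distances along the path. *)
Lemma post_short a b r : (a < n)%N -> (b < n)%N -> reach G set0 set0 (V a) (V b) r ->
  post a - post b <= r /\ post b - post a <= r.
Proof.
have main c d q : (c < n)%N -> (d < n)%N -> reach G set0 set0 (V c) (V d) q -> post d - post c <= q.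
  move=> cn dn hq; have h1 := reach_trans (reach_trans (reach_post cn) hq) (reach_rest (_ : d <= N)%N Nn).
  have := h1 ltac:(lia); rewrite V_last // => /reach_hops.
  by rewrite -(V_last (leqnn N)) => /(hopsP _ Nn); lra.
by move=> an bn hr; split; [apply: main (reach_sym hr) | apply: main hr].
Qed.

Lemma line_path : line G V post.
Proof.
split; [exact: n0|exact: post0|exact: post_mono|exact: post_short|exact: post_step].
Qed.

(** A repeated vertex would be reached with fewer edges at no greater length, since [post] is
    monotone; this contradicts the strict improvement at its second occurrence. *)
Lemma V_inj L a b : (forall h, (h < L)%N -> moves h) -> (L <= N)%N -> (a < b)%N -> (b <= L)%N ->
  V a <> V b.
Proof.
move=> mv LN ab bL e; case: b ab bL e => // b ab bL e.
have bn : (b.+1 < n)%N by lia.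
have [_ _ [r [h1 h2]]] := mv b bL; apply: h2.
have pb := (hopsP r bn).1 h1; have pab := post_mono (ltnW ab) bn.
rewrite -e; apply: hops_leq (_ : a <= b)%N _ => //.
by apply/hopsP; [lia|lra].
Qed.

Definition is_nedges L := [/\ (L <= N)%N, forall h, (h < L)%N -> moves h
  & forall h, (L <= h)%N -> V h = t].

Lemma is_nedgesP : exists L, is_nedges L.
Proof.
have [L [h1 h2 h3]] := nedges_exists; exists L; split=> // h hL.
case: (leqP N h) => hN; first exact: V_last.
have [c hc] : exists c, (h + c = N)%N by exists (N - h)%N; lia.
elim: c h hc hL {hN} => [|c IH] h hc hL; first by apply: V_last; lia.
by have [-> _ _] := h3 h hL ltac:(lia); apply: IH; lia.
Qed.

Lemma V_genuine L f : is_nedges L -> (f < L)%N -> genuine V f.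
Proof.
move=> [LN mv tl] fL; split=> [|a b af fb bn]; first by lia.
case: (leqP b L) => bL; first by apply: (V_inj mv LN); lia.
by rewrite (tl b (ltnW bL)) -(tl L (leqnn L)); apply: (V_inj mv LN); lia.
Qed.

Lemma table_sizeP L : is_nedges L -> TI 7 0 0 N = L.
Proof.
move=> [LN mv tl].
have tlP z : (z <= N)%N -> (V z == t) = (L <= z)%N.
  move=> zN; case: leqP => zL; first by rewrite tl ?eqxx.
  by apply/eqP => e; apply: (V_inj mv LN zL (leqnn L)); rewrite e tl.
case: (isearch (cc := fun z => [&& (0 < z)%N, V z == t & V z.-1 != t]) (val := id) (d' := 0%N) n0
   (Fn F0) FF (m := 3) (i := 0) (j := 0) erefl isT n0 n0 _ Nn).
- move=> z x zn X; rewrite (view_v X); split=> //.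
  rewrite /= /xV !(view_I3 X) //; ev X; rewrite -!/(vt n F _) ?(view_N1 X) ?(view_v X) /=.
  have [_ ->] := view_s F0 X; rewrite subn1 -!/(vt n F _) !(vtV F0 FF) -!eqn_leq.
  by rewrite !(inj_eq val_inj).
- move=> [z [zN /and3P[z0 e1 e2] ->]].
  by move: e1 e2; rewrite !tlP //; lia.
move=> [none ->]; case: (posnP L) => // L0.
by have := none L LN; rewrite L0 !tlP //; lia.
Qed.

Lemma table_pathP h : (h < n)%N -> imem F 2 h = V h :> nat.
Proof.
move=> hn; have [x [X _ hi]] := viewP n0 (Fn F0) FF (m := 32) (i := 0) (j := 0) (v := h) isT erefl n0 n0 hn.
have := hi isT; rewrite /icell [tid _]/= !mul0n !add0n => ->.
rewrite /= /xV (view_I3 X) //; ev X.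
by rewrite -/(vt n F h) (vtV F0 FF).
Qed.

End PathLine.

(** * Distances off the path *)

Ltac rd X := rewrite /= ?(view_W3 X) // /= ?(view_I3 X) // /= ?(view_v X) ?(view_i X) ?(view_j X) ?(view_N1 X) /=.

Section Tables.
Variables (R : realType) (n : nat) (G : wgraph R n) (s t : 'I_n) (F : state R).
Local Notation N := n.-1.
Hypothesis F0 : forall a, imem F 0 a = imem (input G s t) 0 a /\
                          wmem F 0 a = wmem (input G s t) 0 a.
Hypothesis FF : filled F.
Local Notation T := (wcell n F).
Local Notation TI := (icell n F).
Local Notation V := (Vt s F).
Hypothesis conn : exists p, is_path G s t p.

Let n0 := n_gt0 s.
Let Fn := Fn F0.
Let Nn : (N < n)%N. Proof. by have := n0; lia. Qed.
Local Notation pos := (post s F).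
Let L := line_path F0 FF conn.

Definition offedge (u v : 'I_n) (r : R) : Prop :=
  (u = v /\ 0 <= r) \/
  [/\ [set u; v] \in edges G, [set u; v] \notin pedges V & weight G [set u; v] <= r].

Lemma edge_neq (u v : 'I_n) : [set u; v] \in edges G -> u <> v.
Proof. by move=> /edges_card2 + e; rewrite e setUid cards1. Qed.

Lemma pair_eq (u v a b : 'I_n) : u <> v ->
  ([set u; v] == [set a; b]) = (u == a) && (v == b) || (v == a) && (u == b).
Proof.
move=> uv; apply/eqP/orP => [e|[/andP[/eqP-> /eqP->]|/andP[/eqP-> /eqP->]]] //; last by rewrite setUC.
have hu : u \in [set a; b] by rewrite -e !inE eqxx.
have hv : v \in [set a; b] by rewrite -e !inE eqxx orbT.
move: hu hv; rewrite !inE => /orP[] /eqP hu /orP[] /eqP hv.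
- by case: uv; rewrite hu hv.
- by left; rewrite hu hv !eqxx.
- by right; rewrite hu hv !eqxx.
- by case: uv; rewrite hu hv.
Qed.

Lemma table_edgeP (u v : 'I_n) : u <> v -> (TI 8 u v N <= 0)%N = ([set u; v] \notin pedges V).
Proof.
move=> uv.
have := isearch (cc := fun h => (u == V h) && (v == V h.+1) || (v == V h) && (u == V h.+1))
  (val := fun=> 1%N) (d' := 0%N) n0 Fn FF (m := 4) (i := u) (j := v) erefl isT (ltn_ord _) (ltn_ord _) _ Nn.
case.
- move=> z x zn X; split=> //; rewrite /= /xV; rd X.
  rewrite -!/(vt n F _) addn1 !(vtV F0 FF) -!eqn_leq !(inj_eq val_inj).
  by rewrite negb_and !negbK.
- move=> [z [zN h ->]]; apply/esym/negbTE; rewrite negbK inE.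
  (* At [z = N] the positions [z] and [z.+1] both name t, so a match there would force [u = v]. *)
  move: zN; rewrite leq_eqVlt => /orP[/eqP e|zN].
    by case/orP: h => /andP[/eqP e1 /eqP e2]; case: uv; rewrite e1 e2 e !(V_last F0 FF) //; lia.
  have zn : (z < n)%N by lia.
  apply/existsP; exists (Ordinal zn); rewrite /= (_ : (z.+1 < n)%N); last by lia.
  by rewrite /pedge pair_eq.
move=> [none ->]; apply/esym; rewrite inE negb_exists; apply/forallP => a.
rewrite negb_and -implybE; apply/implyP => an; rewrite /pedge pair_eq //.
by apply: none; lia.
Qed.

Lemma table_weightP (u v : 'I_n) : dval (T 9 0 u v) (offedge u v).
Proof.
have [x [X hw _]] := viewP n0 Fn FF (m := 5) (i := 0) (j := u) (v := v) isT erefl n0 (ltn_ord _) (ltn_ord _).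
have := hw isT; rewrite [tid _]/= => ->; rd X.
rewrite -eqn_leq (inj_eq val_inj); case: eqP => [<-|uv].
  by apply: dval_ext (dval_fin _) _ => r; split=> [h|[[]|[/edge_neq]]] //; left.
rewrite (view_w (u := u) (w := v) X) ?(view_v X) ?(view_j X) //.
rewrite table_edgeP //; case: ifP => h.
  apply: dval_ext (input_weight F0 u v) _ => r; split=> [[h1 h2]|[[//]|[h1 h2 h3]]] //.
  by right.
by apply: dval_ext (dval_pinfty R) _ => r; split=> // -[[]|[_]] //; rewrite h.
Qed.

(** The Floyd-Warshall invariant: inner vertices are numbered below [m]. *)
Fixpoint fw m (u v : 'I_n) (r : R) : Prop :=
  if m is m'.+1 then
    fw m' u v r \/ exists (w : 'I_n) a b, [/\ w = m' :> nat, fw m' u w a, fw m' w v b & a + b <= r]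
  else offedge u v r.

Lemma table_floydP h (u v : 'I_n) : (h < n)%N -> dval (T 10 h u v) (fw h.+1 u v).
Proof.
elim: h u v => [|h IH] u v mn.
  have [x [X hw _]] := viewP n0 Fn FF (m := 6) (i := 0) (j := u) (v := v) isT erefl n0 (ltn_ord _) (ltn_ord _).
  have := hw isT; rewrite [tid _]/= => ->; rewrite /= (view_i X) /=; rd X.
  have := dval_min (table_weightP u v) (dval_add (table_weightP u (Ordinal mn)) (table_weightP (Ordinal mn) v)).
  move=> hh; apply: dval_ext hh _ => r; split=> [[hh|[a [b [h1 h2 h3]]]]|[hh|[w [a [b [h0 h1 h2 h3]]]]]].
  - by left.
  - by right; exists (Ordinal mn), a, b; split.
  - by left.
  have e : w = Ordinal mn by apply: val_inj.
  by rewrite e in h1 h2; right; exists a, b; split.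
have mn' := ltnW mn.
have [x [X hw _]] := viewP n0 Fn FF (m := 6) (i := h.+1) (j := u) (v := v) isT erefl mn (ltn_ord _) (ltn_ord _).
have := hw isT; rewrite [tid _]/= => ->.
have own a b (c d : 'I_n) : iden x a = c :> nat -> iden x b = d :> nat ->
    wden x (W3 10 hp a b) = T 10 h c d.
  move=> ha hb; rewrite /hp (view_W3own X) //=; rewrite (view_i X) ha hb ?subn1 //.
  by rewrite /precedes !ltn_ord ltnSn.
rewrite /t_floyd /= (view_i X) /=.
rewrite (own JJ VV u v) ?(view_j X) ?(view_v X) // (own JJ II u (Ordinal mn)) ?(view_j X) ?(view_i X) //.
rewrite (own II VV (Ordinal mn) v) ?(view_i X) ?(view_v X) //.
have := dval_min (IH u v mn') (dval_add (IH u (Ordinal mn) mn') (IH (Ordinal mn) v mn')).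
move=> hh; apply: dval_ext hh _ => r; split=> [[hh|[a [b [h1 h2 h3]]]]|[hh|[w [a [b [h0 h1 h2 h3]]]]]].
- by left.
- by right; exists (Ordinal mn), a, b; split.
- by left.
have e : w = Ordinal mn by apply: val_inj.
by rewrite e in h1 h2; right; exists a, b; split.
Qed.

Lemma fw_le m u v a b : fw m u v a -> a <= b -> fw m u v b.
Proof.
elim: m u v a b => [|m IH] u v a b /=.
  case=> [[h1 h2] ab|[h1 h2 h3] ab]; first by left; split=> //; lra.
  by right; split=> //; lra.
case=> [h ab|[w [c [d [h1 h2 h3 h4]]]] ab]; first by left; apply: IH ab.
by right; exists w, c, d; split=> //; lra.
Qed.

Lemma fw_ge0 m u v a : fw m u v a -> 0 <= a.
Proof.
elim: m u v a => [|m IH] u v a /=.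
  by case=> [[]//|[/weight_ge0 h _ h2]]; lra.
by case=> [/IH//|[w [c [d [_ /IH h2 /IH h3 h4]]]]]; lra.
Qed.

Lemma fw_trans m (u p v : 'I_n) a b : (p < m)%N -> fw m u p a -> fw m p v b -> fw m u v (a + b).
Proof.
elim: m u p v a b => // m IH u p v a b; rewrite ltnS leq_eqVlt => /orP[/eqP pm|pm].
  have h1 : fw m.+1 u p a -> fw m u p a.
    case=> // -[w [c [d [wm h1 /fw_ge0 h2 h3]]]]; rewrite (_ : p = w) in h1 *; last by apply: val_inj; rewrite /= wm.
    by apply: fw_le h1 _; lra.
  have h2 : fw m.+1 p v b -> fw m p v b.
    case=> // -[w [c [d [wm /fw_ge0 h2 h3 h4]]]]; rewrite (_ : p = w); last by apply: val_inj; rewrite /= wm.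
    by apply: fw_le h3 _; lra.
  by move=> /h1 h3 /h2 h4; right; exists p, a, b.
case=> [h1|[w [c [d [wm h1 h2 h3]]]]] [h4|[w' [c' [d' [wm' h4 h5 h6]]]]].
- by left; apply: IH h4.
- by right; exists w', (a + c'), d'; split=> //; [apply: IH h4 | lra].
- by right; exists w, c, (d + b); split=> //; [apply: IH h4 | lra].
have e : w' = w by apply: val_inj; rewrite /= wm wm'.
have := fw_ge0 h2; have := fw_ge0 h4.
by right; exists w, c, d'; split; rewrite // -?e //; lra.
Qed.

Lemma fw_base m u v r : offedge u v r -> fw m u v r.
Proof. by move=> h; elim: m => [|m IH]; [|left]. Qed.

Lemma fw_reach (u v : 'I_n) r : fw n u v r <-> reach G (pedges V) set0 u v r.
Proof.
have main m x y a : fw m x y a -> reach G (pedges V) set0 x y a.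
  elim: m x y a => [|m IH] x y a /=.
    case=> [[-> h]|[h1 h2 h3]]; first by apply: Reach0; rewrite ?inE.
    by apply: reach_le (reach1 _ _ h1 h2) h3; rewrite inE.
  case=> [/IH//|[w [b [c [_ /IH h1 /IH h2 h3]]]]].
  by apply: reach_le (reach_trans h1 h2) h3.
split; first exact: main.
elim=> [x a _ h|x w y a b _ hE hF _ h1 h2]; first by apply: fw_base; left.
apply: fw_le h2; apply: fw_trans (ltn_ord w) _ h1.
by apply: fw_base; right.
Qed.

Lemma table_MP a b : (a < n)%N -> (b < n)%N -> dval (T 11 0 a b) (Mp G V a b).
Proof.
move=> an bn.
have [x [X hw _]] := viewP n0 Fn FF (m := 7) (i := 0) (j := a) (v := b) isT erefl n0 an bn.
have := hw isT; rewrite [tid _]/= => ->; rewrite /= /xV; rd X.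
rewrite -!/(vt n F _) !(vtV F0 FF); apply: dval_ext (table_floydP _ _ Nn) _ => r.
by rewrite prednK // fw_reach.
Qed.

Lemma table_posP h : (h < n)%N -> T 12 0 0 h = (pos h)%:E.
Proof.
move=> hn.
have [x [X hw _]] := viewP n0 Fn FF (m := 8) (i := 0) (j := 0) (v := h) isT erefl n0 n0 hn.
have := hw isT; rewrite [tid _]/= => ->; rewrite /= /xV /xB; rd X.
by rewrite -!/(vt n F _) !(vtV F0 FF) (postP F0 FF conn).
Qed.

End Tables.

(** * Tables for two failing edges *)

Section Tables13.
Variables (R : realType) (n : nat) (G : wgraph R n) (s t : 'I_n) (F : state R).
Local Notation N := n.-1.
Hypothesis F0 : forall a, imem F 0 a = imem (input G s t) 0 a /\
                          wmem F 0 a = wmem (input G s t) 0 a.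
Hypothesis FF : filled F.
Local Notation T := (wcell n F).
Local Notation TI := (icell n F).
Local Notation V := (Vt s F).
Hypothesis conn : exists p, is_path G s t p.

Let n0 := n_gt0 s.
Let Fn := Fn F0.
Let Nn : (N < n)%N. Proof. by have := n0; lia. Qed.
Local Notation pos := (post s F).
Let L := line_path F0 FF conn.
Local Notation Mp := (Mp G V).
Local Notation Sp := (Sp G V pos).
Local Notation Tp := (Tp G V pos).
Local Notation Up := (Up G V pos).
Local Notation Dp := (Dp G V pos).
Local Notation sgp := (sgp G V pos).
Local Notation tgp := (tgp G V pos).
Local Notation gap := (gap pos).
Let T11 := table_MP F0 FF.
Let T12 := table_posP F0 FF conn.

Lemma gap_le a (u v : nat) r : (u < n)%N -> (v < n)%N ->
  a + gap u v <= r <-> a + (pos u - pos v) <= r /\ a + (pos v - pos u) <= r.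
Proof.
by move=> un vn; have [h1 h2 [h3|h3]] := gapP L un vn; split; rewrite ?h3; lra.
Qed.

Lemma view_tgap m x l i j v e a b : view n F m x l i j v -> earlier m 12 ->
  (iden x a < n)%N -> (iden x b < n)%N ->
  wval x (tgap e a b) = (wden x e + (gap (iden x a) (iden x b))%:E)%E.
Proof.
move=> X h12 an bn; rewrite /= /xP !(view_W3 X) //= !T12 // /gap.
by case: ifP => _; rewrite EFinB.
Qed.

Lemma table_SP i v : (i < n)%N -> (v < n)%N -> dval (T 13 i v N) (Sp i v).
Proof.
move=> iN vn.
apply: dval_ext (wacc (cc := fun z => (z <= i)%N) (phi := fun z r => exists2 a, Mp z v a & pos z + a <= r)
  n0 Fn FF (m := 9) (i := i) (j := v) erefl isT isT isT iN vn _ Nn) _.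
  move=> z x zn X; rewrite /= /xP /xM; rd X; split=> // _; rewrite T12 //.
  by apply: dval_shiftl; apply: T11.
move=> r; split=> [[z [_ h1 [a h2 h3]]]|[z [a [h1 h2 h3]]]]; first by exists z, a.
by exists z; split=> //; [lia | exists a].
Qed.

Lemma table_TP k v : (k < n)%N -> (v < n)%N -> dval (T 14 k v N) (Tp k v).
Proof.
move=> kn vn.
apply: dval_ext (wacc (cc := fun z => (k < z)%N) (phi := fun z r => exists2 a, Mp v z a & a + (pos N - pos z) <= r)
  n0 Fn FF (m := 10) (i := k) (j := v) erefl isT isT isT kn vn _ Nn) _.
  move=> z x zn X; rewrite /= /xP /xM; rd X; rewrite -ltnNge; split=> // _; rewrite !T12 //.
  by rewrite -EFinB; apply: dval_shift; apply: T11.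
move=> r; split=> [[z [h0 h1 [a h2 h3]]]|[z [a [h0 h1 h2 h3]]]]; first by exists z, a; split=> //; lia.
by exists z; split=> //; [lia | exists a].
Qed.

Lemma table_UP i k v : (i < n)%N -> (k < n)%N -> (v < n)%N -> dval (T 15 i v k) (Up i k v).
Proof.
move=> iN kn vn.
apply: dval_ext (wacc (cc := fun z => (i < z)%N) (phi := fun z r => exists2 a, Sp i z a & a + gap z v <= r)
  n0 Fn FF (m := 11) (i := i) (j := v) erefl isT isT isT iN vn _ kn) _.
  move=> z x zn X; rewrite (view_tgap _ X) ?(view_v X) ?(view_j X) //.
  rewrite /= /xS; rd X; rewrite -ltnNge; split=> // _.
  by apply: dval_shift; apply: table_SP.
move=> r; split=> [[z [h0 h1 [a h2 h3]]]|[z [a [h0 h1 h2 h3 h4]]]].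
  have zn : (z < n)%N by lia.
  by have [h4 h5] := (gap_le a r zn vn).1 h3; exists z, a.
by exists z; split=> //; exists a => //; apply/gap_le => //; lia.
Qed.

Lemma table_sgP i v : (i < n)%N -> (v < n)%N -> dval (T 16 0 i v) (sgp i v).
Proof.
move=> iN vn.
have [x [X hw _]] := viewP n0 Fn FF (m := 12) (i := 0) (j := i) (v := v) isT erefl n0 iN vn.
have := hw isT; rewrite [tid _]/= => ->; rewrite /= /xP /xU; rd X.
rewrite /sgp; case: ifP => h; first by rewrite T12 //; apply: dval_fin.
exact: table_UP.
Qed.

Lemma table_tgP k v : (k < n)%N -> (v < n)%N -> dval (T 17 k v N) (tgp k v).
Proof.
move=> kn vn.
apply: dval_ext (wacc (cc := fun z => (k < v)%N || (z <= k)%N) (phi := fun z r =>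
    if (k < v)%N then is_true (pos N - pos v <= r) else exists2 a, Tp k z a & a + gap z v <= r)
  n0 Fn FF (m := 13) (i := k) (j := v) erefl isT isT isT kn vn _ Nn) _.
  move=> z x zn X; rewrite wvalE (view_tgap _ X) ?(view_v X) ?(view_j X) //.
  rewrite /= /xT /xP; rd X; rewrite negb_and !negbK -!ltnNge; split=> // c.
  case: ifP c => h c; first by rewrite !T12 // -EFinB; apply: dval_fin.
  by apply: dval_shift; apply: table_TP.
move=> r; rewrite /tgp; case: ifP => h.
  by split=> [[z [_ _ ->]]|h2]//; exists 0%N.
split=> [[z [h0 h1 [a h2 h3]]]|[z [a [h0 h1 h2 h3]]]].
  have zn : (z < n)%N by lia.
  by have [h4 h5] := (gap_le a r zn vn).1 h3; exists z, a.
exists z; split=> //; first by lia.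
by exists a => //; apply/gap_le => //; lia.
Qed.

Lemma table_DP i k : (i <= k)%N -> (k < n)%N -> dval (T 18 i k N) (Dp i k).
Proof.
move=> ik kn; have iN : (i < n)%N by lia.
apply: dval_ext (wacc (cc := fun z => (i < z)%N) (phi := fun z r =>
    if (z <= k)%N then exists a b, [/\ Up i k z a, Tp k z b & a + b <= r]
    else exists2 a, Sp i z a & a + (pos N - pos z) <= r)
  n0 Fn FF (m := 14) (i := i) (j := k) erefl isT isT isT iN kn _ Nn) _.
  move=> z x zn X; rewrite /= /xU /xT /xS /xP; rd X; rewrite -ltnNge; split=> // _.
  case: ifP => h; first by apply: dval_add; [apply: table_UP | apply: table_TP].
  by rewrite !T12 // -EFinB; apply: dval_shift; apply: table_SP.
move=> r; split.
  case=> z [h0 h1]; case: leqP => zk.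
    by case=> a [b [h2 h3 h4]]; right; exists z, a, b.
  by case=> a h2 h3; left; exists z, a; split=> //; lia.
case=> [[q [a [h1 h2 h3 h4]]]|[q [a [b [h1 h2 h3 h4 h5]]]]]; exists q.
  by split; [lia | lia | rewrite leqNgt h1 /=; exists a].
by split; [lia | lia | rewrite h2; exists a, b].
Qed.

(** The default 0 is unambiguous, since an exit is greater than [i]. *)
Lemma table_ZP i k : (i < n)%N -> (k < n)%N ->
  (exists z, [/\ TI 19 i k N = z, (i < z)%N, (z <= k)%N & (T 15 i z k + T 14 k z N <= T 18 i k N)%E]) \/
  (TI 19 i k N = 0%N /\
   forall z, (i < z)%N -> (z <= k)%N -> ~~ (T 15 i z k + T 14 k z N <= T 18 i k N)%E).
Proof.
move=> iN kn.
case: (isearch (cc := fun z => [&& (i < z)%N, (z <= k)%N & (T 15 i z k + T 14 k z N <= T 18 i k N)%E])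
  (val := id) (d' := 0%N) n0 Fn FF (m := 15) (i := i) (j := k) erefl isT iN kn _ Nn).
- by move=> z x zn X; rewrite (view_v X) /= /xU /xT /xD; rd X; rewrite -ltnNge andbA.
- by move=> [z [_ /and3P[h1 h2 h3] ->]]; left; exists z.
move=> [none ->]; right; split=> // z iz zk; apply/negP => h.
by have /negP := none z ltac:(lia); apply; rewrite iz zk h.
Qed.

Lemma table_YP i k : (i < n)%N -> (k < n)%N ->
  let z := TI 19 i k N in (z < n)%N ->
  (exists y, [/\ TI 20 i k N = y, (i < y)%N, (y <= k)%N &
     (T 13 i y N + (gap y z)%:E <= T 15 i z k)%E]) \/
  (forall y, (i < y)%N -> (y <= k)%N -> ~~ (T 13 i y N + (gap y z)%:E <= T 15 i z k)%E).
Proof.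
move=> iN kn z zn.
(* The program compares with both signed differences; [gap] is the larger of the two. *)
have gapE y : (y < n)%N -> (T 13 i y N + (pos y - pos z)%:E <= T 15 i z k)%E &&
   (T 13 i y N + (pos z - pos y)%:E <= T 15 i z k)%E = (T 13 i y N + (gap y z)%:E <= T 15 i z k)%E.
  move=> yn; have [h1 h2 h3] := gapP L yn zn.
  apply/andP/idP => [[h4 h5]|h4]; first by case: h3 => ->.
  by split; apply: le_trans h4; apply: leeD => //; rewrite lee_fin.
case: (isearch (cc := fun y => [&& (i < y)%N, (y <= k)%N & (T 13 i y N + (gap y z)%:E <= T 15 i z k)%E])
  (val := id) (d' := 0%N) n0 Fn FF (m := 16) (i := i) (j := k) erefl isT iN kn _ Nn).
- move=> y x yn X; rewrite (view_v X) /= /xU /xS /xP /xZ; rd X.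
  by rewrite -ltnNge -/z !T12 // -!EFinB gapE // andbA.
- by move=> [y [_ /and3P[h1 h2 h3] ->]]; left; exists y.
move=> [none _]; right=> y iy yk; apply/negP => h.
by have /negP := none y ltac:(lia); apply; rewrite iy yk h.
Qed.

End Tables13.

(** * Logarithms and powers of 2 *)

Section Logs.
Variables (R : realType) (n : nat) (F : state R).
Hypothesis n0 : (0 < n)%N.
Hypothesis Fn : imem F 0 0 = n.
Hypothesis FF : filled F.
Local Notation TI := (icell n F).

Lemma table_logP v : (v < n)%N -> TI 21 0 0 v = trunc_log 2 v.
Proof.
elim/ltn_ind: v => v IH vn.
have [x [X _ hi]] := viewP n0 Fn FF (m := 17) (i := 0) (j := 0) (v := v) isT erefl n0 n0 vn.
have := hi isT; rewrite [tid _]/= => ->; rewrite /= /xLG (view_v X).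
case: leqP => v1; first by move: v v1 {IH vn X hi} => [|[|v]].
have v2 : (v %/ 2 < v)%N by rewrite divn2; lia.
rewrite (view_I3own X) //=; rewrite (view_v X); last first.
  by rewrite /precedes n0 /= v2; lia.
rewrite IH //; last by lia.
rewrite divn2 [RHS]trunc_log2S //.
(* This keeps the nested differences from being truncated, so that they amount to the logarithm plus
   1. *)
have : (trunc_log 2 v./2 < v./2)%N.
  have h : (0 < v./2)%N by lia.
  by apply: leq_trans (trunc_logP (isT : (1 < 2)%N) h); apply: ltn_expl.
lia.
Qed.

Lemma table_powP l : (l < n)%N -> (2 ^ l <= n)%N -> TI 22 0 0 l = (2 ^ l)%N.
Proof.
elim: l => [|l IH] ln h.
  have [x [X _ hi]] := viewP n0 Fn FF (m := 18) (i := 0) (j := 0) (v := 0) isT erefl n0 n0 n0.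
  by have := hi isT; rewrite [tid _]/= => ->; rewrite /= (view_v X).
have [x [X _ hi]] := viewP n0 Fn FF (m := 18) (i := 0) (j := 0) (v := l.+1) isT erefl n0 n0 ln.
have := hi isT; rewrite [tid _]/= => ->; rewrite /= /xPW (view_v X) /=.
rewrite (view_I3own X) //=; rewrite (view_v X) subn1 /=; last first.
  by rewrite /precedes n0 /= ltnSn; lia.
have h2 : (2 ^ l.+1 = 2 * 2 ^ l)%N by rewrite expnS.
rewrite IH ?(view_n X); lia.
Qed.

End Logs.

(** * Sparse tables for range minima *)

Section Tables23.
Variables (R : realType) (n : nat) (G : wgraph R n) (s t : 'I_n) (F : state R).
Local Notation N := n.-1.
Hypothesis F0 : forall a, imem F 0 a = imem (input G s t) 0 a /\
                          wmem F 0 a = wmem (input G s t) 0 a.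
Hypothesis FF : filled F.
Local Notation T := (wcell n F).
Local Notation TI := (icell n F).
Local Notation V := (Vt s F).
Hypothesis conn : exists p, is_path G s t p.

Let n0 := n_gt0 s.
Let Fn := Fn F0.
Let Nn : (N < n)%N. Proof. by have := n0; lia. Qed.
Local Notation pos := (post s F).
Let L := line_path F0 FF conn.
Local Notation Mp := (Mp G V).
Local Notation Sp := (Sp G V pos).
Local Notation Tp := (Tp G V pos).
Local Notation Up := (Up G V pos).
Local Notation Dp := (Dp G V pos).
Local Notation sgp := (sgp G V pos).
Local Notation tgp := (tgp G V pos).
Local Notation gap := (gap pos).
Let T11 := table_MP F0 FF.
Let T12 := table_posP F0 FF conn.

Let loglt : (trunc_log 2 N < n)%N.
Proof.
case: (posnP N) => [->//|N0].
by apply: leq_trans (leq_trans (ltn_expl _ (isT : (1 < 2)%N)) (trunc_logP (isT : (1 < 2)%N) N0)) _; lia.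
Qed.

Lemma n3logE : iden F n3log = (n * n * n * (trunc_log 2 N).+1)%N.
Proof. by rewrite (iden_n3log Fn) (table_logP n0 Fn FF Nn) (modn_small loglt) addn1. Qed.

Lemma pow_le g : (g <= trunc_log 2 N)%N -> (2 ^ g <= n)%N.
Proof.
case: (posnP N) => [->|N0]; first by rewrite trunc_log0 leqn0 => /eqP->.
move=> h; apply: leq_trans (leq_trans (_ : 2 ^ g <= 2 ^ trunc_log 2 N)%N (trunc_logP _ N0)) _ => //.
  by rewrite leq_exp2l.
lia.
Qed.

Lemma sparseP m a f (phi : nat -> R -> Prop) i :
  nth table0 tables m = Table a n3log (tsparse a f) -> (m < size tables)%N ->
  earlier m 11 -> earlier m 22 -> (i < n)%N ->
  (forall x j v, view n F m x 0 i j v -> (j < n)%N -> dval (wden x f) (phi j)) ->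
  forall l j u, (l <= trunc_log 2 N)%N -> (j < n)%N -> (u < n)%N ->
  dval (wcell4 n F a l i j u)
    (fun r => exists p b c, [/\ (p <= j)%N, (j < p + 2 ^ l)%N, phi p b, Mp p u c & b + c <= r]).
Proof.
move=> E hm e11 e22 iN H; elim=> [|l IH] j u hl jn un.
  have bnd k : (((0 * n + i) * n + j) * n + u < n * n * n * k.+1)%N.
    have h1 : (i.+1 * n <= n * n)%N by rewrite leq_mul2r iN orbT.
    have h2 : ((i * n + j).+1 * n <= n * n * n)%N by rewrite leq_mul2r; lia.
    nia.
  have [|x [X hw _]] := viewP4 n0 Fn FF (m := m) (l := 0) hm iN jn un; first by rewrite E [tbound _]/= n3logE; apply: bnd.
  move: hw; rewrite E [tbody _]/= [tid _]/= => /(_ isT) ->; rewrite /= (view_l X) /= /xM; rd X.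
  apply: dval_ext (dval_add (H _ _ _ X jn) (T11 jn un)) _ => r; split.
    by case=> b [c [h1 h2 h3]]; exists j, b, c; split=> //; lia.
  case=> p [b [c [h1 h2 h3 h4 h5]]]; exists b, c.
  by rewrite (_ : j = p); [|rewrite expn0 in h2; lia].
have ll : (l <= trunc_log 2 N)%N by lia.
have [|x [X hw _]] := viewP4 n0 Fn FF (m := m) (l := l.+1) hm iN jn un.
  rewrite E [tbound _]/= n3logE.
  have h1 : ((l.+1 * n + i).+1 <= n * (trunc_log 2 N).+1)%N.
    have h : (l.+2 * n <= (trunc_log 2 N).+1 * n)%N by rewrite leq_mul2r; lia.
    lia.
  have h2 : ((l.+1 * n + i).+1 * (n * n) <= n * (trunc_log 2 N).+1 * (n * n))%N by rewrite leq_mul2r h1 orbT.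
  have h3 : (j * n + u < n * n)%N.
    have : (j.+1 * n <= n * n)%N by rewrite leq_mul2r jn orbT.
    lia.
  nia.
move: hw; rewrite E [tbody _]/= [tid _]/= => /(_ isT) ->.
have lp_l : iden x lp = l by rewrite /lp /= (view_l X) subn1.
have pw : iden x (xPW lp) = (2 ^ l)%N.
  rewrite /xPW (view_I3 X) // lp_l /= (table_powP n0 Fn FF) ?pow_le //; lia.
have own1 : wden x (W4 a lp II JJ VV) = wcell4 n F a l i j u.
  rewrite (view_W4own X) ?E // ?lp_l ?(view_i X) ?(view_j X) ?(view_v X) //.
  by rewrite /precedes jn un; lia.
rewrite /tsparse wvalE bdenE (view_l X) /= -!/(xPW lp) -!/lp pw own1 (view_j X) -ltnNge.
case: ltnP => jl.
  apply: dval_ext (IH j u ll jn un) _ => r.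
  split=> -[p [b [c [h1 h2 h3 h4 h5]]]]; exists p, b, c; split=> //; rewrite ?expnS in h2 *; lia.
have j'n : (j - 2 ^ l < n)%N by lia.
have own2 : wden x (W4 a lp II (ISub JJ (xPW lp)) VV) = wcell4 n F a l i (j - 2 ^ l) u.
  have e : iden x (ISub JJ (xPW lp)) = (j - 2 ^ l)%N by rewrite /= -/(xPW lp) pw (view_j X).
  rewrite (view_W4own X) ?E // ?e ?lp_l ?(view_i X) ?(view_v X) //.
  by rewrite /precedes j'n un; lia.
rewrite own2; apply: dval_ext (dval_min (IH j u ll jn un) (IH _ u ll j'n un)) _ => r.
rewrite expnS; have p0 : (0 < 2 ^ l)%N by rewrite expn_gt0.
split.
  by case=> -[p [b [c [h1 h2 h3 h4 h5]]]]; exists p, b, c; split=> //; lia.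
case=> p [b [c [h1 h2 h3 h4 h5]]]; case: (ltnP j (p + 2 ^ l)) => h; [left|right].
  by exists p, b, c.
by exists p, b, c; split=> //; lia.
Qed.

Lemma table_spAP l i j u : (l <= trunc_log 2 N)%N -> (i < n)%N -> (j < n)%N -> (u < n)%N ->
  dval (wcell4 n F 23 l i j u)
    (fun r => exists p b c, [/\ (p <= j)%N, (j < p + 2 ^ l)%N, sgp i p b, Mp p u c & b + c <= r]).
Proof.
move=> hl iN; apply: (sparseP (m := 19) erefl) => // x j' v' X j'n.
by rewrite /= /xsg; rd X; apply: table_sgP.
Qed.

Lemma table_spBP l i j u : (l <= trunc_log 2 N)%N -> (i < n)%N -> (j < n)%N -> (u < n)%N ->
  dval (wcell4 n F 24 l i j u)
    (fun r => exists p b c, [/\ (p <= j)%N, (j < p + 2 ^ l)%N, tgp i p b, Mp p u c & b + c <= r]).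
Proof.
move=> hl iN; apply: (sparseP (m := 20) erefl) => // x j' v' X j'n.
by rewrite /= /xtg; rd X; apply: table_tgP.
Qed.

(** With [g] the logarithm of the length of the range, one window of [2 ^ g] positions ending at
    [r0] and one starting at [l0] stay inside the range and cover it; their overlap is harmless for
    a minimum. *)
Lemma rangeP m x l' i' j' v' a e i l r u (phi : nat -> R -> Prop) Q i0 l0 r0 u0 :
  view n F m x l' i' j' v' -> earlier m 21 -> earlier m 22 -> earlier m a ->
  iden x i = i0 -> iden x l = l0 -> iden x r = r0 -> iden x u = u0 ->
  (0 < l0)%N -> (l0 <= r0)%N -> (r0 < n)%N -> dval (wden x e) Q ->
  (forall g j, (g <= trunc_log 2 N)%N -> (j < n)%N -> dval (wcell4 n F a g i0 j u0)
    (fun r => exists p b c, [/\ (p <= j)%N, (j < p + 2 ^ g)%N, phi p b, Mp p u0 c & b + c <= r])) ->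
  dval (wval x (trange a e i l r u)) (fun s => Q s \/
    exists p b c, [/\ (l0 <= p <= r0)%N, phi p b, Mp p u0 c & b + c <= s]).
Proof.
move=> X e21 e22 ea hi hl hr hu l0p lr rn hQ H.
set len := (r0 + 1 - l0)%N; set g := trunc_log 2 len.
have lenN : (len <= N)%N by rewrite /len; lia.
have len0 : (0 < len)%N by rewrite /len; lia.
have gN : (g <= trunc_log 2 N)%N by apply: leq_trunc_log.
have hg : iden x (xLG (ISub (IAdd r lit1) l)) = g.
  rewrite /xLG (view_I3 X) //= hr hl (table_logP n0 Fn FF) //; rewrite -/len; lia.
have hp : iden x (xPW (xLG (ISub (IAdd r lit1) l))) = (2 ^ g)%N.
  rewrite /xPW (view_I3 X) // hg /= (table_powP n0 Fn FF) ?pow_le //; lia.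
have pg1 : (2 ^ g <= len)%N := trunc_logP (isT : (1 < 2)%N) len0.
have pg2 : (len < 2 ^ g.+1)%N := trunc_log_ltn len (isT : (1 < 2)%N).
have p0 : (0 < 2 ^ g)%N by rewrite expn_gt0.
have d1 := wval_tmin (t := LW e) isT hQ (_ : dval (wden x (W4 a (xLG (ISub (IAdd r lit1) l)) i r u)) _).
have {}d1 := d1 _ ltac:(rewrite (view_W4 X) // hg hi hr hu; apply: (H g r0 gN rn)).
have jn : (l0 + 2 ^ g - 1 < n)%N by move: pg1; rewrite /len; lia.
have := wval_tmin (_ : is_wtree (tmin (LW e) (W4 a (xLG (ISub (IAdd r lit1) l)) i r u))) d1
  (_ : dval (wden x (W4 a (xLG (ISub (IAdd r lit1) l)) i
     (ISub (IAdd l (xPW (xLG (ISub (IAdd r lit1) l)))) lit1) u)) _).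
move=> /(_ _ isT).
have hj : iden x (ISub (IAdd l (xPW (xLG (ISub (IAdd r lit1) l)))) lit1) = (l0 + 2 ^ g - 1)%N.
  by rewrite [iden _ _]/= -/(xLG _) -/(xPW _) hp hl.
rewrite (view_W4 X) // hj hg hi hu => /(_ _ (H g _ gN jn)) d2.
apply: dval_ext d2 _ => s'; move: pg1 pg2; rewrite expnS /len => pg1 pg2; split.
  case=> [[h|]|]; [by left| |]; case=> p [b [c [h1 h2 h3 h4 h5]]]; right; exists p, b, c; split=> //; lia.
case=> [h|[p [b [c [h1 h3 h4 h5]]]]]; first by left; left.
by case: (ltnP r0 (p + 2 ^ g)) => h; [left; right|right]; exists p, b, c; split=> //; lia.
Qed.

End Tables23.

(** * Tables for jumps across the middle edge *)

Section Tables25.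
Variables (R : realType) (n : nat) (G : wgraph R n) (s t : 'I_n) (F : state R).
Local Notation N := n.-1.
Hypothesis F0 : forall a, imem F 0 a = imem (input G s t) 0 a /\
                          wmem F 0 a = wmem (input G s t) 0 a.
Hypothesis FF : filled F.
Local Notation T := (wcell n F).
Local Notation TI := (icell n F).
Local Notation V := (Vt s F).
Hypothesis conn : exists p, is_path G s t p.

Let n0 := n_gt0 s.
Let Fn := Fn F0.
Let Nn : (N < n)%N. Proof. by have := n0; lia. Qed.
Local Notation pos := (post s F).
Let L := line_path F0 FF conn.
Local Notation Mp := (Mp G V).
Local Notation Sp := (Sp G V pos).
Local Notation Tp := (Tp G V pos).
Local Notation Up := (Up G V pos).
Local Notation Dp := (Dp G V pos).
Local Notation sgp := (sgp G V pos).
Local Notation tgp := (tgp G V pos).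
Local Notation gap := (gap pos).
Let T11 := table_MP F0 FF.
Let T12 := table_posP F0 FF conn.

Lemma upP m a g e (w : nat -> R -> Prop) i k p :
  nth table0 tables m = Table a n3 (tup a g e) -> (m < size tables)%N -> earlier m 12 ->
  (i < n)%N -> (k < n)%N -> (p < n)%N ->
  (forall x v, view n F m x 0 i k v -> (v < n)%N -> iden x e = p /\ dval (wden x (g II JJ VV)) (w v)) ->
  forall v, (v < n)%N -> dval (T a i k v)
    (fun r => exists u b, [/\ (u <= v)%N, (p <= u)%N, w u b & b + (pos u - pos p) <= r]).
Proof.
move=> E hm e12 iN kn pn H v vn.
apply: dval_ext (wacc (cc := fun u => (p <= u)%N) (phi := fun u r => exists2 b, w u b & b + (pos u - pos p) <= r)
  n0 Fn FF E hm isT isT iN kn _ vn) _.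
  move=> u x un X; have [he hd] := H x u X un.
  rewrite bdenE he (view_v X) wvalE wdenE /xP wdenE !(view_W3 X) //= (view_v X) he !T12 //.
  by split=> // _; rewrite -EFinB; apply: dval_shift.
move=> r; split=> [[u [h1 h2 [b h3 h4]]]|[u [b [h1 h2 h3 h4]]]]; first by exists u, b.
by exists u; split=> //; exists b.
Qed.

Lemma downP m a g e (w : nat -> R -> Prop) i k p :
  nth table0 tables m = Table a n3 (tdown a g e) -> (m < size tables)%N -> earlier m 12 ->
  (i < n)%N -> (k < n)%N -> (p < n)%N ->
  (forall x v, view n F m x 0 i k v -> (v < n)%N ->
     iden x e = p /\ dval (wden x (g II JJ RR)) (w (N - v)%N)) ->
  forall v, (v < n)%N -> dval (T a i k v)
    (fun r => exists u b, [/\ (N - v <= u)%N, (u <= p)%N, w u b & b + (pos p - pos u) <= r]).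
Proof.
move=> E hm e12 iN kn pn H v vn.
apply: dval_ext (wacc (cc := fun u => (N - u <= p)%N)
   (phi := fun u r => exists2 b, w (N - u)%N b & b + (pos p - pos (N - u)%N) <= r)
  n0 Fn FF E hm isT isT iN kn _ vn) _.
  move=> u x un X; have [he hd] := H x u X un.
  have hR : iden x RR = (N - u)%N by rewrite /RR /= (view_N1 X) (view_v X).
  have un' : (N - u < n)%N by lia.
  rewrite bdenE he hR wvalE wdenE /xP wdenE !(view_W3 X) // hR he !T12 //.
  by split=> // _; rewrite -EFinB; apply: dval_shift.
move=> r; split=> [[u [h1 h2 [b h3 h4]]]|[u [b [h1 h2 h3 h4]]]].
  by exists (N - u)%N, b; split=> //; lia.
exists (N - u)%N; rewrite (_ : (N - (N - u) = u)%N); last by lia.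
by split=> //; [lia | exists b].
Qed.

Lemma table_W0P q lo j : (q < n)%N -> (lo < n)%N -> (j < n)%N -> dval (T 32 q lo j)
  (fun r => exists p m, [/\ (p <= j)%N, (lo <= p)%N, Mp p q m & m + (pos p - pos lo) <= r]).
Proof.
move=> qn ln jn.
apply: dval_ext (wacc (cc := fun u => (lo <= u)%N) (phi := fun u r => exists2 b, Mp u q b & b + (pos u - pos lo) <= r)
  n0 Fn FF (m := 28) (i := q) (j := lo) erefl isT isT isT qn ln _ jn) _.
  move=> u x un X; rewrite /= /xP /xM; rd X; split=> // _; rewrite !T12 // -EFinB.
  by apply: dval_shift; apply: T11.
move=> r; split=> [[u [h1 h2 [b h3 h4]]]|[u [b [h1 h2 h3 h4]]]]; first by exists u, b.
by exists u; split=> //; exists b.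
Qed.

Lemma table_WP j lo hi : (j < n)%N -> (lo < n)%N -> (hi < n)%N ->
  dval (T 33 j lo hi + T 12 0 0 hi)%E
  (fun r => exists p q m, [/\ (lo <= p <= j)%N, (j < q <= hi)%N, Mp p q m &
     m + (pos p - pos lo) + (pos hi - pos q) <= r]).
Proof.
move=> jn ln hn; rewrite T12 //.
have h := wacc (cc := fun u => (j < u)%N)
   (phi := fun u r => exists2 b, (exists p m, [/\ (p <= j)%N, (lo <= p)%N, Mp p u m & m + (pos p - pos lo) <= b]) & b - pos u <= r)
  n0 Fn FF (m := 29) (i := j) (j := lo) erefl isT isT isT jn ln _ hn.
apply: dval_ext (dval_shift (pos hi) (h _)) _.
  move=> u x un X; rewrite /= /xP; rd X; rewrite -ltnNge; split=> // _.
  by rewrite !T12 // -EFinN; apply: dval_shift; apply: table_W0P.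
move=> r; split.
  case=> a [q [h1 h2 [b [p [m [h3 h4 h5 h6]]] h7]]] h8; exists p, q, m.
  by rewrite h1 h2 h3 h4; split=> //; lra.
case=> p [q [m [/andP[h1 h2] /andP[h3 h4] h5 h6]]].
exists (m + (pos p - pos lo) - pos q); last by lra.
exists q; split=> //; exists (m + (pos p - pos lo)) => //.
by exists p, m; split.
Qed.

Section Found.
Variables i k y z : nat.
Hypothesis (kn : (k < n)%N) (iy : (i < y)%N) (yk : (y <= k)%N) (iz : (i < z)%N) (zk : (z <= k)%N).
Hypothesis (hy : TI 20 i k N = y) (hz : TI 19 i k N = z).
Let iN : (i < n)%N. Proof. by apply: ltn_trans iy _; apply: leq_ltn_trans yk kn. Qed.
Let yn : (y < n)%N. Proof. exact: leq_ltn_trans yk kn. Qed.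
Let zn : (z < n)%N. Proof. exact: leq_ltn_trans zk kn. Qed.
Local Notation GAp := (GAp G V pos i k y z).
Local Notation GBp := (GBp G V pos i k y z).

Lemma view_Y m x v : view n F m x 0 i k v -> earlier m 20 -> iden x (xY II JJ) = y.
Proof. by move=> X h; rewrite /xY (view_I3 X) // (view_i X) (view_j X) (view_N1 X). Qed.

Lemma view_Z m x v : view n F m x 0 i k v -> earlier m 19 -> iden x (xZ II JJ) = z.
Proof. by move=> X h; rewrite /xZ (view_I3 X) // (view_i X) (view_j X) (view_N1 X). Qed.

Lemma table_GAP u : (u < n)%N -> dval (T 25 i k u) (GAp u).
Proof.
move=> un.
have [x [X hw _]] := viewP n0 Fn FF (m := 21) (i := i) (j := k) (v := u) isT erefl iN kn un.
have := hw isT; rewrite [tid _]/= [tbody _]/= => ->.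
rewrite wvalE bdenE (view_Y X) // (view_Z X) //.
have hS : dval (wden x (xS II VV)) (Sp i u) by rewrite /xS (view_W3 X) //; rd X; apply: table_SP.
have hI : iden x (IAdd II lit1) = i.+1 by rewrite /= (view_i X) addn1.
rewrite /GAp /outY; case: leqP => yz.
  have := rangeP (a := 23) F0 FF X isT isT isT (view_i X) hI (view_Y X isT) (view_v X) isT iy yn hS
     (fun g j hg hj => table_spAP F0 FF conn hg iN hj un).
  move=> h; apply: dval_ext h _ => r.
  by split=> -[h|[p [b [c [h1 h2 h3 h4]]]]]; [left|right; exists p, b, c|left|right; exists p, b, c].
have := rangeP (a := 23) F0 FF X isT isT isT (view_i X) (view_Y X isT) (view_j X) (view_v X) (leq_ltn_trans (leq0n i) iy) yk kn hS
     (fun g j hg hj => table_spAP F0 FF conn hg iN hj un).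
move=> h; apply: dval_ext h _ => r.
by split=> -[h|[p [b [c [h1 h2 h3 h4]]]]]; [left|right; exists p, b, c|left|right; exists p, b, c].
Qed.

Lemma table_GBP u : (u < n)%N -> dval (T 26 i k u) (GBp u).
Proof.
move=> un.
have [x [X hw _]] := viewP n0 Fn FF (m := 22) (i := i) (j := k) (v := u) isT erefl iN kn un.
have := hw isT; rewrite [tid _]/= [tbody _]/= => ->.
rewrite wvalE bdenE (view_Y X) // (view_Z X) //.
have hS : dval (wden x (xT JJ VV)) (Tp k u) by rewrite /xT (view_W3 X) //; rd X; apply: table_TP.
have hI : iden x (IAdd II lit1) = i.+1 by rewrite /= (view_i X) addn1.
rewrite /GBp /outZ; case: leqP => yz.
  have := rangeP (a := 24) F0 FF X isT isT isT (view_j X) (view_Z X isT) (view_j X) (view_v X) (leq_ltn_trans (leq0n i) iz) zk kn hS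
     (fun g j hg hj => table_spBP F0 FF conn hg kn hj un).
  move=> h; apply: dval_ext h _ => r.
  by split=> -[h|[p [b [c [h1 h2 h3 h4]]]]]; [left|right; exists p, b, c|left|right; exists p, b, c].
have := rangeP (a := 24) F0 FF X isT isT isT (view_j X) hI (view_Z X isT) (view_v X) isT iz zn hS
     (fun g j hg hj => table_spBP F0 FF conn hg kn hj un).
move=> h; apply: dval_ext h _ => r.
by split=> -[h|[p [b [c [h1 h2 h3 h4]]]]]; [left|right; exists p, b, c|left|right; exists p, b, c].
Qed.

Lemma table_OOP : dval (T 27 i k N) (OOp G V pos i k y z).
Proof.
apply: dval_ext (wacc (cc := fun u => (k < u)%N || outZ i k y z u)
   (phi := fun u r => exists a b, [/\ GAp u a, tgp k u b & a + b <= r])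
  n0 Fn FF (m := 23) (i := i) (j := k) erefl isT isT isT iN kn _ Nn) _.
  move=> u x un X; split.
    rewrite bdenE /boutZ !bdenE (view_Y X) // (view_Z X) // (view_i X) (view_j X) (view_v X).
    by rewrite /outZ; case: (leqP y z) => yz /=; rewrite ?orbF.
  move=> _; rewrite /= /xGA /xtg; rd X; apply: dval_add; [exact: table_GAP | exact: table_tgP].
move=> r; split=> [[u [h1 h2 [a [b [h3 h4 h5]]]]]|[u [a [b [h1 h2 h3 h4 h5]]]]].
  by exists u, a, b; split=> //; lia.
by exists u; split=> //; [lia | exists a, b].
Qed.

Lemma table_upAP v : (v < n)%N -> dval (T 28 i k v)
  (fun r => exists u b, [/\ (u <= v)%N, (z <= u)%N, GAp u b & b + (pos u - pos z) <= r]).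
Proof.
apply: (upP (m := 24) (a := 28) erefl) => // x v' X v'n; split; first exact: view_Z X _.
by rewrite /xGA (view_W3 X) //; rd X; apply: table_GAP.
Qed.

Lemma table_upBP v : (v < n)%N -> dval (T 30 i k v)
  (fun r => exists u b, [/\ (u <= v)%N, (y <= u)%N, GBp u b & b + (pos u - pos y) <= r]).
Proof.
apply: (upP (m := 26) (a := 30) erefl) => // x v' X v'n; split; first exact: view_Y X _.
by rewrite /xGB (view_W3 X) //; rd X; apply: table_GBP.
Qed.

Lemma table_downAP v : (v < n)%N -> dval (T 29 i k v)
  (fun r => exists u b, [/\ (N - v <= u)%N, (u <= z)%N, GAp u b & b + (pos z - pos u) <= r]).
Proof.
apply: (downP (m := 25) (a := 29) erefl) => // x v' X v'n; split; first exact: view_Z X _.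
by rewrite /xGA (view_W3 X) // /RR; rd X; apply: table_GAP; lia.
Qed.

Lemma table_downBP v : (v < n)%N -> dval (T 31 i k v)
  (fun r => exists u b, [/\ (N - v <= u)%N, (u <= y)%N, GBp u b & b + (pos y - pos u) <= r]).
Proof.
apply: (downP (m := 27) (a := 31) erefl) => // x v' X v'n; split; first exact: view_Y X _.
by rewrite /xGB (view_W3 X) // /RR; rd X; apply: table_GBP; lia.
Qed.

End Found.
End Tables25.

(** * The answer for a sorted triple *)

Section Tables34.
Variables (R : realType) (n : nat) (G : wgraph R n) (s t : 'I_n) (F : state R).
Local Notation N := n.-1.
Hypothesis F0 : forall a, imem F 0 a = imem (input G s t) 0 a /\
                          wmem F 0 a = wmem (input G s t) 0 a.
Hypothesis FF : filled F.
Local Notation T := (wcell n F).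
Local Notation TI := (icell n F).
Local Notation V := (Vt s F).
Hypothesis conn : exists p, is_path G s t p.

Let n0 := n_gt0 s.
Let Fn := Fn F0.
Let Nn : (N < n)%N. Proof. by have := n0; lia. Qed.
Local Notation pos := (post s F).
Let L := line_path F0 FF conn.
Local Notation Mp := (Mp G V).
Local Notation Sp := (Sp G V pos).
Local Notation Tp := (Tp G V pos).
Local Notation Up := (Up G V pos).
Local Notation Dp := (Dp G V pos).
Local Notation sgp := (sgp G V pos).
Local Notation tgp := (tgp G V pos).
Local Notation gap := (gap pos).

Lemma wval_tmin4 (x : state R) a b c d Pa Pb Pc Pd :
  dval (wden x a) Pa -> dval (wden x b) Pb -> dval (wden x c) Pc -> dval (wden x d) Pd ->
  dval (wval x (tmin4 a b c d)) (fun r => [\/ Pa r, Pb r, Pc r | Pd r]).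
Proof.
move=> ha hb hc hd; have h1 := wval_tmin (t := LW a) isT ha hb.
have h2 := wval_tmin (t := tmin (LW a) b) isT h1 hc.
have h3 := wval_tmin (t := tmin (tmin (LW a) b) c) isT h2 hd.
apply: dval_ext h3 _ => r; split.
  by case=> [[[h|h]|h]|h]; [constructor 1|constructor 2|constructor 3|constructor 4].
by case=> h; [left; left; left|left; left; right|left; right|right].
Qed.

Lemma cut_sub_reach fs fs' u v r : {subset fs' <= fs} ->
  reach G (cut V fs) set0 u v r -> reach G (cut V fs') set0 u v r.
Proof.
move=> h; apply: reach_sub => //; apply/subsetP => d; rewrite !inE => /mapP[f /h hf ->].
exact: map_f.
Qed.

Section Triple.
Variables i j k : nat.
Hypothesis (gi : genuine V i) (gj : genuine V j) (gk : genuine V k).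
Hypothesis (ij : (i <= j)%N) (jk : (j <= k)%N).
Local Notation target := (reach G (cut V [:: i; j; k]) set0 (V 0) (V N)).
Let kn : (k < n)%N. Proof. by case: gk => /ltnW. Qed.
Let jn : (j < n)%N. Proof. by case: gj => /ltnW. Qed.
Let iN : (i < n)%N. Proof. by case: gi => /ltnW. Qed.
Let g3 : genuines V [:: i; j; k].
Proof. by move=> f; rewrite !inE => /or3P[] /eqP->. Qed.
Let i3 : {in [:: i; j; k], forall f, i <= f}%N.
Proof. by move=> f; rewrite !inE => /or3P[] /eqP->; lia. Qed.
Let k3 : {in [:: i; j; k], forall f, f <= k}%N.
Proof. by move=> f; rewrite !inE => /or3P[] /eqP->; lia. Qed.
Let ik : (i <= k)%N. Proof. exact: leq_trans ij jk. Qed.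

Let D18 := table_DP F0 FF conn ik kn.
Let DpP r : Dp i k r <-> reach G (cut V [:: i; k]) set0 (V 0) (V N) r.
Proof. exact: Dp_reach. Qed.

Lemma target_Dp r : target r -> Dp i k r.
Proof.
by move=> h; apply/DpP; apply: cut_sub_reach h => f; rewrite !inE => /orP[] ->; rewrite ?orbT.
Qed.

Lemma dval_target : (forall r, Dp i k r -> target r) -> dval (T 18 i k N) target.
Proof. by move=> h; apply: dval_ext D18 _ => r; split; [apply: h | apply: target_Dp]. Qed.

Section Value.
Variables (x : state R) (y z : nat) (ay bz : R).
Hypothesis X : view n F 30 x 0 i j k.
Hypothesis (iy : (i < y)%N) (yk : (y <= k)%N) (iz : (i < z)%N) (zk : (z <= k)%N).
Hypothesis (ey : TI 20 i k N = y) (ez : TI 19 i k N = z).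
Hypothesis (eS : T 13 i y N = ay%:E) (eT : T 14 k z N = bz%:E).
Let yn : (y < n)%N. Proof. exact: leq_ltn_trans yk kn. Qed.
Let zn : (z < n)%N. Proof. exact: leq_ltn_trans zk kn. Qed.
Let jN : (j.+1 <= N)%N. Proof. by case: gj => /= + _; clear; lia. Qed.
Let dn : (N - j.+1 < n)%N. Proof. by have := n0; clear; lia. Qed.

Let poseq (u v : nat) : u = v -> pos u = pos v. Proof. by move=> ->. Qed.

Lemma view_xz : iden x xz = z.
Proof. by rewrite -ez /xz /xZ (view_I3 X) // (view_i X) (view_v X) (view_N1 X). Qed.

Lemma view_xy : iden x xy = y.
Proof. by rewrite -ey /xy /xY (view_I3 X) // (view_i X) (view_v X) (view_N1 X). Qed.

Let hSx : wden x (xS II xy) = ay%:E.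
Proof. by rewrite /xS (view_W3 X) // (view_i X) (view_N1 X) view_xy. Qed.

Let hTx : wden x (xT VV xz) = bz%:E.
Proof. by rewrite /xT (view_W3 X) // (view_v X) (view_N1 X) view_xz. Qed.

Let hdn : iden x down = (N - j.+1)%N.
Proof. by rewrite /down /= (view_N1 X) (view_j X) addn1. Qed.

Let OO : dval (wden x (W3 27 II VV N1)) (OOp G V pos i k y z).
Proof. by rewrite (view_W3 X) // (view_i X) (view_v X) (view_N1 X); apply: table_OOP. Qed.

Lemma forward_value : (y <= j < z)%N -> dval (wval x t_forward)
  (fun r => [\/ OOp G V pos i k y z r, OBp G V pos i j k y z bz r,
                BOp G V pos i j k y z ay r | BBp G V pos j y z ay bz r]).
Proof.
move=> yjz; have yz : (y <= z)%N by lia.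
apply: wval_tmin4 OO _ _ _.
+ rewrite wdenE hTx (view_W3 X) // (view_i X) (view_v X) hdn.
  apply: dval_ext (dval_shift bz (table_downAP F0 FF conn kn iy yk iz zk ey ez dn)) _ => r.
  rewrite /OBp /betZ yz; split=> [[c [u [b' [h4 h5 h6 h7]]] h8]|[u [b' [h4 h5 h6]]]].
    by exists u, b'; rewrite /gap h5; split=> //; [lia|lra].
  exists (b' + gap u z); last by lra.
  by exists u, b'; rewrite /gap; split=> //; [lia|lia|rewrite (_ : (u <= z)%N); [lra|lia]].
+ rewrite wdenE hSx (view_W3 X) // (view_i X) (view_v X) (view_j X).
  apply: dval_ext (dval_shiftl ay (table_upBP F0 FF conn kn iy yk iz zk ey ez jn)) _ => r.
  rewrite /BOp /betY yz; split=> [[c [u [b' [h4 h5 h6 h7]]] h8]|[u [b' [h4 h5 h6]]]].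
    exists u, b'; split=> //; first by lia.
    have [_ _ hg] := gapP L (u := u) (v := y) ltac:(lia) yn.
    have := line_mono L h5 ltac:(lia); rewrite /gap.
    by case: leqP => uy; [have := @poseq u y ltac:(lia); lra|lra].
  exists (b' + gap u y); last by lra.
  exists u, b'; split=> //; [lia|lia|].
  by rewrite /gap; case: leqP => uy; [have := @poseq u y ltac:(lia); lra|lra].
rewrite wdenE hTx wdenE hSx /xWW wdenE /xP (view_W3 X) // (view_W3 X) //= (view_j X) view_xy view_xz.
apply: dval_ext (dval_shift bz (dval_shiftl ay (table_WP F0 FF conn jn yn zn))) _ => r.
rewrite /BBp /betY /betZ yz; split.
  case=> c [c' [p [q [m [h4 h5 h6 h7]]]] h8] h9; exists p, q, m; split=> //.
  have [_ _ _] := gapP L (u := p) (v := y) ltac:(lia) yn.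
  rewrite /gap (_ : (q <= z)%N); last by lia.
  by case: leqP => uy; [have := @poseq p y ltac:(lia); lra|lra].
case=> p [q [m [h4 h5 h6 h7]]]; move: h7; rewrite /gap (_ : (q <= z)%N) => [h7|]; last by lia.
exists (r - bz); last by lra.
exists (r - bz - ay); last by lra.
exists p, q, m; split=> //.
by move: h7; case: leqP => uy; [have := @poseq p y ltac:(lia); lra|lra].
Qed.

Lemma backward_value : (z <= j < y)%N -> dval (wval x t_backward)
  (fun r => [\/ OOp G V pos i k y z r, OBp G V pos i j k y z bz r,
                BOp G V pos i j k y z ay r | BBp G V pos j y z ay bz r]).
Proof.
move=> zjy; have yz : (y <= z)%N = false by lia.
apply: wval_tmin4 OO _ _ _.
+ rewrite wdenE hTx (view_W3 X) // (view_i X) (view_v X) (view_j X).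
  apply: dval_ext (dval_shift bz (table_upAP F0 FF conn kn iy yk zk ey ez jn)) _ => r.
  rewrite /OBp /betZ yz; split=> [[c [u [b' [h4 h5 h6 h7]]] h8]|[u [b' [h4 h5 h6]]]].
    exists u, b'; split=> //; first by lia.
    rewrite /gap; case: leqP => uz; last by lra.
    by have := @poseq u z ltac:(lia); lra.
  exists (b' + gap u z); last by lra.
  exists u, b'; split=> //; [lia|lia|].
  by rewrite /gap; case: leqP => uy; [have := @poseq u z ltac:(lia); lra|lra].
+ rewrite wdenE hSx (view_W3 X) // (view_i X) (view_v X) hdn.
  apply: dval_ext (dval_shiftl ay (table_downBP F0 FF conn kn iy yk iz zk ey ez dn)) _ => r.
  rewrite /BOp /betY yz; split=> [[c [u [b' [h4 h5 h6 h7]]] h8]|[u [b' [h4 h5 h6]]]].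
    by exists u, b'; rewrite /gap h5; split=> //; [lia|lra].
  exists (b' + gap u y); last by lra.
  by exists u, b'; rewrite /gap; split=> //; [lia|lia|rewrite (_ : (u <= y)%N); [lra|lia]].
rewrite wdenE hTx wdenE hSx /xWW wdenE /xP (view_W3 X) // (view_W3 X) //= (view_j X) view_xy view_xz.
apply: dval_ext (dval_shift bz (dval_shiftl ay (table_WP F0 FF conn jn zn yn))) _ => r.
rewrite /BBp /betY /betZ yz; split.
  case=> c [c' [p [q [m [h4 h5 h6 h7]]]] h8] h9; exists q, p, m; split=> //.
    exact: reach_sym.
  rewrite /gap (_ : (q <= y)%N); last by lia.
  by case: leqP => uy; [have := @poseq p z ltac:(lia); lra|lra].
case=> q [p [m [h4 h5 h6 h7]]]; move: h7; rewrite /gap (_ : (q <= y)%N) => [h7|]; last by lia.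
exists (r - bz); last by lra.
exists (r - bz - ay); last by lra.
exists p, q, m; split=> //; first exact: reach_sym.
by move: h7; case: leqP => uy; [have := @poseq p z ltac:(lia); lra|lra].
Qed.
End Value.

Lemma table_ansP : dval (T 34 i j k) target.
Proof.
have [x [X hw _]] := viewP n0 Fn FF (m := 30) (i := i) (j := j) (v := k) isT erefl iN jn kn.
have := hw isT; rewrite [tid _]/= [tbody _]/= => ->.
have [z ez] : exists z, TI 19 i k N = z by exists (TI 19 i k N).
have [y ey] : exists y, TI 20 i k N = y by exists (TI 20 i k N).
have hz := view_xz X ez; have hy := view_xy X ey.
have hD : wden x (xD II VV) = T 18 i k N by rewrite /xD (view_W3 X) //; rd X.
have b0 : bden x (bor (BWLe WInfty (xD II VV)) (BILe xz lit0)) = (+oo <= T 18 i k N)%E || (z <= 0)%N.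
  by rewrite bdenE; congr (_ || _); rewrite bdenE ?hD ?hz.
have b1 : bden x (BAnd (BILe xy JJ) (blt JJ xz)) = (y <= j < z)%N.
  by rewrite bdenE; congr (_ && _); rewrite bdenE ?hy ?hz (view_j X).
have b2 : bden x (BAnd (BILe xz JJ) (blt JJ xy)) = (z <= j < y)%N.
  by rewrite bdenE; congr (_ && _); rewrite bdenE ?hy ?hz (view_j X).
rewrite /t_ans wvalE b0 [wval x (LW _)]wvalE hD.
have -> : wval x (Br (BAnd (BILe xy JJ) (blt JJ xz)) t_forward
    (Br (BAnd (BILe xz JJ) (blt JJ xy)) t_backward (LW (xD II VV)))) =
  if (y <= j < z)%N then wval x t_forward else if (z <= j < y)%N then wval x t_backward else T 18 i k N.
  by rewrite -b1 -b2 -hD.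
case: ifP => [/orP[|z0]|/norP[Doo zn0]].
- rewrite leye_eq => /eqP e; apply: dval_target => r; have := D18; rewrite e => h.
  by move/(dval_pinfty_none h).
(* With no exit found, the optimum is a travel in A, one jump, and a travel beyond [k]; such a walk
   avoids [j] as well. *)
- apply: dval_target => r hr; case: (table_ZP F0 FF iN kn) => [[z1 [e h1 _ _]]|[_ none]].
    by move: z0 h1; rewrite -ez e leqn0 => /eqP->.
  have [d eD [hd dr]] := dval_real D18 hr; apply: reach_le dr.
  case: hd => [[q [a [kq qn h1 h2]]]|[q [a [b [iq qk h1 h2 h3]]]]].
    apply: reach_le h2; apply: reach_trans (Sp_reach L g3 iN i3 h1) _.
    by apply: (t_travel L g3 qn _ (lexx _)) => f /k3; lia.
  have /negP[] := none q iq qk; rewrite eD.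
  have qn : (q < n)%N by apply: leq_ltn_trans qk kn.
  apply/(dval_add (table_UP F0 FF conn iN kn qn) (table_TP F0 FF conn kn qn)).2.
  by exists a, b.
case: (table_ZP F0 FF iN kn) => [[z1 [e iz zk hle]]|[e _]]; last by rewrite -ez e in zn0.
have {}e : z1 = z by rewrite -e.
rewrite {}e {z1} in iz zk hle.
have zn : (z < n)%N by apply: leq_ltn_trans zk kn.
have [d eD] : exists d, T 18 i k N = d%:E.
  by case: D18 Doo => n1 _; case: (T 18 i k N) n1 => [d| |] // _ _; exists d.
have hd0 : Dp i k d by apply/D18.2; rewrite eD.
have hr0 r : reach G (cut V [:: i; k]) set0 (V 0) (V N) r -> d <= r.
  by move=> /DpP /D18.2; rewrite eD lee_fin.
rewrite eD in hle.
have U15 := table_UP F0 FF conn iN kn zn; have T14 := table_TP F0 FF conn kn zn.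
have [a [b [ha hb hab]]] := ((dval_add U15 T14).2 d).1 hle.
have [u0 eU [hu0 u0a]] := dval_real U15 ha; have [bz eT [hbz bzb]] := dval_real T14 hb.
have [y1 [a1 [iy1 y1k hS1 h1 h2]]] := hu0.
have y1n : (y1 < n)%N by apply: leq_ltn_trans y1k kn.
have T20 := table_YP F0 FF conn iN kn; rewrite /= ez in T20.
(* The search for the entry succeeds: [u0] is itself a bound of [Up], and this provides an entry
   [y1] that passes the test. *)
have [[y' [e iy yk hSy]]|none] := T20 zn; last first.
  have /negP[] := none y1 iy1 y1k; rewrite eU.
  have c1 := dval_shift (gap y1 z) (table_SP F0 FF conn iN y1n).
  by apply/c1.2; exists a1 => //; apply/(gap_le F0 FF conn).
have {}e : y' = y by rewrite -e.
rewrite {}e {y'} in iy yk hSy; clear T20.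
have yn : (y < n)%N by apply: leq_ltn_trans yk kn.
have S13 := table_SP F0 FF conn iN yn.
have [a2 ha2 h3] : exists2 a2, Sp i y a2 & a2 + gap y z <= u0.
  by apply/(dval_shift (gap y z) S13).2; rewrite -eU.
have [ay eS [hay aya]] := dval_real S13 ha2.
have hyz : ay + gap y z + bz <= d by lra.
have thr sep := threeP L gi gj gk ij jk iy yk iz zk sep hay hbz hr0 hyz.
case: ifP => [yjz|nyjz]; last (case: ifP => [zjy|nzjy]).
- have sep : (y <= j < z)%N || (z <= j < y)%N by rewrite yjz.
  by apply: dval_ext (forward_value X iy yk iz zk ey ez eS eT yjz) (thr sep).
- have sep : (y <= j < z)%N || (z <= j < y)%N by rewrite zjy orbT.
  by apply: dval_ext (backward_value X iy yk iz zk ey ez eS eT zjy) (thr sep).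
(* Here [j] does not separate [y] from [z], so the optimal route for [i] and [k] survives the
   removal of [j]. *)
apply: dval_target => r /D18.2; rewrite eD lee_fin => dr.
have [g1 g2 _] := gapP L yn zn.
apply: reach_le (_ : ay + gap y z + bz <= r); last by lra.
apply: reach_trans (Tp_reach L g3 k3 hbz); apply: reach_trans (Sp_reach L g3 iN i3 hay) _.
apply: (travel L g3) => //; clear -nyjz nzjy iy yk iz zk.
by move=> f; rewrite !inE => /or3P[] /eqP->; lia.
Qed.

End Triple.
End Tables34.

(** * The output path and its distances *)

Section Final.
Variables (R : realType) (n : nat) (G : wgraph R n) (s t : 'I_n) (F : state R).
Local Notation N := n.-1.
Hypothesis F0 : forall a, imem F 0 a = imem (input G s t) 0 a /\
                          wmem F 0 a = wmem (input G s t) 0 a.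
Hypothesis FF : filled F.
Local Notation T := (wcell n F).
Local Notation TI := (icell n F).
Local Notation V := (Vt s F).
Hypothesis conn : exists p, is_path G s t p.

Let n0 := n_gt0 s.
Let Fn := Fn F0.
Let Nn : (N < n)%N. Proof. by have := n0; lia. Qed.
Local Notation pos := (post s F).
Let L := line_path F0 FF conn.
Local Notation Mp := (Mp G V).
Local Notation Sp := (Sp G V pos).
Local Notation Tp := (Tp G V pos).
Local Notation Up := (Up G V pos).
Local Notation Dp := (Dp G V pos).
Local Notation sgp := (sgp G V pos).
Local Notation tgp := (tgp G V pos).
Local Notation gap := (gap pos).

Lemma table_outP a b c : genuine V a -> genuine V b -> genuine V c ->
  dval (T 1 a b c) (reach G (cut V [:: a; b; c]) set0 s t).
Proof.
move=> ga gb gc.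
have an : (a < n)%N by case: ga => /ltnW.
have bn : (b < n)%N by case: gb => /ltnW.
have cn : (c < n)%N by case: gc => /ltnW.
have perm (fs fs' : seq nat) : fs =i fs' -> forall x, dval x (reach G (cut V fs) set0 (V 0) (V N)) ->
    dval x (reach G (cut V fs') set0 s t).
  move=> e x; rewrite (V0 F0 FF conn) (V_last F0 FF (leqnn N)) => h.
  suff -> : cut V fs' = cut V fs by [].
  by apply/setP => d; rewrite !inE; apply/mapP/mapP => -[f hf ->]; exists f; rewrite // ?e // -?e.
have [x [X hw _]] := viewP n0 Fn FF (m := 31) (i := a) (j := b) (v := c) isT erefl an bn cn.
have := hw isT; rewrite [tid _]/= [tbody _]/= => ->; rewrite /t_out; rd X.
have sort3 (f g h : nat) : [/\ [:: f; g; h] =i [:: f; h; g], [:: f; g; h] =i [:: h; f; g],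
    [:: f; g; h] =i [:: g; f; h], [:: f; g; h] =i [:: g; h; f] & [:: f; g; h] =i [:: h; g; f]].
  by split=> d; rewrite !inE; case: (d == f); case: (d == g); case: (d == h).
case: (leqP a b) => ab; case: (leqP b c) => bc; case: (leqP a c) => ac; try lia.
- by apply: (perm [:: a; b; c]) => //; apply: table_ansP.
- by apply: (perm [:: a; c; b]); [case: (sort3 a c b)|apply: table_ansP => //; apply: ltnW].
- by apply: (perm [:: c; a; b]); [case: (sort3 c a b)|apply: table_ansP => //; apply: ltnW].
- by apply: (perm [:: b; a; c]); [case: (sort3 b a c)|apply: table_ansP => //; apply: ltnW].
- by apply: (perm [:: b; c; a]); [case: (sort3 b c a)|apply: table_ansP => //; apply: ltnW].
- by apply: (perm [:: c; b; a]); [case: (sort3 c b a)|apply: table_ansP => //; apply: ltnW].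
Qed.

Variable l : nat.
Hypothesis hl : is_nedges G s t F l.
Let lN : (l <= N)%N. Proof. by case: hl. Qed.
Definition shortest : seq 'I_n := [seq V h | h <- iota 1 l].

Lemma iota_edges a m : path_edges (V a) [seq V h | h <- iota a.+1 m] = [seq pedge V h | h <- iota a m].
Proof. by elim: m a => //= m IH a; rewrite path_edges_cons IH. Qed.

Lemma shortest_edges : path_edges s shortest = [seq pedge V h | h <- iota 0 l].
Proof. by rewrite -iota_edges (V0 F0 FF conn). Qed.

Lemma iota_path a m : (a + m <= l)%N ->
  path (adj G) (V a) [seq V h | h <- iota a.+1 m] /\
  path_length G (V a) [seq V h | h <- iota a.+1 m] = pos (a + m) - pos a.
Proof.
have [_ mv _] := hl.
elim: m a => [|m IH] a am; first by rewrite addn0 subrr /path_length /path_edges big_nil.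
have [hE hw _] := mv a ltac:(lia); have [|h1 h2] := IH a.+1; first by lia.
rewrite /= path_length_cons h1 h2 hw addSnnS; split; last by lra.
by rewrite andbT.
Qed.

Lemma size_shortest : size shortest = l. Proof. by rewrite size_map size_iota. Qed.

Lemma nth_shortest h : (h <= l)%N -> nth s (s :: shortest) h = V h.
Proof.
move=> hh; have -> : s :: shortest = [seq V h | h <- iota 0 l.+1] by rewrite /= (V0 F0 FF conn).
by rewrite (nth_map 0%N) ?size_iota // nth_iota.
Qed.

Lemma shortest_is_path : is_path G s t shortest.
Proof.
have [_ mv tl] := hl.
have [h1 _] := @iota_path 0 l (leqnn _); rewrite (V0 F0 FF conn) in h1.
rewrite /is_path h1 /=; apply/andP; split.
  have /= <- := nth_last s (s :: shortest).
  by rewrite size_shortest nth_shortest // tl.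
rewrite -/(uniq (s :: shortest)).
have -> : s :: shortest = [seq V h | h <- iota 0 l.+1] by rewrite /= (V0 F0 FF conn).
rewrite map_inj_in_uniq ?iota_uniq // => a b; rewrite !mem_iota /= => al bl e.
case: (ltngtP a b) => // ab.
  by case: (V_inj F0 FF conn mv lN ab _ e); lia.
by case: (V_inj F0 FF conn mv lN ab _ (esym e)); lia.
Qed.

Lemma shortest_shortest : shortest_path G s t shortest.
Proof.
split; first exact: shortest_is_path.
have [_ mv tl] := hl; have ln : (l < n)%N by lia.
have [_] := @iota_path 0 l (leqnn _); rewrite (V0 F0 FF conn) add0n => ->.
move=> q /and3P[h1 /eqP h2 _].
have h3 : reach G set0 set0 (V 0) (V l) (path_length G s q).
  rewrite (V0 F0 FF conn) tl //; apply: path_reach => //.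
  by apply: sub_path h1 => x y; rewrite /adj !inE.
by have [_] := line_short L n0 ln h3.
Qed.

Lemma shortest_pos d : d \in path_edges s shortest ->
  genuine V (index d (path_edges s shortest)) /\ d = pedge V (index d (path_edges s shortest)).
Proof.
move=> hd; have := hd; rewrite -index_mem {2}shortest_edges size_map size_iota => il.
split; first exact: (V_genuine F0 FF conn hl).
rewrite -{1}(nth_index set0 hd) {1}shortest_edges (nth_map 0%N) ?size_iota //.
by rewrite nth_iota.
Qed.

Lemma outputs_dist d1 d2 d3 : d1 \in path_edges s shortest -> d2 \in path_edges s shortest ->
  d3 \in path_edges s shortest ->
  is_dist (remove G [set d1; d2; d3]) s t (output_at F s shortest d1 d2 d3).
Proof.
move=> /shortest_pos[g1 e1] /shortest_pos[g2 e2] /shortest_pos[g3 e3].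
apply: dval_reach_dist.
suff -> : [set d1; d2; d3] = cut V [:: index d1 (path_edges s shortest);
    index d2 (path_edges s shortest); index d3 (path_edges s shortest)] by exact: table_outP.
by apply/setP => d; rewrite !inE /= -e1 -e2 -e3 orbA.
Qed.

End Final.

(** * Running time and conclusion *)

Definition factor := \sum_(T <- tables) (depth (tbody T) + 4)%N.
(** A cell costs a test, at most [depth] steps and an increment of the counter. Two more units per
    cell in [factor] absorb the initialisation and the last test of each loop; the final 1 is the
    store of the number of edges. *)
Definition time n := (n ^ 3 * (trunc_log 2 n).+1 * factor + 1)%N.

Lemma time_soft_O : soft_O time (fun n => (n ^ 3)%N).
Proof.
(* From [n = 2] on the logarithm is at least 1: adding 1 to it at most doubles it, and the trailing
   1 is at most [n ^ 3] times it. *)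
exists (2 * factor + 1)%N, 1%N, 2%N => n n2; rewrite /time expn1.
have l1 : (0 < trunc_log 2 n)%N by rewrite trunc_log_gt0.
have n31 : (0 < n ^ 3)%N by rewrite expn_gt0; lia.
move: (trunc_log 2 n) l1 (n ^ 3)%N n31 factor => lg l1 m m1 K; nia.
Qed.

Lemma good_input (R : realType) n (G : wgraph R n) (s t : 'I_n) : good n (input G s t).
Proof.
have hs := ltn_ord s; have ht := ltn_ord t.
have h : forall i, (nth 0%N [:: n; nat_of_ord s; nat_of_ord t] i < n.+2)%N.
  by case=> [|[|[|[|i]]]] //=; lia.
split=> //= a i; case: ifP => _; last by rewrite expn_gt0.
by apply: leq_trans (h i) _; rewrite -{1}(expn1 n.+2) leq_pexp2l.
Qed.

Lemma leq_sum_all (I : Type) (r : seq I) (f g : I -> nat) :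
  all (fun x => f x <= g x)%N r -> (\sum_(x <- r) f x <= \sum_(x <- r) g x)%N.
Proof.
elim: r => [|x r IH]; first by rewrite !big_nil.
by case/andP => h1 /IH h2; rewrite !big_cons leq_add.
Qed.

Theorem theorem38 :
  exists (A : cmd) (c : nat) (T : nat -> nat),
    soft_O T (fun n => (n ^ 3)%N) /\
    forall (R : realType) (n : nat) (G : wgraph R n) (s t : 'I_n),
      exists (k : nat) (st : state R),
        exec (n.+2 ^ c)%N A (input G s t) k st /\
        (k <= T n)%N /\
        ((exists p, is_path G s t p) ->
         exists p : seq 'I_n,
           shortest_path G s t p /\
           outputs_path st s p /\
           forall d1 d2 d3 : {set 'I_n},
             d1 \in path_edges s p ->
             d2 \in path_edges s p ->
             d3 \in path_edges s p ->
             is_dist (remove G [set d1; d2; d3]) s t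
               (output_at st s p d1 d2 d3)).
Proof.
exists program, 30, time; split; first exact: time_soft_O.
move=> R n G s t; have n0 : (0 < n)%N := n_gt0 s.
have [k [F [ex gF hk fr cells]]] :=
  fill_all_exec n0 (isT : (6 <= 30)%N) wf_program isT (good_input G s t).
have F0 a : imem F 0 a = imem (input G s t) 0 a /\ wmem F 0 a = wmem (input G s t) 0 a.
  exact: (fr 0%N isT isT a).
have FF : filled F by [].
have Fn : imem F 0 0 = n by exact: (Fn F0).
pose st := iset F 1 0 (icell n F 7 0 0 n.-1).
have eI := iden_size Fn 7.
have ex2 : exec (n.+2 ^ 30)%N (IPut 1 lit0 (I3 7 lit0 lit0 N1)) F 1 st.
  apply: ExecIPut; first by rewrite (proj1 (ieval_ok n0 (isT : (6 <= 30)%N) gF _)).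
  by rewrite (proj1 (ieval_ok n0 (isT : (6 <= 30)%N) gF _)) // eI.
exists (k + 1)%N, st; split; first exact: ExecSeq ex ex2.
split.
  rewrite /time leq_add2r; apply: leq_trans hk _.
  have n3E : iden F n3 = (n ^ 3)%N by rewrite /n3 /nn /= Fn !expnS expn0 muln1 mulnA.
  have n3le : (iden F n3log <= n ^ 3 * (trunc_log 2 n).+1)%N.
    rewrite (iden_n3log Fn) (table_logP n0 Fn FF) ?prednK //.
    rewrite (_ : (n * n * n = n ^ 3)%N); last by rewrite !expnS expn0 muln1 mulnA.
    rewrite leq_mul2l addn1 ltnS; apply/orP; right.
    by apply: leq_trans (leq_mod _ _) _; apply: leq_trunc_log; apply: leq_pred.
  have n31 : (0 < n ^ 3)%N by rewrite expn_gt0 n0.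
  have term b d : (iden F b <= n ^ 3 * (trunc_log 2 n).+1)%N ->
      (iden F b * (d + 2) + 2 <= n ^ 3 * (trunc_log 2 n).+1 * (d + 4))%N.
    move: (iden F b) (n ^ 3)%N n31 (trunc_log 2 n) => u m m1 lg h; nia.
  have bnds : all (fun T => (iden F (tbound T) <= n ^ 3 * (trunc_log 2 n).+1)%N) tables.
    have h3 : (iden F n3 <= n ^ 3 * (trunc_log 2 n).+1)%N by rewrite n3E leq_pmulr.
    by rewrite /tables; do ?[apply/andP; split]; rewrite ?h3 ?n3le.
  rewrite /factor big_distrr; apply: leq_sum_all; apply: sub_all bnds => T; apply: term.
move=> conn; have [l hl] := is_nedgesP F0 FF conn.
have lN : (l <= n.-1)%N by case: hl.
exists (shortest s F l); split; first exact: shortest_shortest.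
split; last exact: outputs_dist.
split; first by rewrite /= /upd /= (table_sizeP F0 FF conn hl) size_shortest.
move=> i; rewrite size_shortest => il; rewrite (nth_shortest F0 FF conn il).
by rewrite /= /upd /= (table_pathP F0 FF) //; lia.
Qed.
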